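(* Fix $t>1$. For each $N\ge1$ let $G=G_N$ be an $N\times N$ complex Ginibre matrix (i.i.d. $\mathcal{N}_{\mathbb{C}}(0,1/N)$ entries), let $v=v_N\in\mathbb{C}^N$ be a unit vector independent of $G$, and set $G(t)=G+t\,vv^*$ (all defined on a common probability space). Let $\lambda_1(t)$ be the outlier eigenvalue of $G(t)$ and let $\mathscr{O}_{11}$ be the diagonal overlap of $G(t)$ associated with $\lambda_1(t)$. Then $$\mathscr{O}_{11}\xrightarrow[N\to\infty]{\text{a.s.}}\left(\frac{t^2}{t^2-1}\right)^2.$$
   Context: $\mathcal{N}_{\mathbb{C}}(0,1/N)$ denotes the centered circularly symmetric complex Gaussian law with $\mathbb{E}|G_{ij}|^2=1/N$. Outlier: it is known that almost surely, for $N$ large enough, $G(t)$ has exactly one eigenvalue in a (small, fixed) neighborhood of the point $t$, while all other eigenvalues lie in an arbitrarily small neighborhood of the closed unit disk. This eigenvalue is the outlier $\lambda_1(t)$, and $\lambda_1(t)\to t$ almost surely. (One may take $\lambda_1(t)$ to be the eigenvalue of $G(t)$ closest to $t$.) Overlaps: for a matrix $M$ with simple spectrum $\{\lambda_1,\dots,\lambda_N\}$, let $R_i$ be right eigenvectors ($MR_i=\lambda_iR_i$) and $L_i$ left eigenvectors ($L_i^*M=\lambda_iL_i^*$), normalized by $\langle L_i|R_j\rangle=L_i^*R_j=\delta_{ij}$. The matrix of overlaps is $\mathscr{O}_{ij}=\langle L_i|L_j\rangle\langle R_j|R_i\rangle$; in particular $\mathscr{O}_{ii}=\|L_i\|^2\|R_i\|^2$,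 with Euclidean norms. *)

(* Defs.v *)
From HB Require Import structures.
From mathcomp Require Import all_boot all_order all_algebra.
From mathcomp Require Import complex.
From mathcomp Require Import all_classical all_reals all_analysis.

Set Implicit Arguments.
Unset Strict Implicit.
Unset Printing Implicit Defensive.

Import Order.TTheory GRing.Theory Num.Theory.
Import numFieldNormedType.Exports.

Local Open Scope classical_set_scope.
Local Open Scope ring_scope.

Section LinearAlgebra.
Context {R : realType}.
Local Notation C := (R[i]).

Definition adjmx {m n : nat} (A : 'M[C]_(m, n)) : 'M[C]_(n, m) :=
  map_mx Num.conj A^T.

(* Antilinear in the first argument. *)
Definition inner {n : nat} (x y : 'cV[C]_n) : C := (adjmx x *m y) 0 0.

(* Injectivity of [lam] makes the spectrum of [M] simple, the [lam i] being
   then all its eigenvalues. *)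
Definition biorthogonal_eigensystem {n : nat} (M : 'M[C]_n)
    (lam : 'I_n -> C) (L Rv : 'I_n -> 'cV[C]_n) : Prop :=
  [/\ injective lam,
      forall i, M *m Rv i = lam i *: Rv i,
      forall i, adjmx (L i) *m M = lam i *: adjmx (L i) &
      forall i j, inner (L i) (Rv j) = (i == j)%:R].

Definition overlap {n : nat} (L Rv : 'I_n -> 'cV[C]_n) (i j : 'I_n) : C :=
  inner (L i) (L j) * inner (Rv j) (Rv i).

(* When [M] has simple spectrum and [z] is an eigenvalue of [M], the overlap
   below is a nonnegative real that does not depend on the chosen eigensystem.
   In all other cases the value is the dummy 0; a genuine diagonal overlap is
   at least 1 by Cauchy-Schwarz. *)
Definition diag_overlap {n : nat} (M : 'M[C]_n) (z : C) : R :=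
  xget 0 [set o : R | exists (lam : 'I_n -> C) (L Rv : 'I_n -> 'cV[C]_n)
    (i : 'I_n), [/\ biorthogonal_eigensystem M lam L Rv, lam i = z &
                    overlap L Rv i i = (o%:C)%C]].

(* The eigenvalue of [M] closest to [t]; ties are broken by choice. *)
Definition outlier {n : nat} (M : 'M[C]_n) (t : R) : C :=
  xget 0 [set z : C | eigenvalue M z /\
    forall w : C, eigenvalue M w -> `|z - (t%:C)%C| <= `|w - (t%:C)%C|].

End LinearAlgebra.

Section Probability.
Context {d : measure_display} {T : measurableType d} {R : realType}.
Variable P : probability T R.
Local Notation C := (R[i]).

(* Complex random variables are handled through R^2, which carries the Borel
   sigma-algebra. *)
Definition coords (z : C) : R * R := (complex.Re z, complex.Im z).

Definition complex_rv (Z : T -> C) : Prop :=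
  measurable_fun [set: T] (coords \o Z).

Definition sigma_rv (Z : T -> C) : set_system T :=
  g_sigma_algebra_preimage (coords \o Z).

Definition sigma_mx {m n : nat} (M : T -> 'M[C]_(m, n)) : set_system T :=
  <<s \bigcup_(ij in [set: 'I_m * 'I_n])
        sigma_rv (fun w => M w ij.1 ij.2) >>.

Definition independent2 (F F' : set_system T) : Prop :=
  forall A B : set T, F A -> F' B -> P (A `&` B) = (P A * P B)%E.

Definition mutually_independent {I : finType} (F : I -> set_system T) : Prop :=
  forall (J : {set I}) (A : I -> set T), (forall i, i \in J -> F i (A i)) ->
    P (\bigcap_(i in [set` J]) A i) = (\prod_(i in J) P (A i))%E.

(* N_C(0, s2): the real and imaginary parts are independent centered real
   Gaussians of variance s2 / 2 each; [normal_prob] takes the standard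
   deviation. *)
Definition complex_gaussian (s2 : R) : set (R * R) -> \bar R :=
  (normal_prob 0 (Num.sqrt (s2 / 2)) \x normal_prob 0 (Num.sqrt (s2 / 2)))%E.

Definition has_complex_gaussian_law (Z : T -> C) (s2 : R) : Prop :=
  forall B : set (R * R), measurable B ->
    P ((coords \o Z) @^-1` B) = complex_gaussian s2 B.

Definition ginibre {n : nat} (G : T -> 'M[C]_n) : Prop :=
  [/\ forall i j, complex_rv (fun w => G w i j),
      forall i j, has_complex_gaussian_law (fun w => G w i j) n%:R^-1 &
      mutually_independent
        (fun ij : 'I_n * 'I_n => sigma_rv (fun w => G w ij.1 ij.2))].

Definition random_unit_vector {n : nat} (v : T -> 'cV[C]_n) : Prop :=
  (forall i, complex_rv (fun w => v w i 0)) /\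
  (forall w, inner (v w) (v w) = 1).

End Probability.

Definition rank_one_perturbation {R : realType} {n : nat} (G : 'M[R[i]]_n)
    (v : 'cV[R[i]]_n) (t : R) : 'M[R[i]]_n :=
  G + (t%:C)%C *: (v *m adjmx v).

(* Main.v *)
From HB Require Import structures.
Require Import Defs.
From mathcomp Require Import all_boot all_order all_algebra.
From mathcomp Require Import complex.
From mathcomp Require Import all_classical all_reals all_analysis.
From mathcomp Require Import ring lra spectral.
From mathcomp Require Import measurable_realfun normal_distribution.

Set Implicit Arguments.
Unset Strict Implicit.
Unset Printing Implicit Defensive.

Import Order.TTheory GRing.Theory Num.Theory.
Import numFieldNormedType.Exports.
Local Open Scope classical_set_scope.
Local Open Scope ring_scope.

(** Write M = G + t v v^* and R(z) = (z - G)^-1. Because the perturbation has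
    rank one, a number z outside the spectrum of G is an eigenvalue of M exactly
    when t v^* R(z) v = 1; its right and left eigenvectors are then R(z) v and
    v^* R(z), and its overlap is
      |v^* R(z)|^2 |R(z) v|^2 / |v^* R(z) R(z) v|^2
    ([rank_one_eigenvalue], [diag_overlap_value]). For |z|, |w| >= r > 1 and a
    large size N,
      v^* R(z) v ~ 1/z,  v^* R(z) R(w) v ~ 1/(zw),
      |R(z) v|^2 ~ |v^* R(z)|^2 ~ 1/(|z|^2 - 1).
    The outlier is then the only fixed point near t of the contraction
    z -> t z v^* R(z) v ([outlier_fixed_point]), it converges to t, and the
    overlap converges to (t^2 - 1)^-2 / t^-4.

    These estimates hold because G acts on v almost like a shift. The law of G
    is invariant under a unitary change of basis, even a random one, as long as
    the latter depends only on v and on columns that have been revealed. So G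
    is brought to Hessenberg form one column at a time, in a basis that starts
    with v ([krylov_hessenberg]). A Gaussian column has small entries and a
    length close to 1, hence the first K columns of the Hessenberg form are
    close to those of the shift e_j -> e_(j+1), and G^k v is close to the k-th
    basis vector ([krylov_shift]). In the Neumann series of R(z) v the terms of
    degree less than m = K/2 give the announced values. The same reduction with
    each canonical basis vector in place of v bounds the entries of G^k by 2
    ([hess_pow_entry]); the remainder is thus at most a power of N times r^-m
    ([resolvent_bound]). The left vectors of G are the right vectors of the
    transpose of G, which has the same law.

    With m of order N^(1/8) all errors tend to 0, and the exceptional events
    have probabilities O(N^-2) ([risk_bound]), so that only finitely many of
    them occur ([eventually_of_holds_off]).

    The overlap is defined by an eigensystem, which exists as soon as the
    spectrum is simple. This is almost sure: the determinant of the matrix of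
    the traces of M^(i+j) is the discriminant of the spectrum and a polynomial
    in the entries of M, so that it does not vanish once the real parts of the
    diagonal entries are drawn, one after the other, outside finite sets
    ([ae_discr_neq0]). *)

(** * Rotation invariance of the Gaussian law *)

Definition mfun_of d1 d2 (T1 : measurableType d1) (T2 : measurableType d2)
    (f : T1 -> T2) (mf : measurable_fun setT f) : {mfun T1 >-> T2} :=
  HB.pack f (isMeasurableFun.Build _ _ _ _ _ mf).

Section Density.
Context d (T : measurableType d) (R : realType).
Variables (mu nu : {measure set T -> \bar R}) (p : T -> R).
Hypothesis mp : measurable_fun setT p.
Hypothesis p0 : forall x, 0 <= p x.
Hypothesis nuE : forall A, measurable A -> nu A = (\int[mu]_(x in A) (p x)%:E)%E.
Import HBNNSimple.
Local Open Scope ereal_scope.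

(** Monotone convergence extends the defining property of the density from
    indicator functions. *)
Lemma ge0_integral_density (f : T -> \bar R) :
  measurable_fun setT f -> (forall x, 0 <= f x) ->
  \int[nu]_x f x = \int[mu]_x (f x * (p x)%:E).
Proof.
move=> mf f0.
pose g := nnsfun_approx measurableT mf.
have Ep : measurable_fun setT (EFin \o p) by exact/measurable_EFinP.
transitivity (limn (fun n => \int[nu]_x (g n x)%:E)).
  rewrite -monotone_convergence//.
  - by apply: eq_integral => x _; apply/esym/cvg_lim => //; exact: cvg_nnsfun_approx.
  - by move=> n; exact/measurable_EFinP.
  - by move=> n x _; rewrite lee_fin.
  - by move=> x _ a b ab; rewrite lee_fin; exact/lefP/nd_nnsfun_approx.
transitivity (limn (fun n => \int[mu]_x ((g n x)%:E * (p x)%:E))); last first.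
  rewrite -monotone_convergence//.
  - apply: eq_integral => x _; apply/cvg_lim => //.
    by apply: cvgeZr => //; exact: cvg_nnsfun_approx.
  - by move=> n; apply: emeasurable_funM => //; exact/measurable_EFinP.
  - by move=> n x _; rewrite mule_ge0// lee_fin.
  - move=> x _ a b ab; rewrite lee_wpmul2r// ?lee_fin//.
    exact/lefP/nd_nnsfun_approx.
apply/congr_lim/funext => n.
have mi y : measurable_fun setT (fun x => (\1_(g n @^-1` [set y]) x)%:E : \bar R).
  by apply/measurable_EFinP; exact: measurable_indic.
have myi (y : R) : measurable_fun setT
    (fun x => y%:E * (\1_(g n @^-1` [set y]) x)%:E : \bar R).
  by apply: emeasurable_funM.
transitivity (\int[nu]_x
    \sum_(y \in range (g n)) (y%:E * (\1_(g n @^-1` [set y]) x)%:E)).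
  by apply: eq_integral => x _; rewrite fimfunE -fsumEFin.
rewrite ge0_integral_fsum//; last first.
  by move=> y x _; exact: nnfun_muleindic_ge0.
transitivity (\int[mu]_x
    \sum_(y \in range (g n)) (y%:E * (\1_(g n @^-1` [set y]) x)%:E * (p x)%:E)).
  rewrite ge0_integral_fsum//; last 2 first.
  - by move=> y; apply: emeasurable_funM.
  - by move=> y x _; rewrite mule_ge0 ?lee_fin//; exact: nnfun_muleindic_ge0.
  apply: eq_fsbigr => y /[!inE] -[z _ yE].
  have y0 : (0 <= y)%R by rewrite -yE.
  rewrite ge0_integralZl//.
  rewrite integral_indic// setIT nuE//.
  under [RHS]eq_integral do rewrite -muleA.
  rewrite ge0_integralZl//; last 2 first.
  - by apply: emeasurable_funM.
  - by move=> x _; rewrite mule_ge0 ?lee_fin.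
  rewrite integral_mkcond; congr (_ * _); apply: eq_integral => x _.
  rewrite patchE indicE; case: ifP => _; by rewrite ?mul1e ?mul0e.
apply: eq_integral => x _.
rewrite [in RHS]fimfunE -fsumEFin// ge0_mule_fsuml//.
by move=> y; exact: nnfun_muleindic_ge0.
Qed.
End Density.

Section Lebesgue.
Context (R : realType).
Notation mu := (@lebesgue_measure R).
Local Open Scope ereal_scope.

Lemma ge0_integral_translation (a : R) (f : R -> \bar R) :
  measurable_fun setT f -> (forall x, 0 <= f x) ->
  \int[mu]_x f (x + a)%R = \int[mu]_x f x.
Proof.
move=> mf f0.
have ma : measurable_fun setT (fun x : measurableTypeR R => (x + a)%R : measurableTypeR R).
  exact: measurable_funD.
transitivity (\int[pushforward mu (mfun_of ma)]_x f x).
  by rewrite ge0_integral_pushforward//=.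
apply: eq_measure_integral => A mA _.
apply/esym/lebesgue_measure_unique => // X [[x y] /= xy <-].
rewrite /pushforward.
have -> : mfun_of ma @^-1` `]x, y] = `](x - a)%R, (y - a)%R]%classic.
  by apply/seteqP; split => z /=; rewrite !in_itv/= ltrBlDr lerBrDr.
rewrite !lebesgue_measure_itv/= !lte_fin ltrD2r.
by case: ifP => // _; rewrite -!EFinD; congr EFin; rewrite opprB addrA subrK.
Qed.

Let q (f : R * R -> \bar R) := \int[mu]_x \int[mu]_y f (x, y).

Let mpair (g h : R * R -> R) (mg : measurable_fun setT g) (mh : measurable_fun setT h)
    (f : R * R -> \bar R) : measurable_fun setT f ->
  measurable_fun setT (fun z => f (g z, h z)).
Proof. by move=> mf; apply: measurableT_comp => //; exact: measurable_fun_pair. Qed.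

Let shear2 (a : R) (f : R * R -> \bar R) :
  measurable_fun setT f -> (forall x, 0 <= f x) ->
  q (fun z => f (z.1, z.2 + a * z.1)%R) = q f.
Proof.
move=> mf f0; apply: eq_integral => x _ /=.
rewrite (@ge0_integral_translation (a * x)%R (fun y => f (x, y)))//.
exact: measurableT_comp.
Qed.

Let shear1 (a : R) (f : R * R -> \bar R) :
  measurable_fun setT f -> (forall x, 0 <= f x) ->
  q (fun z => f (z.1 + a * z.2, z.2)%R) = q f.
Proof.
move=> mf f0.
have F (g : R * R -> \bar R) : measurable_fun setT g -> (forall x, 0 <= g x) ->
    q g = \int[mu]_y \int[mu]_x g (x, y).
  move=> mg g0.
  exact: (@fubini_tonelli _ _ _ _ _ mu mu g mg g0).
have ms : measurable_fun setT (fun z : R * R => f (z.1 + a * z.2, z.2)%R).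
  by apply: mpair => //; apply: measurable_funD => //; exact: measurable_funM.
rewrite (F f mf f0) (F _ ms (fun z => f0 _)).
apply: eq_integral => y _ /=.
rewrite (@ge0_integral_translation (a * y)%R (fun x => f (x, y)))//.
exact: measurableT_comp.
Qed.

(** A rotation of the plane is a product of three shears, and each shear
    preserves the measure by Fubini and translation invariance; the rotation by
    pi, for which the half-angle tangent does not exist, is the square of the
    rotation by pi/2. *)
Lemma ge0_integral_rotation (c s : R) (f : R * R -> \bar R) :
  measurable_fun setT f -> (forall x, 0 <= f x) -> (c ^+ 2 + s ^+ 2 = 1)%R ->
  \int[mu]_x \int[mu]_y f (c * x - s * y, s * x + c * y)%R =
  \int[mu]_x \int[mu]_y f (x, y).
Proof.
have gen (c' s' : R) g : measurable_fun setT g -> (forall x, 0 <= g x) ->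
    (c' ^+ 2 + s' ^+ 2 = 1)%R -> (c' != -1)%R ->
    q (fun z => g (c' * z.1 - s' * z.2, s' * z.1 + c' * z.2)%R) = q g.
  move=> mg g0 cs c1; pose t := (s' / (1 + c'))%R.
  have c0 : (1 + c' != 0)%R by rewrite addrC addr_eq0.
  pose g1 z := g (z.1 + (- t) * z.2, z.2)%R.
  pose g2 z := g1 (z.1, z.2 + s' * z.1)%R.
  have mg1 : measurable_fun setT g1.
    by apply: mpair => //; apply: measurable_funD => //; exact: measurable_funM.
  have mg2 : measurable_fun setT g2.
    by apply: mpair => //; apply: measurable_funD => //; exact: measurable_funM.
  rewrite -(shear1 (- t) mg g0) -(shear2 s' mg1 (fun z => g0 _)).
  rewrite -(shear1 (- t) mg2 (fun z => g0 _)).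
  apply: eq_integral => x _; apply: eq_integral => y _.
  have st : (s' * t = 1 - c')%R.
    by rewrite /t mulrA; apply: (mulIf c0); rewrite divfK// -expr2 -(addrC c') ; lra.
  have tc : (t + t * c' = s')%R by rewrite -[X in (X + _)%R]mulr1 -mulrDr divfK.
  have e2 : (y + s' * (x + (- t) * y) = s' * x + c' * y)%R.
    by rewrite mulrDr mulrA mulrN st; ring.
  have e1 : (x + (- t) * y + (- t) * (s' * x + c' * y) = c' * x - s' * y)%R.
    transitivity ((1 - s' * t) * x - (t + t * c') * y)%R; first by ring.
    by rewrite st tc; ring.
  by rewrite /g2 /g1 /= e2 e1.
move=> mf f0 cs; have [c1|c1] := eqVneq c (-1)%R; last exact: (gen c s f).
have s0 : s = 0%R by apply/eqP; rewrite -sqrf_eq0; apply/eqP; move: cs; rewrite c1; lra.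
have cs01 : (0 ^+ 2 + 1 ^+ 2 = 1 :> R)%R by rewrite expr0n expr1n add0r.
have c01 : (0 != -1 :> R)%R by rewrite eq_sym oppr_eq0 oner_eq0.
pose f1 z := f (0 * z.1 - 1 * z.2, 1 * z.1 + 0 * z.2)%R.
have mf1 : measurable_fun setT f1.
  apply: mpair => //.
    by apply: measurable_funB => //; exact: measurable_funM.
  by apply: measurable_funD => //; exact: measurable_funM.
have E1 : q f1 = q f by exact: gen.
have := gen 0%R 1%R f1 mf1 (fun z => f0 _) cs01 c01.
rewrite E1 -/(q f) => <-; apply: eq_integral => x _; apply: eq_integral => y _.
by rewrite /f1 /= c1 s0; congr (f (_, _)); ring.
Qed.

End Lebesgue.

Lemma measure_integral_indic d (T : measurableType d) (R : realType)
    (mu : {measure set T -> \bar R}) (A : set T) : measurable A ->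
  mu A = (\int[mu]_x (\1_A x)%:E)%E.
Proof. by move=> mA; rewrite integral_indic// setIT. Qed.

(** The exponents at x^2 = y of exp (l x^2) times the density of variance a,
    and of the density of variance a / (1 - 2 l a). *)
Lemma gauss_exponent (F : numFieldType) (l a y : F) : a != 0 ->
  l * y + - y * (a^-1 * 2^-1) = - y * (a^-1 * (1 - 2 * l * a) * 2^-1).
Proof. by move=> a0; field; rewrite a0. Qed.

Section Gauss.
Context (R : realType) (sg : R).
Hypothesis sg0 : sg != 0.
Notation mu := (@lebesgue_measure R).
Notation gam := (normal_prob 0 sg : probability (measurableTypeR R) R).
Local Open Scope ereal_scope.

Lemma ge0_integral_normal (f : R -> \bar R) : measurable_fun setT f ->
  (forall x, 0 <= f x) ->
  \int[gam]_x f x = \int[mu]_x (f x * (normal_pdf 0 sg x)%:E).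
Proof.
move=> mf f0; apply: ge0_integral_density => //.
- exact: measurable_normal_pdf.
- by move=> x; exact: normal_pdf_ge0.
Qed.

Let p (x : R) := normal_pdf 0 sg x.
Let p0 (x : R) : 0 <= (p x)%:E. Proof. by rewrite lee_fin normal_pdf_ge0. Qed.
Let mp : measurable_fun setT (fun x => (p x)%:E).
Proof. by apply/measurable_EFinP; exact: measurable_normal_pdf. Qed.

Lemma ge0_integral_normal2 (f : R * R -> \bar R) : measurable_fun setT f ->
  (forall x, 0 <= f x) ->
  \int[gam \x gam]_z f z =
  \int[mu]_x \int[mu]_y (f (x, y) * ((p x)%:E * (p y)%:E)).
Proof.
move=> mf f0; rewrite fubini_tonelli1// ge0_integral_normal; last 2 first.
- exact: measurable_fun_fubini_tonelli_F.
- by move=> x; apply: integral_ge0.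
apply: eq_integral => x _; rewrite /fubini_F ge0_integral_normal//; last first.
  exact: measurableT_comp.
rewrite muleC -ge0_integralZl//=.
- by apply: eq_integral => y _; rewrite muleCA muleA.
- by apply: emeasurable_funM => //; exact: measurableT_comp.
- by move=> y _; rewrite mule_ge0.
Qed.

(** The density of the product law depends on x^2 + y^2 only. *)
Lemma normal_rotation (c s : R) (S : set (R * R)) : measurable S ->
  (c ^+ 2 + s ^+ 2 = 1)%R ->
  (gam \x gam) [set z | S (c * z.1 - s * z.2, s * z.1 + c * z.2)%R] =
  (gam \x gam) S.
Proof.
move=> mS cs.
pose r (z : R * R) := (c * z.1 - s * z.2, s * z.1 + c * z.2)%R.
have mr : measurable_fun setT r.
  apply: measurable_fun_pair.
    by apply: measurable_funB => //; exact: measurable_funM.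
  by apply: measurable_funD => //; exact: measurable_funM.
have mrS : measurable (r @^-1` S) by rewrite -[X in measurable X]setTI; exact: mr.
have mi (A : set (R * R)) : measurable A ->
    measurable_fun setT (fun z => (\1_A z)%:E : \bar R).
  by move=> mA; apply/measurable_EFinP; exact: measurable_indic.
have i0 (A : set (R * R)) z : 0 <= (\1_A z)%:E :> \bar R by rewrite lee_fin.
rewrite -[X in (gam \x gam) X = _]/(r @^-1` S).
have := measure_integral_indic (gam \x gam) mrS.
have := measure_integral_indic (gam \x gam) mS.
move=> -> ->.
rewrite (ge0_integral_normal2 (mi _ mrS) (i0 _)).
rewrite (ge0_integral_normal2 (mi _ mS) (i0 _)).
pose f z : \bar R := (\1_S z)%:E * ((p z.1)%:E * (p z.2)%:E).
have mf : measurable_fun setT f.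
  apply: emeasurable_funM; first exact: mi.
  apply: emeasurable_funM.
    exact: (measurableT_comp mp measurable_fst).
  exact: (measurableT_comp mp measurable_snd).
have f0 z : 0 <= f z.
  by apply: mule_ge0; [exact: i0|apply: mule_ge0; exact: p0].
have := ge0_integral_rotation mf f0 cs; rewrite {2}/f /= => <-.
apply: eq_integral => x _; apply: eq_integral => y _.
rewrite /f /= -!EFinM -[r @^-1` S]/(r @^-1` S); congr ((_ * _)%:E).
rewrite /p /normal_pdf (negbTE sg0) mulrACA [in RHS]mulrACA; congr (_ * _)%R.
rewrite /normal_fun -!expRD; congr expR; rewrite -!mulrDl; congr (_ / _)%R.
rewrite !subr0.
transitivity (- ((c ^+ 2 + s ^+ 2) * (x ^+ 2 + y ^+ 2)))%R; last by ring.
by rewrite cs mul1r opprD.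
Qed.

(** Up to a constant the integrand is the normal density of variance sg^2 / (1
    - 2 l sg^2). *)
Lemma normal_exp_sqr (l : R) : (2 * l * sg ^+ 2 < 1)%R ->
  \int[gam]_x (expR (l * x ^+ 2))%:E =
  ((Num.sqrt (1 - 2 * l * sg ^+ 2))^-1)%:E.
Proof.
move=> l1; set k := (1 - _)%R; have k0 : (0 < k)%R by rewrite subr_gt0.
have s0 : (Num.sqrt k != 0)%R by rewrite gt_eqF// sqrtr_gt0.
pose tau := (sg / Num.sqrt k)%R.
have tau0 : (tau != 0)%R by rewrite mulf_neq0// invr_eq0.
have tau2 : (tau ^+ 2 = sg ^+ 2 / k)%R by rewrite exprMn exprVn sqr_sqrtr// ltW.
rewrite ge0_integral_normal; last 2 first.
- apply/measurable_EFinP; apply: measurableT_comp => //.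
  by apply: measurable_funM => //; exact: exprn_measurable.
- by move=> x; rewrite lee_fin expR_ge0.
have mq : measurable_fun setT (fun x => (normal_pdf 0 tau x)%:E).
  by apply/measurable_EFinP; exact: measurable_normal_pdf.
have q0 (x : R) : 0 <= (normal_pdf 0 tau x)%:E by rewrite lee_fin normal_pdf_ge0.
have r0 : 0 <= ((Num.sqrt k)^-1)%:E by rewrite lee_fin invr_ge0 sqrtr_ge0.
rewrite -[RHS]mule1 -(integral_normal_pdf 0 tau).
rewrite -(ge0_integralZl mu measurableT mq (fun x _ => q0 x) r0).
apply: eq_integral => x _; rewrite -!EFinM; congr EFin.
rewrite /normal_pdf (negbTE sg0) (negbTE tau0) mulrCA [RHS]mulrA.
congr (_ * _)%R; last first.
  rewrite /normal_fun -expRD; congr expR; rewrite subr0 tau2.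
  have sg20 : (sg ^+ 2 != 0)%R by rewrite expf_neq0.
  have k1 : (k != 0)%R by rewrite gt_eqF.
  rewrite -(mulr_natr (sg ^+ 2)%R) -(mulr_natr (sg ^+ 2 / k)%R).
  rewrite (invfM (sg ^+ 2)%R) (invfM (sg ^+ 2 / k)%R) (invfM (sg ^+ 2)%R) invrK /k.
  move: (sg ^+ 2)%R (x ^+ 2)%R sg20 => a y a0.
  exact: gauss_exponent.
rewrite /normal_peak tau2 -invfM -sqrtrM ?ltW// (mulrnAr k).
by rewrite (mulrCA k) mulrA divfK ?gt_eqF.
Qed.

End Gauss.

(** * Gaussian families independent of a sigma-algebra *)

(** For independent events the constant c is the probability of one of them
    and m2 the law of the others. *)
Lemma measure_unique_scale d (T : measurableType d) (R : realType)
    (G : set_system T) (m1 m2 : {measure set T -> \bar R}) (c : R) :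
  G `<=` measurable -> setI_closed G -> G setT ->
  (m1 setT < +oo)%E -> 0 <= c ->
  (forall A, G A -> m1 A = c%:E * m2 A)%E ->
  forall A, <<s G >> A -> (m1 A = c%:E * m2 A)%E.
Proof.
move=> Gm GI GT fin c0 m12 A sA.
rewrite (_ : (c%:E * m2 A)%E = mscale (NngNum c0) m2 A)//.
apply: (@g_sigma_algebra_measure_unique _ _ _ G Gm (fun=> setT)) => //.
by rewrite bigcup_const//; exists 0%N.
Qed.

(** The measurability proof is an argument, as it cannot be inferred from the
    function. *)
Definition image_measure d d' (T1 : measurableType d) (T2 : measurableType d')
    (R : realType) (m : {measure set T1 -> \bar R}) (f : T1 -> T2)
    (mf : measurable_fun setT f) : {measure set T2 -> \bar R} :=
  measure_function_pushforward__canonical__measure_function_Measure m mf.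

Section Independence.
Context d (T : measurableType d) (R : realType) (P : probability T R).
Local Open Scope ereal_scope.

(** Independence of W and F turned into a product law for the pair of the
    identity and W: by Fubini, W can be integrated out while everything that
    is known from F is kept fixed. *)
Lemma joint_law (F : set_system T) d' (E : measurableType d')
    (W : T -> E) (nu : probability E R)
    (mid : measurable_fun setT (id : T -> g_sigma_algebraType F)) :
  measurable_fun setT W ->
  (forall A C, <<s F >> A -> measurable C ->
     P (A `&` W @^-1` C) = P A * nu C) ->
  forall S : set (g_sigma_algebraType F * E), measurable S ->
  P [set w | S (w, W w)] = (distribution P (mfun_of mid) \x nu) S.
Proof.
move=> mW H S mS.
have mp : measurable_fun setT (fun w => (w, W w) : g_sigma_algebraType F * E).
  exact: measurable_fun_pair.
apply/esym.
apply: (@product_measure_unique _ _ _ _ _ (distribution P (mfun_of mid)) nu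
  (image_measure P mp)) => //.
Qed.

Variable sg : R.
Hypothesis sg0 : sg != 0%R.
Notation gam := (normal_prob 0 sg : probability (measurableTypeR R) R).

(** F is the information that has been revealed; the variables X i for i in K
    are still fresh. *)
Definition iid_normal (F : set_system T) (I : finType) (X : I -> T -> R)
    (K : {set I}) : Prop :=
  [/\ F `<=` measurable,
      forall i, i \in K -> measurable_fun setT (X i) &
      forall A (B : I -> set R), <<s F >> A -> (forall i, measurable (B i)) ->
        P (A `&` \bigcap_(i in [set` K]) X i @^-1` B i) =
        P A * \prod_(i in K) gam (B i)].

Section IidNormal.
Variables (F : set_system T) (I : finType).
Implicit Types (X : I -> T -> R) (J K : {set I}).

Lemma gam_fin (B : set R) : measurable B -> gam B \is a fin_num.
Proof. by move=> mB; exact: fin_num_measure. Qed.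

Lemma prod_gam_fin K (B : I -> set R) : (forall i, measurable (B i)) ->
  exists2 c : R, (0 <= c)%R & \prod_(i in K) gam (B i) = c%:E.
Proof.
move=> mB; exists (\prod_(i in K) fine (gam (B i)))%R.
  by apply: prodr_ge0 => i _; exact: fine_ge0.
rewrite (eq_bigr (fun i => (fine (gam (B i)))%:E)).
  by elim/big_rec2: _ => // i y _ _ ->.
by move=> i _; rewrite fineK// gam_fin.
Qed.

Lemma eq_iid_normal X X' K : (forall i w, i \in K -> X i w = X' i w) ->
  iid_normal F X K -> iid_normal F X' K.
Proof.
move=> XX' [Fm mX H]; have XX i : i \in K -> X i = X' i.
  by move=> iK; apply/funext => w; exact: XX'.
split => //; first by move=> i iK; rewrite -XX//; exact: mX.
move=> A B mA mB; rewrite -H//; congr (P (_ `&` _)).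
by apply: eq_bigcapr => i /= iK; rewrite XX.
Qed.

Lemma iid_normal_sub X K J : J \subset K ->
  iid_normal F X K -> iid_normal F X J.
Proof.
move=> JK [Fm mX H]; split => //; first by move=> i /(fintype.subsetP JK) /mX.
move=> A B mA mB; pose B' i := if i \in J then B i else setT.
have mB' i : measurable (B' i) by rewrite /B'; case: ifP.
have := H A B' mA mB'; rewrite (big_setID J)/= (finset.setIidPr JK).
rewrite [X in _ * (_ * X)]big1 ?mule1; last first.
  by move=> i; rewrite inE /B' => /andP[/negbTE -> _]; exact: probability_setT.
rewrite (eq_bigr (fun i => gam (B i))); last by move=> i; rewrite /B' => ->.
move=> <-; congr (P (_ `&` _)); apply/seteqP; split => w h i /= iK.
  by rewrite /B'; case: ifP => // iJ; exact: h.
by have := h i (fintype.subsetP JK _ iK); rewrite /B' iK.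
Qed.

Lemma finset_bigcap_measurable J (A : I -> set T) :
  (forall i, i \in J -> measurable (A i)) ->
  measurable (\bigcap_(i in [set` J]) A i).
Proof. by move=> mA; apply: fin_bigcap_measurable => //; exact: finite_finset. Qed.

(** A system of sets closed under intersection, as required by uniqueness of
    measures, that generates the information F together with the variables of
    J. *)
Definition adjoin X J : set_system T :=
  [set A | exists2 A0, <<s F >> A0 & exists2 B : I -> set R,
     (forall i, measurable (B i)) &
     A = A0 `&` \bigcap_(i in [set` J]) X i @^-1` B i].

Lemma sub_adjoin X J : F `<=` adjoin X J.
Proof.
move=> A FA; exists A; first exact: sub_sigma_algebra.
exists (fun=> setT) => //; apply/seteqP; split => [w Aw|w []//].
by split.
Qed.

Lemma adjoin_preimage X J i (B : set R) : i \in J -> measurable B ->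
  adjoin X J (X i @^-1` B).
Proof.
move=> iJ mB; exists setT; first by exact: (@measurableT _ (g_sigma_algebraType F)).
exists (fun j => if j == i then B else setT); first by move=> j; case: ifP.
rewrite setTI; apply/seteqP; split => w /= h.
  by move=> j /= jJ; case: eqP => // ->.
by have := h i iJ; rewrite /= eqxx.
Qed.

Lemma adjoin_measurable X J :
  F `<=` measurable -> (forall i, i \in J -> measurable_fun setT (X i)) ->
  adjoin X J `<=` measurable.
Proof.
move=> Fm mX A [A0 FA0 [B mB ->]]; apply: measurableI.
  by apply: smallest_sub FA0 => //; exact: sigma_algebra_measurable.
apply: finset_bigcap_measurable.
move=> i iJ; rewrite -[X in measurable X]setTI; apply: (mX i) => //.
Qed.

(** Variables can be revealed without spoiling the others: both sides of the
    product rule are measures in the conditioning event, and they agree on the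
    intersection-stable system [adjoin]. *)
Lemma iid_normal_adjoin X K J : J \subset K ->
  iid_normal F X K -> iid_normal (adjoin X J) X (K :\: J).
Proof.
move=> JK XK; have [Fm mX H] := XK.
have [_ mXJ HJ] := iid_normal_sub JK XK.
have aM := adjoin_measurable Fm mXJ.
split => //; first by move=> i; rewrite inE => /andP[_ /mX].
move=> A B sA mB; have [c c0 cE] := prod_gam_fin (K :\: J) mB.
have mZ : measurable (\bigcap_(i in [set` K :\: J]) X i @^-1` B i).
  apply: finset_bigcap_measurable.
  move=> i /=; rewrite inE => /andP[_ iK].
  by rewrite -[X in measurable X]setTI; apply: (mX i) => //.
rewrite cE muleC.
apply: (measure_unique_scale (m1 := mrestr P mZ) (m2 := P) (G := adjoin X J)) => //.
- move=> _ _ [A1 s1 [B1 mB1 ->]] [A2 s2 [B2 mB2 ->]].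
  exists (A1 `&` A2); first exact: (@measurableI _ (g_sigma_algebraType F)).
  exists (fun i => B1 i `&` B2 i); first by move=> i; exact: measurableI.
  rewrite setIACA; congr (_ `&` _); apply/seteqP; split => w.
    by move=> [h1 h2] i iJ; split; [exact: h1|exact: h2].
  by move=> h; split => i /h[].
- exists setT; first exact: (@measurableT _ (g_sigma_algebraType F)).
  exists (fun=> setT) => //; apply/esym/seteqP; split => // w _; split => //.
- by rewrite ltey_eq fin_num_measure.
- move=> A' [A0 sA0 [B0 mB0 ->]]; rewrite /= HJ// -[LHS]/(P (_ `&` _)).
  pose B' i := if i \in J then B0 i else B i.
  have mB' i : measurable (B' i) by rewrite /B'; case: ifP.
  rewrite -setIA [X in A0 `&` X](_ : _ = \bigcap_(i in [set` K]) X i @^-1` B' i); last first.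
    apply/seteqP; split => w.
      move=> [h1 h2] i /= iK; rewrite /B'; case: ifPn => iJ; first exact: h1.
      by apply: h2; rewrite /= inE iJ.
    move=> h; split => i /=.
      by move=> iJ; have := h i (fintype.subsetP JK _ iJ); rewrite /B' iJ.
    by rewrite inE => /andP[/negbTE iJ /h]; rewrite /B' iJ.
  rewrite H// (big_setID J)/= (finset.setIidPr JK) -cE [RHS]muleCA; congr (_ * _).
  rewrite [RHS]muleC; congr (_ * _).
    by apply: eq_bigr => i; rewrite /B' => ->.
  by apply: eq_bigr => i; rewrite inE /B' => /andP[/negbTE ->].
Qed.

(** All variables but X a and X b are revealed first; given them the rotation
    is a fixed one, which preserves the law of (X a, X b) by
    [normal_rotation]. *)
Lemma iid_normal_rot1 X K a b (c s : T -> R) :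
  iid_normal F X K -> a \in K -> b \in K -> a != b ->
  measurable_fun setT (c : g_sigma_algebraType F -> R) ->
  measurable_fun setT (s : g_sigma_algebraType F -> R) ->
  (forall w, c w ^+ 2 + s w ^+ 2 = 1)%R ->
  iid_normal F (fun i w => if i == a then c w * X a w - s w * X b w
    else if i == b then s w * X a w + c w * X b w else X i w)%R K.
Proof.
move=> XK aK bK ab mc ms cs; have [Fm mX H] := XK.
have FT (f : T -> R) : measurable_fun setT (f : g_sigma_algebraType F -> R) ->
    measurable_fun setT f.
  move=> mf _ Y mY; have := mf measurableT Y mY.
  by apply: smallest_sub => //; exact: sigma_algebra_measurable.
split => //.
  move=> i iK; case: (i == a); last case: (i == b); last exact: mX.
    by apply: measurable_funB; apply: measurable_funM; try exact: FT; exact: mX.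
  by apply: measurable_funD; apply: measurable_funM; try exact: FT; exact: mX.
move=> A B sA mB.
set X' := (X in \bigcap_(i in _) X i @^-1` _).
(* Everything but the pair (X a, X b) goes into the conditioning. *)
pose J := K :\: [set a; b]%SET.
have JK : J \subset K by exact: finset.subsetDl.
have abK : K :\: J = [set a; b]%SET.
  apply/setP => i; rewrite !inE; case: (i =P a) => [->|_]/=; first by rewrite aK.
  by case: (i =P b) => [->|_]/=; rewrite ?bK ?andNb.
have := iid_normal_adjoin JK XK; rewrite abK; set F' := adjoin X J => XJ.
have [F'm _ H'] := XJ.
have mid : measurable_fun setT (id : T -> g_sigma_algebraType F').
  move=> _ Y sY; rewrite setTI preimage_id; apply: smallest_sub sY => //.
  exact: sigma_algebra_measurable.
have mW : measurable_fun setT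
    ((fun w => (X a w, X b w)) : T -> measurableTypeR R * measurableTypeR R).
  by apply: measurable_fun_pair; exact: mX.
have W2 A' C : <<s F' >> A' -> measurable C ->
    P (A' `&` (fun w => (X a w, X b w)) @^-1` C) = P A' * (gam \x gam) C.
  move=> sA' mC.
  have [c' c'0 c'E] : exists2 r : R, (0 <= r)%R & P A' = r%:E.
    exists (fine (P A')); first exact: fine_ge0.
    by rewrite fineK// fin_num_measure//; apply: smallest_sub sA' => //;
      exact: sigma_algebra_measurable.
  have mA' : measurable A'.
    by apply: smallest_sub sA' => //; exact: sigma_algebra_measurable.
  rewrite c'E [X in P X]setIC.
  pose m1 := image_measure (mrestr P mA') mW.
  pose m2 : {measure set (measurableTypeR R * measurableTypeR R) -> \bar R} := gam \x gam.
  suff : m1 C = c'%:E * m2 C by [].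
  have E := @measure_unique_scale _ _ _ [set D | exists2 D1, measurable D1 &
    exists2 D2, measurable D2 & D = D1 `*` D2] m1 m2 c'.
  apply: E => //.
  - by move=> _ [D1 mD1 [D2 mD2 ->]]; exact: measurableX.
  - move=> _ _ [D1 mD1 [D2 mD2 ->]] [D3 mD3 [D4 mD4 ->]]; exists (D1 `&` D3).
      exact: measurableI.
    by exists (D2 `&` D4); [exact: measurableI|rewrite setXI].
  - by exists setT => //; exists setT => //; rewrite setXTT.
  - by rewrite -[m1 setT]/(P (setT `&` A')) setTI c'E ltry.
  - move=> _ [D1 mD1 [D2 mD2 ->]].
    have -> : m2 (D1 `*` D2) = gam D1 * gam D2 by exact: product_measure1E.
    rewrite -c'E.
    pose D i := if i == a then D1 else D2.
    have mD i : measurable (D i) by rewrite /D; case: ifP.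
    have := H' A' D sA' mD; rewrite big_setU1 ?inE//= finset.big_set1 /D eqxx.
    rewrite eq_sym (negbTE ab) => <-.
    rewrite [X in P X]setIC -[LHS]/(P (_ `&` _)); congr (P (_ `&` _)).
    apply/seteqP; split => w /=.
      move=> [h1 h2] i /=; rewrite !inE => /orP[/eqP ->|/eqP ->]; rewrite ?eqxx//.
      by rewrite eq_sym (negbTE ab).
    move=> h; split; first by have := h a; rewrite /= !inE eqxx; exact.
    by have := h b; rewrite /= !inE eqxx orbT eq_sym (negbTE ab); exact.
  - rewrite measurable_prod_measurableType in mC.
    apply: sub_sigma_algebra2 mC => _ [D1 mD1 [D2 mD2 <-]].
    by exists D1 => //; exists D2.
have JL := joint_law mid mW W2.
have FF' (f : T -> R) : measurable_fun setT (f : g_sigma_algebraType F -> R) ->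
    measurable_fun setT (f : g_sigma_algebraType F' -> R).
  move=> mf _ Y mY; have := mf measurableT Y mY.
  by apply: sub_sigma_algebra2; exact: sub_adjoin.
pose A1 := A `&` \bigcap_(i in [set` J]) X i @^-1` B i.
have sA1 : <<s F' >> A1 by apply: sub_sigma_algebra; exists A => //; exists B.
have [_ _ HJ] := iid_normal_sub JK XK.
pose r (z : g_sigma_algebraType F' * (R * R)) :=
  (c z.1 * z.2.1 - s z.1 * z.2.2, s z.1 * z.2.1 + c z.1 * z.2.2)%R.
have mr : measurable_fun setT r.
  have mc1 : measurable_fun setT (fun z : g_sigma_algebraType F' * (R * R) => c z.1).
    exact: (measurableT_comp (FF' _ mc) measurable_fst).
  have ms1 : measurable_fun setT (fun z : g_sigma_algebraType F' * (R * R) => s z.1).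
    exact: (measurableT_comp (FF' _ ms) measurable_fst).
  have mx : measurable_fun setT (fun z : g_sigma_algebraType F' * (R * R) => z.2.1).
    exact: (measurableT_comp measurable_fst measurable_snd).
  have my : measurable_fun setT (fun z : g_sigma_algebraType F' * (R * R) => z.2.2).
    exact: (measurableT_comp measurable_snd measurable_snd).
  apply: measurable_fun_pair.
    by apply: measurable_funB; exact: measurable_funM.
  by apply: measurable_funD; exact: measurable_funM.
have mBB : measurable (B a `*` B b) by exact: measurableX.
pose S : set (g_sigma_algebraType F' * (R * R)) := (A1 `*` [set: R * R]) `&` r @^-1` (B a `*` B b).
have mS : measurable S.
  apply: measurableI.
    exact: (@measurableX _ _ (g_sigma_algebraType F') (R * R)%type A1 setT sA1 measurableT).
  by rewrite -[X in measurable X]setTI; exact: mr.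
(* In [S] the coefficients c and s are kept fixed by Fubini. *)
transitivity (P [set w | S (w, (X a w, X b w))]).
  congr (P _); apply/seteqP; split => w.
    move=> [Aw h]; split; [split => //; split => //|split].
    - move=> i /=; rewrite !inE negb_or => /andP[/andP[ia ib] iK].
      by have := h i iK; rewrite /X' (negbTE ia) (negbTE ib).
    - by move: (h a aK); rewrite /X' /preimage /= eqxx; exact.
    - by move: (h b bK); rewrite /X' /preimage /= eqxx eq_sym (negbTE ab); exact.
  move=> [[[Aw h] _] [/= ha hb]]; split => // i /= iK; rewrite /X' /=.
  have [->//|ia] := eqVneq i a; have [->//|ib] := eqVneq i b.
  by apply: h; rewrite /= !inE negb_or ia ib iK.
rewrite JL//.
transitivity (\int[distribution P (mfun_of mid)]_w (gam \x gam) (xsection S w)).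
  by [].
transitivity (\int[distribution P (mfun_of mid)]_w
    ((gam \x gam) (B a `*` B b) * (\1_A1 w)%:E)).
  apply: eq_integral => w _ /=; rewrite indicE.
  have [wA|wA] := boolP (w \in A1).
    rewrite mule1 -(normal_rotation sg0 mBB (cs w)); congr (_ _).
    rewrite inE in wA.
    by apply/seteqP; split => z; rewrite /xsection /= inE /S /=; [case|split].
  rewrite mule0 (_ : xsection _ _ = set0) ?measure0//.
  apply/seteqP; split => // z; rewrite /xsection /= inE => -[[/= h]].
  by move: wA; rewrite notin_setE.
have mi : measurable_fun setT
    (fun w : g_sigma_algebraType F' => (\1_A1 w)%:E : \bar R).
  by apply/measurable_EFinP; exact: measurable_indic.
have i0 (w : g_sigma_algebraType F') : setT w -> 0 <= (\1_A1 w)%:E :> \bar R.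
  by rewrite lee_fin.
rewrite (ge0_integralZl _ measurableT mi i0 (measure_ge0 _ _)).
rewrite -(@measure_integral_indic _ (g_sigma_algebraType F') _ _ A1 sA1) -[X in _ * X]/(P A1).
transitivity (gam (B a) * gam (B b) * P A1).
  pose g := gam : {measure set (measurableTypeR R) -> \bar R}.
  rewrite -(product_measure1E g g (mB a) (mB b)).
  reflexivity.
rewrite /A1 HJ// [in RHS](big_setID J)/= (finset.setIidPr JK) abK muleC -muleA.
congr (_ * (_ * _)); by rewrite big_setU1 ?inE//= finset.big_set1.
Qed.
End IidNormal.
End Independence.

Section InvolutiveRotation.
Context d (T : measurableType d) (R : realType) (P : probability T R).
Variables (sg : R) (F : set_system T) (I : finType).
Hypothesis sg0 : sg != 0.
Implicit Types (X : I -> T -> R) (K : {set I}).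

(** The involution sig pairs the indices, each pair spans a plane, and the
    condition S (sig i) = - S i makes (C, S) a rotation of it. The planes are
    disjoint, so the rotations are performed one after the other by
    [iid_normal_rot1]. *)
Lemma iid_normal_rot X K (sig : I -> I) (C S : I -> T -> R) :
  involutive sig -> (forall i, i \in K -> sig i \in K) ->
  (forall i, measurable_fun setT (C i : g_sigma_algebraType F -> R)) ->
  (forall i, measurable_fun setT (S i : g_sigma_algebraType F -> R)) ->
  (forall i w, C i w ^+ 2 + S i w ^+ 2 = 1) ->
  (forall i w, C (sig i) w = C i w) -> (forall i w, S (sig i) w = - S i w) ->
  (forall i w, sig i = i -> C i w = 1) ->
  iid_normal P sg F X K ->
  iid_normal P sg F (fun i w => C i w * X i w + S i w * X (sig i) w) K.
Proof.
move=> sigK Ksig mC mS CS Cs Ss Cfix XK.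
pose Y (D : {set I}) i w :=
  if i \in D then C i w * X i w + S i w * X (sig i) w else X i w.
suff H n : exists D : {set I}, [/\ D \subset K, (minn n #|K| <= #|D|)%N,
    forall i, i \in D -> sig i \in D & iid_normal P sg F (Y D) K].
  have [D [DK nD _ HD]] := H #|K|.
  have {nD}DK : D = K by apply/eqP; rewrite eqEcard DK -[X in (X <= _)%N]minnn.
  by apply: eq_iid_normal HD => i w iK; rewrite /Y DK iK.
elim: n => [|n [D [DK nD Dsig HD]]].
  exists finset.set0; split; rewrite ?finset.sub0set ?min0n//.
    by move=> i; rewrite inE.
  by apply: eq_iid_normal XK => i w iK; rewrite /Y inE.
have [KD|] := boolP (K \subset D).
  exists D; split => //; apply: leq_trans (subset_leq_card KD).
  exact: geq_minr.
case/fintype.subsetPn => a aK aD.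
have sD : sig a \notin D by apply: contra aD => /Dsig; rewrite sigK.
exists (a |: (sig a |: D)); split.
- by rewrite !finset.subUset !finset.sub1set aK Ksig.
- apply: (@leq_trans (minn n #|K|).+1).
    by rewrite -minnSS leq_min geq_minl /= (leq_trans (geq_minr _ _)).
  apply: leq_ltn_trans nD _; apply: proper_card.
  apply/fintype.properP; split.
    by rewrite !finset.subsetU ?subxx ?orbT// finset.subsetU ?subxx ?orbT.
  by exists a => //; rewrite finset.setU11.
- move=> i; rewrite !inE => /or3P[/eqP->|/eqP->|/Dsig->]; rewrite ?sigK ?eqxx ?orbT//.
- have [sa|sa] := eqVneq (sig a) a.
    apply: eq_iid_normal HD => i w iK; rewrite /Y sa !inE.
    have [->|_] := eqVneq i a; last by [].
    rewrite (negbTE aD) sa Cfix// mul1r.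
    have -> : S a w = 0.
      have := Ss a w; rewrite sa => /eqP; rewrite -addr_eq0 -mulr2n mulrn_eq0 /=.
      by move/eqP.
    by rewrite mul0r addr0.
  have mNS : measurable_fun setT
      ((fun w => - S a w) : g_sigma_algebraType F -> R).
    exact: measurable_funN.
  have sa' : a != sig a by rewrite eq_sym.
  have cs w : C a w ^+ 2 + (- S a w) ^+ 2 = 1 by rewrite sqrrN.
  have := iid_normal_rot1 sg0 HD aK (Ksig _ aK) sa' (mC a) mNS cs.
  apply: eq_iid_normal => i w iK; rewrite /Y !inE.
  have [->|ia] := eqVneq i a; first by rewrite (negbTE aD) (negbTE sD) mulNr opprK.
  have [->|ib] := eqVneq i (sig a); last by [].
  by rewrite (negbTE aD) (negbTE sD) sigK Cs Ss addrC.
Qed.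

End InvolutiveRotation.

Section Expectation.
Context d (T : measurableType d) (R : realType) (P : probability T R).
Variables (sg : R) (I : finType).
Notation gam := (normal_prob 0 sg : probability (measurableTypeR R) R).

(** Conditionally on F, a fresh variable may be integrated out. *)
Lemma iid_normal_joint F (X : I -> T -> R) (K : {set I}) (a : I)
    (mid : measurable_fun setT (id : T -> g_sigma_algebraType F)) :
  iid_normal P sg F X K -> a \in K ->
  forall S : set (g_sigma_algebraType F * R), measurable S ->
  P [set w | S (w, X a w)] = (distribution P (mfun_of mid) \x gam)%E S.
Proof.
move=> XK aK; have [Fm mX _] := XK.
have JJ := @joint_law _ _ _ P F _ (measurableTypeR R) (X a) gam mid.
apply: JJ; first exact: mX.
move=> A C sA mC; have aK' : ([set a]%SET \subset K) by rewrite finset.sub1set.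
have [_ _ H] := iid_normal_sub aK' XK.
have := H A (fun=> C) sA (fun=> mC); rewrite finset.big_set1 => <-.
congr (P (_ `&` _)); apply/seteqP; split => w /=.
  by move=> h i /=; rewrite inE => /eqP ->.
by move=> /(_ a); apply; rewrite /= inE.
Qed.

Lemma sub_measurable_id (F : set_system T) : F `<=` measurable ->
  measurable_fun setT (id : T -> g_sigma_algebraType F).
Proof.
move=> Fm _ Y sY; rewrite setTI preimage_id; apply: smallest_sub sY => //.
exact: sigma_algebra_measurable.
Qed.

(** One variable is integrated out at a time, the others being revealed. *)
Lemma iid_normal_expectation F (X : I -> T -> R) (K : {set I}) (f : R -> R) :
  measurable_fun setT f -> (forall x, 0 <= f x) ->
  iid_normal P sg F X K ->
  (\int[P]_w (\prod_(i in K) f (X i w))%:E =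
   \prod_(i in K) \int[gam]_x (f x)%:E)%E.
Proof.
move=> mf f0; move: {2}#|K| (erefl #|K|) => n; elim: n K => [|n IH] K nK XK.
  have -> : K = finset.set0 by apply/eqP; rewrite -cards_eq0 nK.
  rewrite big_set0; under eq_integral do rewrite big_set0.
  by rewrite integral_cst//= mul1e probability_setT.
have [a aK] : exists a, a \in K by apply/set0Pn; rewrite -card_gt0 nK.
pose K' := (K :\ a)%SET.
have K'K : K' \subset K by rewrite subD1set.
have nK' : #|K'| = n by move: nK; rewrite (cardsD1 a) aK => -[].
have IHK := IH K' nK' (iid_normal_sub K'K XK).
have := iid_normal_adjoin K'K XK; set F' := adjoin F X K' => XJ.
have aKK' : a \in (K :\: K')%SET by rewrite !inE eqxx aK.
have [F'm _ _] := XJ; have [_ mX _] := XK.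
have mid := sub_measurable_id F'm.
have JL := iid_normal_joint mid XJ aKK'.
pose g w := \prod_(i in K') f (X i w).
have mg : measurable_fun setT (g : g_sigma_algebraType F' -> R).
  rewrite (_ : g = fun w => \prod_(i <- enum K') f (X i w)); last first.
    by apply/funext => w; rewrite big_enum.
  apply: measurable_prod => i; rewrite mem_enum => iK'.
  apply: (measurableT_comp mf) => _ Y mY; rewrite setTI.
  by apply: sub_sigma_algebra; exact: adjoin_preimage.
have g0 w : 0 <= g w by apply: prodr_ge0.
pose h (z : g_sigma_algebraType F' * measurableTypeR R) := ((g z.1)%:E * (f z.2)%:E)%E.
have mh : measurable_fun setT h.
  apply: emeasurable_funM; apply/measurable_EFinP.
    exact: (measurableT_comp mg measurable_fst).
  exact: (measurableT_comp mf measurable_snd).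
have h0 z : (0 <= h z)%E by rewrite mule_ge0// lee_fin.
have mp : measurable_fun setT
    (fun w => (w, X a w) : g_sigma_algebraType F' * measurableTypeR R).
  by apply: measurable_fun_pair => //; exact: mX.
transitivity (\int[image_measure P mp]_z h z)%E.
  rewrite ge0_integral_pushforward//=.
  apply: eq_integral => w _; rewrite /h /= -EFinM; congr EFin.
  by rewrite (big_setD1 a)//= mulrC.
have E1 : (\int[image_measure P mp]_z h z =
    \int[(distribution P (mfun_of mid) \x gam : {measure set _ -> \bar R})]_z h z)%E.
  by apply: eq_measure_integral => S mS _; exact: JL.
rewrite E1; have E2 := @fubini_tonelli1 _ _ _ _ _ (distribution P (mfun_of mid)) gam h mh h0.
apply: etrans; first exact: E2.
have mfE : measurable_fun setT (fun x => (f x)%:E) by exact/measurable_EFinP.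
have mgE : measurable_fun setT (fun x : g_sigma_algebraType F' => (g x)%:E).
  exact/measurable_EFinP.
have f0E x : (0 <= (f x)%:E)%E by rewrite lee_fin.
have g0E x : (0 <= (g x)%:E)%E by rewrite lee_fin.
pose c := (\int[gam]_x (f x)%:E)%E.
have c0 : (0 <= c)%E by apply: integral_ge0.
transitivity (\int[distribution P (mfun_of mid)]_w (c * (g w)%:E))%E.
  apply: eq_integral => w _; rewrite /fubini_F /h /=.
  rewrite [RHS]muleC.
  exact: (ge0_integralZl gam measurableT mfE (fun x _ => f0E x) (g0E w)).
rewrite (ge0_integralZl _ measurableT mgE (fun x _ => g0E x) c0).
rewrite [in RHS](big_setD1 a)//= -/c -/K' -IHK; congr (_ * _)%E.
rewrite /distribution ge0_integral_pushforward//.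
Qed.
End Expectation.

(** * Random matrices with Gaussian columns *)

Section ComplexParts.
Context {R : realType}.
Local Notation C := (R[i]).
Implicit Types (x y z : C).

Lemma ReM x y : complex.Re (x * y) =
  complex.Re x * complex.Re y - complex.Im x * complex.Im y.
Proof. by case: x; case: y. Qed.

Lemma ImM x y : complex.Im (x * y) =
  complex.Re x * complex.Im y + complex.Im x * complex.Re y.
Proof. by case: x => a b; case: y => c e. Qed.

Lemma ReJ z : complex.Re (Num.conj z) = complex.Re z.
Proof. by case: z. Qed.

Lemma ImJ z : complex.Im (Num.conj z) = - complex.Im z.
Proof. by case: z. Qed.

Lemma complex_eq x y : complex.Re x = complex.Re y -> complex.Im x = complex.Im y ->
  x = y.
Proof. by case: x => a b; case: y => c e /= -> ->. Qed.

Definition sqmod z : R := complex.Re z ^+ 2 + complex.Im z ^+ 2.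

Lemma sqmod_ge0 z : 0 <= sqmod z. Proof. by rewrite addr_ge0 ?sqr_ge0. Qed.

Lemma sqmodE z : z * Num.conj z = (sqmod z)%:C%C.
Proof.
apply: complex_eq; rewrite ?ReM ?ImM ReJ ImJ /sqmod /= ?mulrN ?opprK//.
by rewrite (mulrC (complex.Im z)) addrC subrr.
Qed.

Lemma sqmod_eq0 z : (sqmod z == 0) = (z == 0).
Proof.
rewrite paddr_eq0 ?sqr_ge0// !sqrf_eq0; apply/andP/eqP => [[/eqP ? /eqP ?]|->] //.
exact: complex_eq.
Qed.

End ComplexParts.

Section AdjointMatrices.
Context {R : realType}.
Local Notation C := (R[i]).

Lemma adjmxE m n (A : 'M[C]_(m, n)) i j : adjmx A i j = Num.conj (A j i).
Proof. by rewrite !mxE. Qed.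

Lemma adjmxM m n p (A : 'M[C]_(m, n)) (B : 'M[C]_(n, p)) :
  adjmx (A *m B) = adjmx B *m adjmx A.
Proof. by rewrite /adjmx trmx_mul map_mxM. Qed.

Lemma adjmxK m n (A : 'M[C]_(m, n)) : adjmx (adjmx A) = A.
Proof. by apply/matrixP => i j; rewrite !adjmxE conjCK. Qed.

Lemma adjmx1 n : adjmx (1%:M : 'M[C]_n) = 1%:M.
Proof. by rewrite /adjmx trmx1 map_mx1. Qed.

Definition ec n (i : 'I_n) : 'cV[C]_n := delta_mx i 0.

Definition unitary n (U : 'M[C]_n) := adjmx U *m U = 1%:M.

Lemma unitaryC n (U : 'M[C]_n) : unitary U -> U *m adjmx U = 1%:M.
Proof. exact: mulmx1C. Qed.

Lemma unitaryM n (U V : 'M[C]_n) : unitary U -> unitary V -> unitary (U *m V).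
Proof.
rewrite /unitary => hU hV; rewrite adjmxM mulmxA -(mulmxA (adjmx V)) hU mulmx1.
exact: hV.
Qed.

Lemma unitary_adj n (U : 'M[C]_n) : unitary U -> unitary (adjmx U).
Proof. by move=> hU; rewrite /unitary adjmxK; exact: unitaryC. Qed.

End AdjointMatrices.

Section RandomMatrices.
Context d (T : measurableType d) (R : realType) (P : probability T R).
Variables (n : nat) (sg : R).
Hypothesis sg0 : sg != 0.
Local Notation C := (R[i]).

Definition cpart (b : bool) (z : C) : R := if b then complex.Re z else complex.Im z.

Definition cmeas (F : set_system T) (z : T -> C) : Prop :=
  forall b, measurable_fun setT ((fun w => cpart b (z w)) : g_sigma_algebraType F -> R).

Section Cmeas.
Variable F : set_system T.
Implicit Types (x y z : T -> C).

Lemma cmeas_cst (a : C) : cmeas F (fun=> a).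
Proof. by move=> b; exact: measurable_cst. Qed.

Lemma cmeasD x y : cmeas F x -> cmeas F y -> cmeas F (fun w => x w + y w).
Proof.
move=> mx my b; rewrite (_ : (fun w => _) =
    fun w => cpart b (x w) + cpart b (y w)); last first.
  by apply/funext => w; rewrite /cpart; case: b; case: (x w); case: (y w).
exact: (measurable_funD (mx b) (my b)).
Qed.

Lemma cmeasM x y : cmeas F x -> cmeas F y -> cmeas F (fun w => x w * y w).
Proof.
move=> mx my [].
  rewrite (_ : (fun w => _) = fun w => complex.Re (x w) * complex.Re (y w) -
      complex.Im (x w) * complex.Im (y w)); last first.
    by apply/funext => w; rewrite /cpart ReM.
  apply: measurable_funB; apply: measurable_funM.
  - exact: (mx true).
  - exact: (my true).
  - exact: (mx false).
  - exact: (my false).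
rewrite (_ : (fun w => _) = fun w => complex.Re (x w) * complex.Im (y w) +
    complex.Im (x w) * complex.Re (y w)); last first.
  by apply/funext => w; rewrite /cpart ImM.
apply: measurable_funD; apply: measurable_funM.
- exact: (mx true).
- exact: (my false).
- exact: (mx false).
- exact: (my true).
Qed.

Lemma cmeasJ z : cmeas F z -> cmeas F (fun w => Num.conj (z w)).
Proof.
move=> mz [].
  by rewrite (_ : (fun w => _) = fun w => cpart true (z w))//; apply/funext => w; exact: ReJ.
rewrite (_ : (fun w => _) = fun w => - cpart false (z w)); last first.
  by apply/funext => w; exact: ImJ.
exact: (measurable_funN (mz false)).
Qed.

Lemma cmeas_real (f : T -> R) : measurable_fun setT (f : g_sigma_algebraType F -> R) ->
  cmeas F (fun w => ((f w)%:C)%C).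
Proof. by move=> mf []; [exact: mf|exact: measurable_cst]. Qed.

Lemma cmeas_sum (I : Type) (s : seq I) (z : I -> T -> C) :
  (forall i, cmeas F (z i)) -> cmeas F (fun w => \sum_(i <- s) z i w).
Proof.
move=> mz; elim: s => [|i s IH].
  rewrite (_ : (fun w => _) = fun=> 0); first exact: cmeas_cst.
  by apply/funext => w; rewrite big_nil.
rewrite (_ : (fun w => _) = fun w => z i w + \sum_(i <- s) z i w).
  exact: cmeasD.
by apply/funext => w; rewrite big_cons.
Qed.

Lemma cmeas_mul_mx m p q (A : T -> 'M[C]_(m, p)) (B : T -> 'M[C]_(p, q)) :
  (forall i j, cmeas F (fun w => A w i j)) ->
  (forall i j, cmeas F (fun w => B w i j)) ->
  forall i j, cmeas F (fun w => (A w *m B w) i j).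
Proof.
move=> mA mB i j.
rewrite (_ : (fun w => _) = fun w => \sum_k A w i k * B w k j); last first.
  by apply/funext => w; rewrite mxE.
by apply: cmeas_sum => k; exact: cmeasM.
Qed.

Lemma measurable_sqmod z : cmeas F z ->
  measurable_fun setT ((fun w => sqmod (z w)) : g_sigma_algebraType F -> R).
Proof.
move=> mz; apply: measurable_funD; apply: measurable_funX.
  exact: (mz true).
exact: (mz false).
Qed.

End Cmeas.

Lemma measurable_invsqrt d' (E : measurableType d') (f : E -> R) :
  measurable_fun setT f -> (forall w, 0 <= f w) ->
  measurable_fun setT (fun w => (Num.sqrt (f w))^-1).
Proof.
move=> mf f0; rewrite (_ : (fun w => _) = fun w => (f w) `^ (- 2^-1)); last first.
  by apply/funext => w; rewrite powRN powR12_sqrt.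
by apply: (measurableT_comp (measurable_powR _) mf).
Qed.

Definition ent (M : T -> 'M[C]_n) (i : 'I_n * 'I_n * bool) (w : T) : R :=
  cpart i.2 (M w i.1.1 i.1.2).

Definition cols (c : nat) : {set 'I_n * 'I_n * bool} :=
  finset (fun i : 'I_n * 'I_n * bool => (c <= i.1.2)%N).

(** The columns of index less than c are arbitrary; they may depend on F. *)
Definition gauss_cols (F : set_system T) (M : T -> 'M[C]_n) (c : nat) : Prop :=
  iid_normal P sg F (ent M) (cols c).

(** A random change of basis, known from F, that keeps the fresh columns
    Gaussian. It fixes the first c basis vectors, for otherwise multiplication
    on the right would mix the columns already revealed into the fresh
    ones. *)
Definition admissible (F : set_system T) (c : nat) (V : T -> 'M[C]_n) : Prop :=
  [/\ forall w, unitary (V w),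
      forall w (i : 'I_n), (i < c)%N -> V w *m ec i = ec i,
      forall i j, cmeas F (fun w => V w i j) &
      forall M, gauss_cols F M c ->
        gauss_cols F (fun w => V w *m M w *m adjmx (V w)) c].

Lemma admissibleM F c U V : admissible F c U -> admissible F c V ->
  admissible F c (fun w => U w *m V w).
Proof.
move=> [uU fU mU gU] [uV fV mV gV]; split.
- by move=> w; exact: unitaryM.
- by move=> w i ic; rewrite -mulmxA fV// fU.
- exact: cmeas_mul_mx.
- move=> M /gV /gU; congr gauss_cols; apply/funext => w.
  by rewrite adjmxM !mulmxA.
Qed.

(** Conjugation multiplies the entry (i, j) by the unit number u_i conj(u_j),
    which rotates the plane of its real and imaginary parts. *)
Lemma admissible_diag F c (u : 'I_n -> T -> C) :
  (forall i w, sqmod (u i w) = 1) -> (forall (i : 'I_n) w, (i < c)%N -> u i w = 1) ->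
  (forall i, cmeas F (u i)) ->
  admissible F c (fun w => diag_mx (\row_i u i w)).
Proof.
move=> u1 uc mu; have VE w i j : diag_mx (\row_i u i w) i j = u i w *+ (i == j).
  by rewrite !mxE.
have adjE w : adjmx (diag_mx (\row_i u i w)) = diag_mx (\row_i Num.conj (u i w)).
  apply/matrixP => i j; rewrite adjmxE !mxE rmorphMn /= eq_sym.
  by case: eqP => [->|].
split.
- move=> w; rewrite /unitary adjE; apply/matrixP => i j.
  rewrite mul_diag_mx !mxE; case: eqP => [->|_]; last by rewrite mulr0.
  by rewrite mulr1n mulrC sqmodE u1.
- move=> w i ic; apply/matrixP => j k; rewrite mul_diag_mx !mxE.
  by have [->|_] := eqVneq j i; [rewrite uc// mul1r|rewrite /= mulr0].
- move=> i j; have [ij|ij] := eqVneq i j.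
    rewrite (_ : (fun w => _) = u i); first exact: mu.
    by apply/funext => w; rewrite VE ij eqxx.
  rewrite (_ : (fun w => _) = fun=> 0); first exact: cmeas_cst.
  by apply/funext => w; rewrite VE (negbTE ij).
- move=> M gM; pose a (i : 'I_n * 'I_n * bool) w := u i.1.1 w * Num.conj (u i.1.2 w).
  have ma i : cmeas F (a i) by apply: cmeasM; [exact: mu|apply: cmeasJ; exact: mu].
  have a1 i w : complex.Re (a i w) ^+ 2 + complex.Im (a i w) ^+ 2 = 1.
    rewrite -[LHS]/(sqmod _); apply: complexI; rewrite -sqmodE /a rmorphM/= conjCK.
    by rewrite mulrACA (mulrC (Num.conj (u i.1.2 w))) !sqmodE !u1 mulr1.
  pose sig (i : 'I_n * 'I_n * bool) := (i.1, ~~ i.2).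
  pose Cf (i : 'I_n * 'I_n * bool) w := complex.Re (a i w).
  pose Sf (i : 'I_n * 'I_n * bool) w :=
    if i.2 then - complex.Im (a i w) else complex.Im (a i w).
  have mS i : measurable_fun setT (Sf i : g_sigma_algebraType F -> R).
    case: i => [ij []]; last exact: (ma (ij, false) false).
    exact: (measurable_funN (ma (ij, true) false)).
  apply: (eq_iid_normal (X := fun i w => Cf i w * ent M i w + Sf i w * ent M (sig i) w)).
    move=> [[i j] b] w _; rewrite /ent /= adjE mul_mx_diag mul_diag_mx !mxE mulrAC.
    rewrite -[X in _ = cpart b X]/(a (i, j, b) w * M w i j).
    rewrite /Cf /Sf /sig /cpart /=.
    by case: b; [move: (a (i, j, true) w)|move: (a (i, j, false) w)] => aa;
      rewrite /= ?ReM ?ImM ?mulNr.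
  apply: iid_normal_rot => //.
  - by case=> ? b; rewrite /sig /= negbK.
  - by move=> [? ?]; rewrite !inE.
  - by move=> i; exact: (ma i true).
  - by move=> i w; rewrite /Sf; case: ifP => _; rewrite ?sqrrN; exact: a1.
  - by move=> [ij []] w; rewrite /Sf /= ?opprK.
  - by move=> [ij []] w.
Qed.

End RandomMatrices.

(** * Reduction of a vector by random Givens rotations *)

Section Givens.
Context d (T : measurableType d) (R : realType) (P : probability T R).
Variables (n : nat) (sg : R).
Hypothesis sg0 : sg != 0.
Local Notation C := (R[i]).
Variables (F : set_system T) (c : nat).

Lemma cpart_realM (a : R) b (z : C) : cpart b ((a%:C)%C * z) = a * cpart b z.
Proof. by case: b; rewrite /cpart ?ReM ?ImM /= mul0r ?subr0 ?addr0. Qed.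

Lemma cpartD b (x y : C) : cpart b (x + y) = cpart b x + cpart b y.
Proof. by case: x y => ? ? [? ?]; case: b. Qed.

Lemma conj_real (a : R) : Num.conj (a%:C)%C = (a%:C)%C.
Proof. by apply: complex_eq; rewrite ?ReJ ?ImJ //= oppr0. Qed.

Lemma sum_mulrn (A : nzRingType) (I : finType) (a : I) (x : A) (f : I -> A) :
  \sum_l x *+ (l == a) * f l = x * f a.
Proof.
rewrite (bigD1 a)//= eqxx big1 ?addr0// => l /negbTE ->.
by rewrite mulr0n mul0r.
Qed.

Section GivensEntries.
Variables (p q : 'I_n).

(** A Givens rotation in the plane of the coordinates p and q is written
    through the transposition of p and q: row i of a product then involves the
    rows i and [swap i] only, which is the form that [iid_normal_rot]
    needs. *)
Definition swap (i : 'I_n) := if i == p then q else if i == q then p else i.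
Definition gcos (k : R) (i : 'I_n) := if (i == p) || (i == q) then k else 1.
Definition gsin (s : R) (i : 'I_n) :=
  if i == p then s else if i == q then - s else 0.

Definition givens (k s : R) : 'M[C]_n :=
  \matrix_(i, j) ((gcos k i)%:C%C *+ (j == i) + (gsin s i)%:C%C *+ (j == swap i)).

Variables (k s : R).

Lemma givens_mull m (A : 'M[C]_(n, m)) i j :
  (givens k s *m A) i j =
  (gcos k i)%:C%C * A i j + (gsin s i)%:C%C * A (swap i) j.
Proof.
rewrite mxE; under eq_bigr do rewrite mxE mulrDl.
by rewrite big_split /= !sum_mulrn.
Qed.

Lemma givens_mulr m (A : 'M[C]_(m, n)) i j :
  (A *m adjmx (givens k s)) i j =
  (gcos k j)%:C%C * A i j + (gsin s j)%:C%C * A i (swap j).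
Proof.
rewrite mxE; under eq_bigr do
  rewrite adjmxE mxE rmorphD !rmorphMn /= !conj_real mulrC mulrDl.
by rewrite big_split /= !sum_mulrn.
Qed.

Hypotheses (pq : p != q) (ks : k ^+ 2 + s ^+ 2 = 1).

Lemma swapK : involutive swap.
Proof.
move=> i; rewrite /swap; have [->|ip] := eqVneq i p.
  by rewrite eq_sym (negbTE pq) eqxx.
by have [->|iq] := eqVneq i q; rewrite ?eqxx// (negbTE ip) (negbTE iq).
Qed.

Lemma gcos_swap i : gcos k (swap i) = gcos k i.
Proof.
rewrite /gcos /swap; have [_|ip] := eqVneq i p; first by rewrite eqxx orbT.
have [_|iq] := eqVneq i q; first by rewrite eqxx.
by rewrite (negbTE ip) (negbTE iq).
Qed.

Lemma gsin_swap i : gsin s (swap i) = - gsin s i.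
Proof.
rewrite /gsin /swap; have [_|ip] := eqVneq i p.
  by rewrite eq_sym (negbTE pq) eqxx.
have [_|iq] := eqVneq i q; first by rewrite eqxx opprK.
by rewrite (negbTE ip) (negbTE iq) oppr0.
Qed.

Lemma gcos_gsin i : gcos k i ^+ 2 + gsin s i ^+ 2 = 1.
Proof.
rewrite /gcos /gsin; have [_|ip] := eqVneq i p; first by [].
by have [_|_] /= := eqVneq i q; rewrite ?sqrrN// expr1n expr0n addr0.
Qed.

Lemma gsin_fix i : swap i = i -> gsin s i = 0 /\ gcos k i = 1.
Proof.
rewrite /swap /gsin /gcos; have [->|ip] := eqVneq i p.
  by move=> e; move: pq; rewrite e eqxx.
by have [->|//] := eqVneq i q; move=> e; move: pq; rewrite e eqxx.
Qed.

Lemma givens_unitary : unitary (givens k s).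
Proof.
apply: mulmx1C; apply/matrixP => i j; rewrite givens_mulr !mxE.
rewrite (inj_eq (inv_inj swapK)) (can2_eq swapK swapK) (eq_sym i j).
have [->|ji] := eqVneq j i; rewrite ?mulr1n ?mulr0n ?add0r ?addr0.
  have [e|e] := eqVneq i (swap i); rewrite ?mulr1n ?mulr0n.
    have [-> ->] := gsin_fix (esym e).
    by rewrite !rmorph0 rmorph1 mul0r !addr0 mulr1.
  by rewrite addr0 add0r -!rmorphM -rmorphD /= -!expr2 gcos_gsin.
have [->|e] := eqVneq j (swap i); rewrite ?mulr1n ?mulr0n ?mulr0 ?addr0//.
by rewrite gcos_swap gsin_swap rmorphN mulNr mulrC subrr.
Qed.

End GivensEntries.

(** Multiplication on the left rotates planes spanned by two entries of a same
    column, multiplication by the adjoint on the right those spanned by two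
    entries of a same row; both are handled by [iid_normal_rot]. *)
Lemma admissible_givens (p q : 'I_n) (k s : T -> R) : p != q -> (c <= p)%N -> (c <= q)%N ->
  measurable_fun setT (k : g_sigma_algebraType F -> R) ->
  measurable_fun setT (s : g_sigma_algebraType F -> R) ->
  (forall w, k w ^+ 2 + s w ^+ 2 = 1) ->
  admissible P sg F c (fun w => givens p q (k w) (s w)).
Proof.
move=> pq cp cq mk ms ks.
have mcos i : measurable_fun setT ((fun w => gcos p q (k w) i) : g_sigma_algebraType F -> R).
  by rewrite /gcos; case: ((i == p) || (i == q)).
have msin i : measurable_fun setT ((fun w => gsin p q (s w) i) : g_sigma_algebraType F -> R).
  rewrite /gsin; case: (i == p); first by [].
  by case: (i == q); first exact: measurable_funN.
split.
- by move=> w; exact: givens_unitary.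
- move=> w i ic; apply/matrixP => j l; rewrite (ord1 l) givens_mull !mxE !andbT.
  have ip : i != p by apply: contraTneq ic => ->; rewrite -leqNgt.
  have iq : i != q by apply: contraTneq ic => ->; rewrite -leqNgt.
  have E : (swap p q j == i) = (j == i).
    rewrite (can2_eq (swapK pq) (swapK pq)) /swap (negbTE ip) (negbTE iq).
    by [].
  rewrite E; have [->|_] := eqVneq j i; last by rewrite !mulr0 addr0.
  by rewrite /gcos /gsin (negbTE ip) (negbTE iq) !mulr1 rmorph1 rmorph0 addr0.
- move=> i j; rewrite (_ : (fun w => _) = fun w => ((gcos p q (k w) i)%:C%C * (j == i)%:R
      + (gsin p q (s w) i)%:C%C * (j == swap p q i)%:R)); last first.
    by apply/funext => w; rewrite mxE !mulr_natr.
  by apply: cmeasD; apply: cmeasM; (exact: cmeas_cst || exact: cmeas_real).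
- move=> M gM.
  pose M1 w := givens p q (k w) (s w) *m M w.
  have gM1 : gauss_cols P sg F M1 c.
    pose sig (i : 'I_n * 'I_n * bool) := (swap p q i.1.1, i.1.2, i.2).
    apply: (eq_iid_normal (X := fun i w => gcos p q (k w) i.1.1 * ent M i w +
        gsin p q (s w) i.1.1 * ent M (sig i) w)).
      by move=> i w _; rewrite /ent /M1 givens_mull cpartD !cpart_realM.
    apply: iid_normal_rot => //.
    + by move=> [[i j] b]; rewrite /sig /= swapK.
    + by move=> [[i j] b]; rewrite !inE.
    + by move=> i w; exact: gcos_gsin.
    + by move=> i w; exact: gcos_swap.
    + by move=> i w; exact: gsin_swap.
    + by move=> [[i j] b] w []; case/(gsin_fix (k w) (s w) pq).
  pose sig (i : 'I_n * 'I_n * bool) := (i.1.1, swap p q i.1.2, i.2).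
  apply: (eq_iid_normal (X := fun i w => gcos p q (k w) i.1.2 * ent M1 i w +
      gsin p q (s w) i.1.2 * ent M1 (sig i) w)).
    by move=> i w _; rewrite /ent givens_mulr cpartD !cpart_realM.
  apply: iid_normal_rot => //.
  + by move=> [[i j] b]; rewrite /sig /= swapK.
  + by move=> [[i j] b]; rewrite !inE /sig /swap /=; do 2?case: ifP.
  + by move=> i w; exact: gcos_gsin.
  + by move=> i w; exact: gcos_swap.
  + by move=> i w; exact: gsin_swap.
  + by move=> [[i j] b] w []; case/(gsin_fix (k w) (s w) pq).
Qed.

End Givens.

Section Reduction.
Context d (T : measurableType d) (R : realType) (P : probability T R).
Variables (n : nat) (sg : R).
Hypothesis sg0 : sg != 0.
Local Notation C := (R[i]).
Variables (F : set_system T) (c : nat).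

Lemma sqmodM (x y : C) : sqmod (x * y) = sqmod x * sqmod y.
Proof. by case: x y => a b [e f]; rewrite /sqmod ReM ImM /=; ring. Qed.

Lemma sqmodJ (x : C) : sqmod (Num.conj x) = sqmod x.
Proof. by rewrite /sqmod ReJ ImJ sqrrN. Qed.

Lemma sqmod_real (a : R) : sqmod ((a%:C)%C) = a ^+ 2.
Proof. by rewrite /sqmod /= expr0n addr0. Qed.

Lemma cmeas_if (b : T -> bool) (x y : T -> C) :
  measurable_fun setT (b : g_sigma_algebraType F -> bool) ->
  cmeas F x -> cmeas F y -> cmeas F (fun w => if b w then x w else y w).
Proof.
move=> mb mx my k; rewrite (_ : (fun w => _) =
    fun w => if b w then cpart k (x w) else cpart k (y w)); last first.
  by apply/funext => w; case: (b w).
exact: measurable_fun_ifT mb (mx k) (my k).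
Qed.

Definition phase (z : C) : C :=
  if sqmod z == 0 then 1 else Num.conj z * ((Num.sqrt (sqmod z))^-1)%:C%C.

Lemma sqmod_phase z : sqmod (phase z) = 1.
Proof.
rewrite /phase; case: eqP => [_|/eqP z0]; first by rewrite sqmod_real expr1n.
rewrite sqmodM sqmodJ sqmod_real exprVn sqr_sqrtr ?sqmod_ge0//.
by rewrite divff.
Qed.

Lemma phaseM z : phase z * z = (Num.sqrt (sqmod z))%:C%C.
Proof.
rewrite /phase; case: eqP => [z0|/eqP z0].
  by rewrite z0 sqrtr0 mul1r; apply/eqP; rewrite -sqmod_eq0 z0.
rewrite mulrC mulrA sqmodE -rmorphM /=; congr (_%:C)%C.
rewrite -[X in X / _](sqr_sqrtr (sqmod_ge0 z)) expr2 mulfK//.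
by rewrite sqrtr_eq0 -ltNge lt_def z0 sqmod_ge0.
Qed.

Lemma cmeas_phase z : cmeas F z -> cmeas F (fun w => phase (z w)).
Proof.
move=> mz; apply: (cmeas_if (b := fun w => sqmod (z w) == 0)).
- by apply: measurable_fun_eqr; [exact: measurable_sqmod|exact: measurable_cst].
- exact: cmeas_cst.
- apply: cmeasM; first exact: cmeasJ.
  apply: cmeas_real; apply: measurable_invsqrt; first exact: measurable_sqmod.
  by move=> w; exact: sqmod_ge0.
Qed.

Definition nonneg (z : C) := 0 <= complex.Re z /\ complex.Im z = 0.

(** Phases first make the coordinates of index at least c nonnegative. Givens
    rotations in the planes (k, k+1), for k decreasing to c, then cancel these
    coordinates one after the other, the last one first. *)
Lemma admissible_reduction (p : T -> 'cV[C]_n) : (c < n)%N ->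
  (forall i, cmeas F (fun w => p w i 0)) ->
  exists2 V, admissible P sg F c V & forall w,
    (forall i : 'I_n, (c < i)%N -> (V w *m p w) i 0 = 0) /\
    (forall i : 'I_n, c = i :> nat -> nonneg ((V w *m p w) i 0)).
Proof.
move=> cn mp.
suff H m k : (k + m = n.-1)%N -> (c <= k)%N ->
    exists2 V, admissible P sg F c V & forall w,
    (forall i : 'I_n, (k < i)%N -> (V w *m p w) i 0 = 0) /\
    (forall i : 'I_n, (c <= i)%N -> nonneg ((V w *m p w) i 0)).
  have cn1 : (c <= n.-1)%N by rewrite -ltnS (ltn_predK cn).
  have [V aV HV] := H (n.-1 - c)%N c (subnKC cn1) (leqnn _).
  exists V => // w; have [V1 V2] := HV w.
  by split => // i ci; apply: V2; rewrite ci.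
elim: m k => [|m IH] k km ck.
  pose u (i : 'I_n) w := if (c <= i)%N then phase (p w i 0) else 1.
  exists (fun w => diag_mx (\row_i u i w)).
    apply: admissible_diag => //.
    - by move=> i w; rewrite /u; case: ifP => _; rewrite ?sqmod_phase// sqmod_real expr1n.
    - by move=> i w ic; rewrite /u leqNgt ic.
    - move=> i; rewrite /u; case: (c <= i)%N; last exact: cmeas_cst.
      exact: cmeas_phase.
  move=> w; split => i; first by rewrite -[k]addn0 km ltnNge -ltnS (ltn_predK cn) ltn_ord.
  move=> ci; rewrite mul_diag_mx !mxE /u ci phaseM.
  by split => //=; exact: sqrtr_ge0.
have [|V aV HV] := IH k.+1 _ (leqW ck); first by rewrite addSnnS.
have kn : (k.+1 < n)%N by rewrite -(ltn_predK cn) ltnS -km addnS ltnS leq_addr.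
pose a : 'I_n := Ordinal (ltnW kn); pose b : 'I_n := Ordinal kn.
have ab : a != b by rewrite -val_eqE /= neq_ltn ltnSn.
have mV : forall i, cmeas F (fun w => (V w *m p w) i 0).
  by case: aV => _ _ mV _ i; apply: cmeas_mul_mx => // i' j; rewrite (ord1 j).
pose x w := complex.Re ((V w *m p w) a 0); pose y w := complex.Re ((V w *m p w) b 0).
have mx : measurable_fun setT (x : g_sigma_algebraType F -> R) := mV a true.
have my : measurable_fun setT (y : g_sigma_algebraType F -> R) := mV b true.
pose q w := x w ^+ 2 + y w ^+ 2.
have q0 w : 0 <= q w by rewrite addr_ge0 ?sqr_ge0.
have mq : measurable_fun setT (q : g_sigma_algebraType F -> R).
  by apply: measurable_funD; exact: measurable_funX.
have mis : measurable_fun setT ((fun w => (Num.sqrt (q w))^-1) : g_sigma_algebraType F -> R).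
  exact: measurable_invsqrt.
pose cs w := if q w == 0 then 1 else x w * (Num.sqrt (q w))^-1.
pose sn w := y w * (Num.sqrt (q w))^-1.
have mcs : measurable_fun setT (cs : g_sigma_algebraType F -> R).
  apply: measurable_fun_ifT; last exact: measurable_funM.
    by apply: measurable_fun_eqr.
  exact: measurable_cst.
have msn : measurable_fun setT (sn : g_sigma_algebraType F -> R).
  exact: measurable_funM.
have xy0 w : q w = 0 -> x w = 0 /\ y w = 0.
  by move/eqP; rewrite /q paddr_eq0 ?sqr_ge0// !sqrf_eq0 => /andP[/eqP -> /eqP ->].
have cssn w : cs w ^+ 2 + sn w ^+ 2 = 1.
  rewrite /cs /sn; case: eqP => [q00|/eqP q00].
    by have [_ ->] := xy0 w q00; rewrite mul0r expr0n addr0 expr1n.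
  by rewrite !exprMn exprVn sqr_sqrtr// -mulrDl divff.
exists (fun w => givens a b (cs w) (sn w) *m V w).
  apply: (admissibleM _ aV).
  exact: (admissible_givens _ sg0 ab ck (leqW ck) mcs msn cssn).
move=> w; have [V1 V2] := HV w.
have nna : nonneg ((V w *m p w) a 0) by exact: V2.
have nnb : nonneg ((V w *m p w) b 0) by apply: V2; exact: leqW.
have Ea : (V w *m p w) a 0 = (x w)%:C%C by apply: complex_eq => //; case: nna.
have Eb : (V w *m p w) b 0 = (y w)%:C%C by apply: complex_eq => //; case: nnb.
have Sab : swap a b a = b by rewrite /swap eqxx.
have Sba : swap a b b = a by rewrite /swap eq_sym (negbTE ab) eqxx.
have zb : (givens a b (cs w) (sn w) *m (V w *m p w)) b 0 = 0.
  rewrite givens_mull Sba Ea Eb /gcos /gsin eqxx orbT eq_sym (negbTE ab).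
  rewrite -!rmorphM -rmorphD /=; apply: complex_eq => //=.
  rewrite /cs /sn; case: eqP => [q00|_]; last by ring.
  by have [-> ->] := xy0 w q00; rewrite !mulr0 addr0.
have za : nonneg ((givens a b (cs w) (sn w) *m (V w *m p w)) a 0).
  rewrite givens_mull Sab Ea Eb /gcos /gsin eqxx /=.
  rewrite -!rmorphM -rmorphD /=; split => //=; rewrite /cs /sn.
  case: eqP => [q00|_]; first by have [-> ->] := xy0 w q00; rewrite !mulr0 addr0.
  have : 0 <= (Num.sqrt (q w))^-1 by rewrite invr_ge0 sqrtr_ge0.
  move: (_^-1) => e e0; rewrite (_ : _ + _ = q w * e); first exact: mulr_ge0.
  by rewrite /q; ring.
have zo (i : 'I_n) : i != a -> i != b ->
    (givens a b (cs w) (sn w) *m (V w *m p w)) i 0 = (V w *m p w) i 0.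
  move=> ia ib; rewrite givens_mull /gcos /gsin (negbTE ia) (negbTE ib) /=.
  by rewrite mul1r mul0r addr0.
split => i; rewrite -mulmxA.
  have [->//|ib] := eqVneq i b => ki.
  have ia : i != a by rewrite -val_eqE /= gtn_eqF.
  rewrite zo//; apply: V1; rewrite ltn_neqAle ki andbT eq_sym.
  by rewrite -val_eqE in ib.
have [->|ib] := eqVneq i b; first by rewrite zb.
by have [->//|ia] := eqVneq i a => ci; rewrite zo//; exact: V2.
Qed.

End Reduction.

(** * Concentration of a Gaussian column *)

Section OffSmallEvents.
Context d (T : measurableType d) (R : realType) (P : probability T R).

(** As Q is not known to be measurable, an event outside which it holds is
    measured. *)
Definition holds_off (e : R) (Q : T -> Prop) : Prop :=
  exists B, [/\ measurable B, (P B <= e%:E)%E & forall w, ~ B w -> Q w].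

Lemma holds_offT e (Q : T -> Prop) : 0 <= e -> (forall w, Q w) -> holds_off e Q.
Proof. by move=> e0 HQ; exists set0; split => //; rewrite measure0 lee_fin. Qed.

Lemma holds_offW e e' (Q Q' : T -> Prop) : e <= e' -> (forall w, Q w -> Q' w) ->
  holds_off e Q -> holds_off e' Q'.
Proof.
move=> ee' QQ' [B [mB PB HB]]; exists B; split => //; last by move=> w /HB /QQ'.
by apply: le_trans PB _; rewrite lee_fin.
Qed.

Lemma holds_offI e1 e2 (Q1 Q2 : T -> Prop) : holds_off e1 Q1 -> holds_off e2 Q2 ->
  holds_off (e1 + e2) (fun w => Q1 w /\ Q2 w).
Proof.
move=> [B1 [m1 P1 H1]] [B2 [m2 P2 H2]]; exists (B1 `|` B2); split.
- exact: measurableU.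
- apply: (@le_trans _ _ (P B1 + P B2)%E); first exact: measureU2.
  by rewrite EFinD leeD.
- by move=> w /not_orP [/H1 ? /H2 ?].
Qed.

Lemma holds_off_forall (I : finType) e (Q : I -> T -> Prop) : 0 <= e ->
  (forall i, holds_off e (Q i)) ->
  holds_off (#|I|%:R * e) (fun w => forall i, Q i w).
Proof.
move=> e0 HQ.
suff H (s : seq I) : holds_off ((size s)%:R * e) (fun w => forall i, i \in s -> Q i w).
  rewrite cardE; apply: holds_offW (H (enum I)) => // w Hw i.
  by apply: Hw; rewrite mem_enum.
elim: s => [|i s IH]; first by rewrite mul0r; apply: holds_offT.
rewrite /= -natr1 mulrDl mul1r addrC; apply: holds_offW (holds_offI (HQ i) IH) => //.
by move=> w [Qi Qs] j; rewrite inE => /orP[/eqP ->//|/Qs].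
Qed.

(** Chernoff's method: Markov's inequality for the exponential of f. *)
Lemma exp_markov (f : T -> R) (a c : R) : measurable_fun setT f ->
  (\int[P]_w (expR (f w))%:E = c%:E)%E ->
  holds_off (expR (- a) * c) (fun w => f w < a).
Proof.
move=> mf fc; pose A := [set w | a <= f w].
have mA : measurable A.
  have := measurable_fun_ler (measurable_cst a) mf.
  by move=> /(_ measurableT [set true] _); rewrite setTI; apply.
exists A; split => //; last by move=> w /negP; rewrite -ltNge.
rewrite expRN mulrC EFinM lee_pdivlMr ?expR_gt0//.
have mi : measurable_fun setT (fun w => (\1_A w)%:E : \bar R).
  by apply/measurable_EFinP; exact: measurable_indic.
have i0 (w : T) : setT w -> (0 <= (\1_A w)%:E :> \bar R)%E by rewrite lee_fin.
have ea0 : (0 <= (expR a)%:E)%E by rewrite lee_fin expR_ge0.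
rewrite muleC -fc (measure_integral_indic P mA).
rewrite -(ge0_integralZl _ measurableT mi i0 ea0).
have f10 (w : T) : setT w -> (0 <= (expR a)%:E * (\1_A w)%:E :> \bar R)%E.
  by move=> wT; rewrite mule_ge0// i0.
have mf1 : measurable_fun setT (fun w => ((expR a)%:E * (\1_A w)%:E : \bar R)%E).
  exact: emeasurable_funM.
have mf2 : measurable_fun setT (fun w => (expR (f w))%:E : \bar R).
  by apply/measurable_EFinP; exact: measurableT_comp.
apply: (@ge0_le_integral _ T R P setT measurableT _ _ f10 mf1 mf2).
- move=> w _; rewrite -EFinM lee_fin indicE; case: (boolP (w \in A)) => wA.
    by rewrite mulr1 ler_expR; rewrite inE in wA.
  by rewrite mulr0 expR_ge0.
Qed.

End OffSmallEvents.

Section Concentration.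
Context d (T : measurableType d) (R : realType) (P : probability T R).
Variables (n : nat) (n0 : (0 < n)%N).
Local Notation C := (R[i]).
Let sg : R := Num.sqrt (n%:R^-1 / 2).

Let nR0 : 0 < n%:R :> R. Proof. by rewrite ltr0n. Qed.

Lemma sg_neq0 : sg != 0.
Proof. by rewrite gt_eqF// sqrtr_gt0 divr_gt0// invr_gt0. Qed.

Let sg2 : 2 * sg ^+ 2 = n%:R^-1.
Proof.
rewrite sqr_sqrtr ?mulr_ge0 ?invr_ge0 ?ltW//.
by rewrite mulrC divfK// pnatr_eq0.
Qed.

(** The variables are the real and imaginary parts of m complex entries. Their
    number being even, the square root of [normal_exp_sqr] disappears. *)
Lemma chi_square_tail F (I : finType) (X : I -> T -> R) (K : {set I}) m (l a : R) :
  iid_normal P sg F X K -> #|K| = m.*2 -> l < n%:R ->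
  holds_off P (expR (- a) * (1 - l / n%:R)^-1 ^+ m)
    (fun w => l * \sum_(i in K) X i w ^+ 2 < a).
Proof.
move=> XK Km ln; have [_ mX _] := XK.
have e2 : 1 - 2 * l * sg ^+ 2 = 1 - l / n%:R by rewrite -sg2; ring.
have l1 : 2 * l * sg ^+ 2 < 1.
  by rewrite -subr_gt0 e2 subr_gt0 ltr_pdivrMr// mul1r.
apply: exp_markov.
  apply: measurable_funM => //.
  rewrite (_ : (fun w => _) =
      fun w => \sum_i (if i \in K then X i w ^+ 2 else 0)); last first.
    by apply/funext => w; rewrite big_mkcond.
  apply: measurable_sum => i; case: (boolP (i \in K)) => iK //.
  by apply: measurable_funX; exact: mX.
transitivity (\int[P]_w (\prod_(i in K) expR (l * X i w ^+ 2))%:E)%E.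
  by apply: eq_integral => w _; rewrite mulr_sumr expR_sum.
have mf : measurable_fun setT (fun x : R => expR (l * x ^+ 2)).
  have mf0 : measurable_fun setT (fun x : R => l * x ^+ 2).
    apply: measurable_funM; first exact: measurable_cst.
    exact: exprn_measurable.
  exact: (measurableT_comp (@measurable_expR R) mf0).
rewrite (iid_normal_expectation mf (fun x => expR_ge0 _) XK).
rewrite (normal_exp_sqr sg_neq0 l1) e2.
have k0 : 0 < 1 - l / n%:R by rewrite subr_gt0 ltr_pdivrMr// mul1r.
rewrite -[X in _ = (X ^+ _)%:E](sqr_sqrtr (a := _^-1)); last by rewrite invr_ge0 ltW.
rewrite -exprM mul2n -Km sqrtrV ?ltW//.
by rewrite -prodr_const; elim/big_rec2: _ => // i y1 y2 _ ->.
Qed.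

Definition column (j : 'I_n) : {set 'I_n * 'I_n * bool} :=
  finset (fun k : 'I_n * 'I_n * bool => k.1.2 == j).

Lemma sum_column (V : nmodType) (f : 'I_n * 'I_n * bool -> V) j :
  \sum_(k in column j) f k = \sum_i (f (i, j, true) + f (i, j, false)).
Proof.
rewrite big_mkcond /= (eq_bigr (fun k : 'I_n * 'I_n * bool =>
  if k.1.2 == j then f (k.1, k.2) else 0)); last first.
  by move=> [[i k] b] _; rewrite inE.
rewrite -(pair_bigA _ (fun x b => if x.2 == j then f (x, b) else 0)) /=.
under eq_bigr do rewrite big_bool /=.
rewrite (eq_bigr (fun p : 'I_n * 'I_n =>
    (if p.2 == j then f (p.1, p.2, true) else 0) +
    (if p.2 == j then f (p.1, p.2, false) else 0))); last by case.
rewrite -(pair_bigA _ (fun i k => (if k == j then f (i, k, true) else 0) +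
  (if k == j then f (i, k, false) else 0))) /=.
apply: eq_bigr => i _; rewrite (bigD1 j)//= eqxx big1 ?addr0// => k /negbTE ->.
by rewrite addr0.
Qed.

Lemma card_column j : #|column j| = n.*2.
Proof.
rewrite -sum1_card (sum_column (fun=> 1%N)) (eq_bigr (fun=> 2%N))//.
by rewrite sum_nat_const card_ord muln2.
Qed.

Definition entry (i j : 'I_n) : {set 'I_n * 'I_n * bool} :=
  finset (fun k : 'I_n * 'I_n * bool => k.1 == (i, j)).

Lemma sum_entry (V : nmodType) (f : 'I_n * 'I_n * bool -> V) i j :
  \sum_(k in entry i j) f k = f (i, j, true) + f (i, j, false).
Proof.
rewrite big_mkcond /= (eq_bigr (fun k : 'I_n * 'I_n * bool =>
  if k.1 == (i, j) then f (k.1, k.2) else 0)); last first.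
  by move=> [k b] _; rewrite inE.
rewrite -(pair_bigA _ (fun x b => if x == (i, j) then f (x, b) else 0)) /=.
rewrite (bigD1 (i, j))//= eqxx big_bool big1 ?addr0// => k /negbTE ->.
by rewrite big1.
Qed.

Lemma card_entry i j : #|entry i j| = 1.*2.
Proof. by rewrite -sum1_card (sum_entry (fun=> 1%N)). Qed.

Lemma sum_sqr_ent (M : T -> 'M[C]_n) w (j : 'I_n) :
  \sum_(k in column j) ent M k w ^+ 2 = \sum_i sqmod (M w i j).
Proof. by rewrite (sum_column (fun k => ent M k w ^+ 2)). Qed.

Definition col_good (delta : R) (p : 'cV[C]_n) :=
  (forall i, sqmod (p i 0) <= delta ^+ 2) /\
  `|\sum_i sqmod (p i 0) - 1| <= delta.

(** A union bound over two failures for each entry and the two deviations of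
    the squared length. *)
Definition col_risk (delta : R) : R :=
  (2 * n%:R + 2) * expR (- (n%:R * delta ^+ 2 / 8)).

(** Because (1 - x) (1 + x + 2 x^2) = 1 + x^2 (1 - 2 x) >= 1. *)
Lemma geom_le_exp (x : R) : `|x| <= 2^-1 -> (1 - x)^-1 <= expR (x + 2 * x ^+ 2).
Proof.
move=> x2; have /andP[x2l x2r] : - 2^-1 <= x <= 2^-1 by rewrite -ler_norml.
have x1 : 0 < 1 - x by lra.
rewrite -[leLHS]mul1r ler_pdivrMr// mulrC.
apply: (@le_trans _ _ ((1 - x) * (1 + (x + 2 * x ^+ 2)))); last first.
  by rewrite ler_wpM2l ?(ltW x1)// expR_ge1Dx.
have -> : (1 - x) * (1 + (x + 2 * x ^+ 2)) = 1 + x ^+ 2 * (1 - 2 * x) by ring.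
by rewrite lerDl mulr_ge0 ?sqr_ge0//; lra.
Qed.

Lemma col_concentration F (M : T -> 'M[C]_n) c (j : 'I_n) (delta : R) :
  gauss_cols P sg F M c -> (c <= j)%N -> 0 < delta <= 1 ->
  holds_off P (col_risk delta) (fun w => col_good delta (col j (M w))).
Proof.
move=> gM cj /andP[d0 d1].
have sub1 : column j \subset cols n c.
  by apply/fintype.subsetP => k; rewrite !inE => /eqP ->.
have sub2 i : entry i j \subset cols n c.
  by apply/fintype.subsetP => k; rewrite !inE => /eqP ->.
have g1 := iid_normal_sub sub1 gM.
have g2 i := iid_normal_sub (sub2 i) gM.
set e := expR (- (n%:R * delta ^+ 2 / 8)).
have e0 : 0 <= e by exact: expR_ge0.
have n1 : (n%:R : R) != 0 by rewrite gt_eqF.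
have bound (x : R) a : `|x| <= 2^-1 ->
    - a + n%:R * (x + 2 * x ^+ 2) <= - (n%:R * delta ^+ 2 / 8) ->
    expR (- a) * (1 - x)^-1 ^+ n <= e.
  move=> x2 ax; apply: (@le_trans _ _ (expR (- a) * expR (x + 2 * x ^+ 2) ^+ n)).
    rewrite ler_wpM2l ?expR_ge0// lerXn2r ?nnegrE ?expR_ge0 ?geom_le_exp//.
    rewrite invr_ge0; have := ler_norm x; lra.
  by rewrite -expRM_natl -expRD ler_expR.
(* Exponent l = n / 2 for one entry; l = n delta / 4 and its opposite for the
   two deviations of the squared length. *)
have Hi i : holds_off P (2 * e) (fun w => sqmod (M w i j) <= delta ^+ 2).
  have := @chi_square_tail _ _ _ _ 1 (n%:R / 2) (n%:R / 2 * delta ^+ 2) (g2 i) (card_entry i j).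
  have hn : n%:R / 2 < n%:R :> R by rewrite ltr_pdivrMr// ltr_pMr// ltr1n.
  move=> /(_ hn); apply: holds_offW.
    rewrite expr1 mulrC (_ : (1 - _)^-1 = 2).
      rewrite ler_wpM2l// ler_expR lerN2.
      have : 0 <= n%:R * delta ^+ 2 by rewrite mulr_ge0 ?sqr_ge0// ltW.
      lra.
    rewrite mulrAC divff// mul1r (_ : 1 - 2^-1 = 2^-1) ?invrK//; lra.
  move=> w; rewrite (sum_entry (fun k => ent M k w ^+ 2)) ltr_pM2l ?divr_gt0//.
  by move/ltW.
have Hs (s : bool) : holds_off P e (fun w => (-1) ^+ s * n%:R * (delta / 4) *
    \sum_i sqmod (M w i j) < (-1) ^+ s * n%:R * (delta / 4) + n%:R * delta ^+ 2 / 4).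
  set x := (-1) ^+ s * (delta / 4).
  have xE : (-1) ^+ s * n%:R * (delta / 4) = x * n%:R by rewrite /x mulrAC.
  have x2 : `|x| = delta / 4.
    by rewrite normrM normrX normrN1 expr1n mul1r ger0_norm// ltW// divr_gt0.
  have xx : x ^+ 2 = delta ^+ 2 / 16.
    by rewrite exprMn -exprM mulnC exprM sqrrN !expr1n mul1r; field.
  have := @chi_square_tail _ _ _ _ n (x * n%:R)
    (x * n%:R + n%:R * delta ^+ 2 / 4) g1 (card_column j).
  have hn : x * n%:R < n%:R.
    by rewrite gtr_pMl//; have := ler_norm x; rewrite x2; lra.
  move=> /(_ hn); apply: holds_offW.
    rewrite mulfK//; apply: bound; first by rewrite x2; lra.
    by rewrite xx; lra.
  by move=> w; rewrite sum_sqr_ent xE.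
have H := holds_offI (holds_off_forall (mulr_ge0 (ler0n _ 2) e0) Hi)
  (holds_offI (Hs false) (Hs true)).
apply: holds_offW H; first by rewrite card_ord /col_risk -/e; lra.
move=> w [H1 [H2 H3]]; split; first by move=> i; rewrite mxE.
under eq_bigr do rewrite mxE.
have nd : 0 < n%:R * (delta / 4) by rewrite mulr_gt0// divr_gt0.
have nE : n%:R * delta ^+ 2 / 4 = n%:R * (delta / 4) * delta by field.
rewrite ler_norml; apply/andP; split.
  rewrite -(ler_pM2l nd); move: H3; rewrite expr1 nE; lra.
rewrite -(ler_pM2l nd); move: H2; rewrite expr0 nE; lra.
Qed.

End Concentration.

(** * Hessenberg form of a matrix with Gaussian columns *)

Section FixedVectors.
Context {R : realType}.
Local Notation C := (R[i]).
Variable n : nat.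
Implicit Types (U V : 'M[C]_n) (y : 'cV[C]_n) (i : 'I_n).

Lemma mulmx_ec m (A : 'M[C]_(m, n)) i k : (A *m ec i) k 0 = A k i.
Proof.
rewrite mxE (bigD1 i)//= mxE !eqxx mulr1 big1 ?addr0// => l /negbTE li.
by rewrite mxE li mulr0.
Qed.

Lemma fix_adj U i : unitary U -> U *m ec i = ec i -> adjmx U *m ec i = ec i.
Proof. by move=> hU {1}<-; rewrite mulmxA hU mul1mx. Qed.

Lemma fix_row U i m (A : 'M[C]_(n, m)) k : unitary U -> U *m ec i = ec i ->
  (U *m A) i k = A i k.
Proof.
move=> hU /(fix_adj hU) fU; rewrite mxE (bigD1 i)//=.
have E l : U i l = (l == i)%:R.
  rewrite -[U]adjmxK adjmxE -mulmx_ec fU mxE eqxx andbT.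
  by rewrite rmorph_nat.
rewrite E eqxx mul1r big1 ?addr0// => l /negbTE li.
by rewrite E li mul0r.
Qed.

Lemma fix_vec U y (c : nat) : (forall i, (i < c)%N -> U *m ec i = ec i) ->
  (forall i, (c <= i)%N -> y i 0 = 0) -> U *m y = y.
Proof.
move=> fU y0; apply/matrixP => k j; rewrite (ord1 j) mxE.
rewrite (eq_bigr (fun l => ec l k 0 * y l 0)); last first.
  move=> l _; case: (ltnP l c) => lc; last by rewrite y0// !mulr0.
  by rewrite -mulmx_ec fU.
rewrite (bigD1 k)//= mxE !eqxx mul1r big1 ?addr0// => l kl.
by rewrite mxE eq_sym (negbTE kl) mul0r.
Qed.

Lemma sum_sqmod y : ((\sum_i sqmod (y i 0))%:C)%C = (adjmx y *m y) 0 0.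
Proof.
rewrite rmorph_sum mxE; apply: eq_bigr => i _.
by rewrite adjmxE mulrC sqmodE.
Qed.

Lemma unitary_sum_sqmod U y : unitary U ->
  \sum_i sqmod ((U *m y) i 0) = \sum_i sqmod (y i 0).
Proof.
move=> hU; apply: complexI; rewrite !sum_sqmod adjmxM mulmxA -(mulmxA (adjmx y)).
by rewrite hU mulmx1.
Qed.

(** In these columns H is close to the shift e_j -> e_(j+1). The entries on
    and above the diagonal are merely small; what they take from the squared
    length of the column is the term (j+1) delta^2 of the subdiagonal
    entry. *)
Definition near_shift (delta : R) (c k : nat) (H : 'M[C]_n) : Prop :=
  forall j : 'I_n, (c <= j < c + k)%N ->
  [/\ forall i : 'I_n, (i <= j)%N -> sqmod (H i j) <= delta ^+ 2,
      forall i : 'I_n, (j.+1 < i)%N -> H i j = 0 &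
      forall i : 'I_n, i = j.+1 :> nat -> nonneg (H i j) /\
        `|sqmod (H i j) - 1| <= delta + j.+1%:R * delta ^+ 2].

End FixedVectors.

Section Hessenberg.
Context d (T : measurableType d) (R : realType) (P : probability T R).
Variables (n : nat) (n0 : (0 < n)%N).
Local Notation C := (R[i]).
Let sg : R := Num.sqrt (n%:R^-1 / 2).

(** Column c is revealed, and an admissible unitary that fixes e_0, ..., e_c
    reduces it to a multiple of e_(c+1) below the diagonal; the later columns
    stay Gaussian given what is known. The unitaries of the next steps fix
    e_0, ..., e_(c+1), hence leave the reduced column as it is. Its entries
    are close to those of e_(c+1) by [col_concentration]. *)
Lemma hessenberg (delta : R) k c F (M : T -> 'M[C]_n) : 0 < delta <= 1 ->
  (c + k < n)%N -> gauss_cols P sg F M c ->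
  holds_off P (k%:R * col_risk n delta) (fun w => exists U : 'M[C]_n,
    [/\ unitary U, forall i : 'I_n, (i < c.+1)%N -> U *m ec i = ec i &
        near_shift delta c k (U *m M w *m adjmx U)]).
Proof.
move=> dl; elim: k c F M => [|k IH] c F M ckn gM.
  apply: holds_offT; first by rewrite mul0r.
  move=> w; exists 1%:M; split.
  - by rewrite /unitary adjmx1 mulmx1.
  - by move=> i _; rewrite mul1mx.
  - by move=> j; rewrite addn0 ltnNge; case/andP => ->.
have cn : (c < n)%N by apply: leq_ltn_trans ckn; exact: leq_addr.
have c1n : (c.+1 < n)%N by apply: leq_ltn_trans ckn; rewrite -addn1 leq_add2l.
pose j0 := Ordinal cn.
have good := col_concentration n0 gM (leqnn j0) dl.
pose J := column j0.
have JK : J \subset cols n c.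
  by apply/fintype.subsetP => i; rewrite !inE => /eqP ->.
have := iid_normal_adjoin JK gM; set F' := adjoin F (ent M) J.
have -> : cols n c :\: J = cols n c.+1.
  by apply/setP => i; rewrite !inE -val_eqE /= ltn_neqAle eq_sym.
move=> gM'.
have mp i : cmeas F' (fun w => col j0 (M w) i 0).
  move=> b _ Y mY; rewrite setTI; apply: sub_sigma_algebra.
  rewrite (_ : _ @^-1` Y = ent M (i, j0, b) @^-1` Y).
    by apply: adjoin_preimage => //; rewrite inE.
  by apply/seteqP; split => w; rewrite /ent /= mxE.
have [V [uV fV mV gV] HV] := admissible_reduction P (sg_neq0 R n0) c1n mp.
pose M' w := V w *m M w *m adjmx (V w).
have IHM := IH c.+1 F' M' _ (gV _ gM').
rewrite addSnnS in IHM.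
have := holds_offI good (IHM ckn); apply: holds_offW.
  by rewrite -natr1 mulrDl mul1r addrC.
move=> w [[p1 p2] [U [uU fU nU]]].
exists (U *m V w); split.
- exact: unitaryM.
- by move=> i ic; rewrite -mulmxA fV// fU// ltnW.
have -> : U *m V w *m M w *m adjmx (U *m V w) = U *m M' w *m adjmx U.
  by rewrite adjmxM /M' !mulmxA.
move=> j /andP[cj jck].
have [cj'|jc] := ltnP c j; first by apply: nU; rewrite cj' addSnnS.
have {jc cj}jE : j = j0 by apply/val_inj/eqP; rewrite eqn_leq cj jc.
pose y := V w *m col j0 (M w).
have [y0 y1] := HV w.
have fj0V : V w *m ec j0 = ec j0 by apply: fV; rewrite ltnS.
have fj0U : U *m ec j0 = ec j0 by apply: fU; rewrite ltnS leqW.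
have yE : (U *m M' w *m adjmx U) *m ec j0 = y.
  rewrite -!mulmxA (fix_adj uU fj0U) /M' /= (fix_adj (uV w) fj0V).
  have -> : M w *m ec j0 = col j0 (M w).
    by apply/matrixP => i l; rewrite (ord1 l) mulmx_ec mxE.
  exact: (fix_vec fU).
have HE (i : 'I_n) : (U *m M' w *m adjmx U) i j = y i 0 by rewrite jE -yE mulmx_ec.
have ylow (i : 'I_n) : (i <= c)%N -> y i 0 = col j0 (M w) i 0.
  by move=> ic; apply: fix_row => //; exact: fV.
have jc : j = c :> nat by rewrite jE.
split => i; rewrite HE jc.
- by move=> ic; rewrite ylow.
- exact: y0.
- move=> ic; split; first by apply: y1; rewrite ic.
have ysum : \sum_l sqmod (y l 0) = \sum_l sqmod (col j0 (M w) l 0).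
  exact: unitary_sum_sqmod.
have : \sum_l sqmod (y l 0) = sqmod (y i 0) + \sum_(l : 'I_n | (l <= c)%N) sqmod (y l 0).
  rewrite (bigD1 i)//=; congr (_ + _); rewrite [RHS]big_mkcond [LHS]big_mkcond /=.
  apply: eq_bigr => l _; rewrite -val_eqE /= ic; case: (ltngtP l c.+1) => lc.
  - by rewrite -ltnS lc.
  - by rewrite leqNgt (ltnW lc) /= y0//; apply/eqP; rewrite sqmod_eq0.
  - by rewrite lc ltnn.
set b := (X in _ = _ + X) => sumE.
have b0 : 0 <= b by apply: sumr_ge0 => l _; exact: sqmod_ge0.
have bK : b <= c.+1%:R * delta ^+ 2.
  apply: (@le_trans _ _ (\sum_(l : 'I_n | (l <= c)%N) delta ^+ 2)).
    by rewrite /b; apply: ler_sum => l lc; rewrite ylow.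
  rewrite sumr_const -[leLHS]mulr_natl ler_wpM2r ?sqr_ge0// ler_nat.
  rewrite -sum1_card (eq_bigl (fun l : 'I_n => (l < c.+1)%N))//.
  by rewrite (big_ord_narrow (F := fun=> 1%N) cn) sum1_card card_ord.
move: p2; rewrite -ysum sumE !ler_norml => /andP[h1 h2]; apply/andP; split.
  by lra.
have : 0 <= c.+1%:R * delta ^+ 2 by rewrite mulr_ge0 ?sqr_ge0.
by lra.
Qed.

(** A vector independent of the matrix is first rotated onto e_0, which leaves
    all columns Gaussian. *)
Lemma krylov_hessenberg (delta : R) k F (M : T -> 'M[C]_n) (v : T -> 'cV[C]_n) :
  0 < delta <= 1 -> (k < n)%N -> gauss_cols P sg F M 0 ->
  (forall i, cmeas F (fun w => v w i 0)) ->
  (forall w, \sum_i sqmod (v w i 0) = 1) ->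
  holds_off P (k%:R * col_risk n delta) (fun w => exists U : 'M[C]_n,
    [/\ unitary U, U *m v w = ec (Ordinal n0) &
        near_shift delta 0 k (U *m M w *m adjmx U)]).
Proof.
move=> dl kn gM mv v1.
have [V [uV fV mV gV] HV] := admissible_reduction P (sg_neq0 R n0) n0 mv.
have := hessenberg (c := 0) dl kn (gV _ gM); apply: holds_offW => // w [U [uU fU nU]].
exists (U *m V w); split.
- exact: unitaryM.
- have [y0 y1] := HV w; set y := V w *m v w in y0 y1 *.
  have ys : \sum_l sqmod (y l 0) = 1 by rewrite unitary_sum_sqmod.
  have [yp yI] := y1 (Ordinal n0) erefl.
  have yE : y = ec (Ordinal n0).
    apply/matrixP => l m; rewrite (ord1 m) [RHS]mxE eqxx andbT.
    have [->|l0] := eqVneq l (Ordinal n0); last first.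
      by apply: y0; rewrite lt0n; move: l0; rewrite -val_eqE.
    have /eqP : sqmod (y (Ordinal n0) 0) = 1.
      rewrite -ys (bigD1 (Ordinal n0))//= big1 ?addr0// => m'.
      by rewrite -val_eqE /= -lt0n => /y0 ->; apply/eqP; rewrite sqmod_eq0.
    rewrite /sqmod yI expr0n addr0 sqrp_eq1// => /eqP r1.
    by apply: complex_eq; rewrite ?r1 ?yI.
  by rewrite -mulmxA -/y yE fU.
- by move: nU; rewrite adjmxM !mulmxA.
Qed.

End Hessenberg.

(** * Krylov vectors and resolvent of a matrix close to a shift *)

Section Modulus.
Context {R : realType}.
Local Notation C := (R[i]).
Implicit Types (x y z : C).

(** The modulus as a real number: the norm on complex numbers is complex
    valued. *)
Definition cmod z : R := Num.sqrt (sqmod z).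

Lemma norm_cmod z : `|z| = (cmod z)%:C%C.
Proof. by case: z. Qed.

Lemma cmod_ge0 z : 0 <= cmod z. Proof. exact: sqrtr_ge0. Qed.

Lemma cmod_sqr z : cmod z ^+ 2 = sqmod z.
Proof. by rewrite sqr_sqrtr// sqmod_ge0. Qed.

Lemma cmodM x y : cmod (x * y) = cmod x * cmod y.
Proof. by rewrite /cmod sqmodM sqrtrM// sqmod_ge0. Qed.

Lemma cmodD x y : cmod (x + y) <= cmod x + cmod y.
Proof. by rewrite -lecR rmorphD /= -!norm_cmod ler_normD. Qed.

Lemma cmodN x : cmod (- x) = cmod x.
Proof. by apply: complexI; rewrite -!norm_cmod normrN. Qed.

Lemma cmodB x y : cmod (x - y) <= cmod x + cmod y.
Proof. by rewrite -(cmodN y) cmodD. Qed.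

Lemma cmod_distC x y : cmod (x - y) = cmod (y - x).
Proof. by rewrite -cmodN opprB. Qed.

Lemma cmodJ x : cmod (Num.conj x) = cmod x.
Proof. by rewrite /cmod sqmodJ. Qed.

Lemma cmod0 : cmod 0 = 0.
Proof. by apply: complexI; rewrite -!norm_cmod normr0. Qed.

Lemma cmod1 : cmod 1 = 1.
Proof. by apply: complexI; rewrite -!norm_cmod normr1. Qed.

Lemma cmod_real (a : R) : cmod ((a%:C)%C) = `|a|.
Proof. by rewrite /cmod sqmod_real sqrtr_sqr. Qed.

Lemma cmodX x k : cmod (x ^+ k) = cmod x ^+ k.
Proof. by elim: k => [|k IH]; rewrite ?expr0 ?cmod1// !exprS cmodM IH. Qed.

Lemma cmodV x : cmod x^-1 = (cmod x)^-1.
Proof. by apply: complexI; rewrite -norm_cmod normfV norm_cmod fmorphV. Qed.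

Lemma cmod_eq0 x : (cmod x == 0) = (x == 0).
Proof. by rewrite sqrtr_eq0 le_eqVlt ltNge sqmod_ge0 orbF sqmod_eq0. Qed.

Lemma cmod_sum (I : Type) (s : seq I) (p : pred I) (F : I -> C) :
  cmod (\sum_(i <- s | p i) F i) <= \sum_(i <- s | p i) cmod (F i).
Proof.
elim/big_rec2: _ => [|i a b _ ab]; first by rewrite cmod0.
by apply: le_trans (cmodD _ _) _; rewrite lerD2l.
Qed.

Lemma ler_cmodB x y : `|cmod x - cmod y| <= cmod (x - y).
Proof.
rewrite ler_norml; apply/andP; split.
  rewrite lerNl opprB lerBlDr -{1}[y](subrK x) cmod_distC.
  by apply: le_trans (cmodD _ _) _; rewrite cmod_distC.
by rewrite lerBlDr -{1}[x](subrK y) cmodD.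
Qed.

Section L1.
Variable n : nat.
Implicit Types (u v : 'cV[C]_n).

(** Errors are measured in the l1 norm, for which a bound on the columns of a
    matrix bounds its action on every vector. *)
Definition nrm1 u : R := \sum_i cmod (u i 0).

Lemma nrm1_ge0 u : 0 <= nrm1 u.
Proof. by apply: sumr_ge0 => i _; exact: cmod_ge0. Qed.

Lemma nrm1D u v : nrm1 (u + v) <= nrm1 u + nrm1 v.
Proof. by rewrite -big_split /=; apply: ler_sum => i _; rewrite mxE cmodD. Qed.

Lemma nrm1Z a u : nrm1 (a *: u) = cmod a * nrm1 u.
Proof. by rewrite mulr_sumr; apply: eq_bigr => i _; rewrite mxE cmodM. Qed.

Lemma nrm10 : nrm1 0 = 0.
Proof. by rewrite /nrm1 big1// => i _; rewrite mxE cmod0. Qed.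

Lemma nrm1_sum (I : Type) (s : seq I) (p : pred I) (F : I -> 'cV[C]_n) :
  nrm1 (\sum_(i <- s | p i) F i) <= \sum_(i <- s | p i) nrm1 (F i).
Proof.
elim/big_rec2: _ => [|i a b _ ab]; first by rewrite nrm10.
by apply: le_trans (nrm1D _ _) _; rewrite lerD2l.
Qed.

Lemma cmod_le_nrm1 u i : cmod (u i 0) <= nrm1 u.
Proof. by rewrite /nrm1 (bigD1 i)//= lerDl sumr_ge0// => l _; exact: cmod_ge0. Qed.

Lemma nrm1_ec (i : 'I_n) : nrm1 (ec i) = 1.
Proof.
rewrite /nrm1 (bigD1 i)//= mxE !eqxx cmod1 big1 ?addr0// => l /negbTE li.
by rewrite mxE li cmod0.
Qed.

Lemma nrm1_eq0 u : nrm1 u <= 0 -> u = 0.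
Proof.
move=> u0; apply/matrixP => i j; rewrite (ord1 j) [RHS]mxE.
apply/eqP; rewrite -cmod_eq0 eq_le cmod_ge0 andbT.
exact: le_trans (cmod_le_nrm1 _ _) u0.
Qed.

Lemma sum_sqmod_le u : \sum_i sqmod (u i 0) <= nrm1 u ^+ 2.
Proof.
rewrite expr2 mulr_suml; apply: ler_sum => i _; rewrite -cmod_sqr expr2.
by rewrite ler_wpM2l ?cmod_ge0// cmod_le_nrm1.
Qed.

Lemma sum_sqmod_dist u v :
  `|\sum_i sqmod (u i 0) - \sum_i sqmod (v i 0)| <=
  nrm1 (u - v) * (nrm1 (u - v) + 2 * nrm1 v).
Proof.
rewrite -sumrB; apply: le_trans (ler_norm_sum _ _ _) _.
rewrite mulr_suml; apply: ler_sum => i _.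
rewrite -!cmod_sqr subr_sqr normrM.
have h : cmod (u i 0 - v i 0) = cmod ((u - v) i 0) by rewrite !mxE.
apply: ler_pM => //; first by rewrite -h ler_cmodB.
rewrite ger0_norm ?addr_ge0 ?cmod_ge0// mulr2n mulrDl mul1r addrA lerD ?cmod_le_nrm1//.
rewrite -{1}[u i 0](subrK (v i 0)); apply: le_trans (cmodD _ _) _.
by rewrite h lerD ?cmod_le_nrm1.
Qed.

End L1.
End Modulus.

Section Krylov.
Context {R : realType}.
Local Notation C := (R[i]).
Variables (N : nat).
Local Notation n := N.+1.
Implicit Types (H : 'M[C]_n).

(** Basis vectors indexed by natural numbers, meaningful for k < n only. *)
Definition ek (k : nat) : 'cV[C]_n := ec (inord k).

Lemma mulmx_sum_ec m (A : 'M[C]_(m, n)) (u : 'cV[C]_n) :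
  A *m u = \sum_j u j 0 *: (A *m ec j).
Proof.
apply/matrixP => i l; rewrite (ord1 l) mxE summxE.
by apply: eq_bigr => j _; rewrite mxE mulmx_ec mulrC.
Qed.

(** The entries on and above the diagonal contribute k delta, the subdiagonal
    one at most delta + k delta^2. *)
Lemma near_shift_column (delta : R) k H (j : 'I_n) : 0 < delta <= 1 ->
  near_shift delta 0 k H -> (j < k)%N -> (k < n)%N ->
  nrm1 (H *m ec j - ek j.+1) <= (2 * k%:R + 1) * delta.
Proof.
move=> /andP[d0 d1] nH jk kn; have [h1 h2 h3] := nH j jk.
have jn : (j.+1 < n)%N by exact: leq_ltn_trans jk kn.
rewrite /nrm1 (bigD1 (inord j.+1))//=.
have d2 : delta ^+ 2 <= delta by rewrite expr2 ler_piMl// ltW.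
have kj : j.+1%:R <= k%:R :> R by rewrite ler_nat.
apply: (@le_trans _ _ ((delta + j.+1%:R * delta ^+ 2) + k%:R * delta)).
  apply: lerD.
    rewrite mxE [X in _ + X]mxE mulmx_ec [X in - X]mxE !eqxx.
    have [[r0 r1] r2] := h3 (inord j.+1) (inordK jn).
    apply: le_trans r2.
    move: (H (inord j.+1) j) r0 r1 => z r0 r1.
    have zE : z - 1 = (complex.Re z - 1)%:C%C.
      by rewrite rmorphB rmorph1 /=; congr (_ - _); apply: complex_eq.
    rewrite zE /sqmod r1 expr0n addr0.
    rewrite cmod_real (_ : _ ^+ 2 - 1 = (complex.Re z - 1) * (complex.Re z + 1)).
      rewrite normrM ler_peMr//.
      by rewrite ger0_norm; lra.
    by ring.
  apply: (@le_trans _ _ (\sum_(i : 'I_n | (i <= j)%N) delta)).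
    rewrite big_mkcond [leRHS]big_mkcond /=; apply: ler_sum => i _.
    case: ifPn => ij; last by case: ifP => // _; exact: ltW.
    rewrite mxE [X in _ + X]mxE mulmx_ec [X in - X]mxE (negbTE ij) subr0.
    case: leqP => ji.
      by rewrite -[leRHS]ger0_norm ?(ltW d0)// -sqrtr_sqr ler_sqrt ?sqr_ge0// h1.
    rewrite h2 ?cmod0// ltn_neqAle ji andbT eq_sym.
    by rewrite -val_eqE /= inordK in ij.
  rewrite sumr_const -[leLHS]mulr_natl ler_wpM2r ?(ltW d0)//.
  apply: le_trans kj; rewrite ler_nat -sum1_card.
  rewrite (eq_bigl (fun l : 'I_n => (l < j.+1)%N))//.
  by rewrite (big_ord_narrow (F := fun=> 1%N) (ltnW jn)) sum1_card card_ord.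
have : j.+1%:R * delta ^+ 2 <= k%:R * delta.
  by apply: ler_pM => //; exact: sqr_ge0.
lra.
Qed.

Lemma ekE k (j : 'I_n) : (k < n)%N -> ek k j 0 = (j == k :> nat)%:R.
Proof. by move=> kn; rewrite mxE eqxx andbT -val_eqE /= inordK. Qed.

(** H^k e_0 is supported on e_0, ..., e_k, so that a further application of H
    meets only columns close to those of the shift, and adds an error of at
    most (2 K + 1) delta times its length. *)
Lemma krylov_shift (delta : R) K H k : 0 < delta <= 1 ->
  near_shift delta 0 K H -> (K < n)%N -> (k <= K)%N ->
  (forall i : 'I_n, (k < i)%N -> (H ^+ k *m ek 0) i 0 = 0) /\
  nrm1 (H ^+ k *m ek 0 - ek k) <= (1 + (2 * K%:R + 1) * delta) ^+ k - 1.
Proof.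
move=> dl nH Kn; elim: k => [_|k IH kK].
  rewrite !expr0 mul1mx !subrr nrm10; split => // i i0.
  by rewrite ekE// gtn_eqF.
have [IH1 IH2] := IH (ltnW kK).
have kn : (k < n)%N by exact: ltn_trans kK Kn.
rewrite exprS -mulmxA; set u := H ^+ k *m ek 0 in IH1 IH2 *.
set eta := (2 * K%:R + 1) * delta in IH2 *.
have eta0 : 0 <= eta.
  by rewrite mulr_ge0 ?addr_ge0 ?mulr_ge0//; case/andP: dl => /ltW.
split.
  move=> i ki; rewrite mxE big1// => j _; case: (ltnP k j) => kj.
    by rewrite IH1// mulr0.
  have jK : (j < K)%N by exact: leq_ltn_trans kj kK.
  have [_ h2 _] := nH j jK.
  by rewrite h2 ?mul0r//; apply: leq_ltn_trans ki; rewrite ltnS.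
have -> : H *m u - ek k.+1 = \sum_j u j 0 *: (H *m ec j - ek j.+1) +
    \sum_j (u j 0 - ek k j 0) *: ek j.+1.
  rewrite -big_split /= (eq_bigr (fun j => u j 0 *: (H *m ec j) - ek k j 0 *: ek j.+1)).
    rewrite sumrB -mulmx_sum_ec; congr (_ - _).
    rewrite (bigD1 (inord k))//= ekE// inordK// eqxx scale1r big1 ?addr0// => j jk.
    rewrite ekE// (_ : (j == k :> nat) = false) ?scale0r//.
    by apply: contraNF jk => /eqP jk; apply/eqP/val_inj; rewrite /= inordK.
  by move=> j _; rewrite scalerBr scalerBl addrA subrK.
apply: le_trans (nrm1D _ _) _.
apply: (@le_trans _ _ (eta * nrm1 u + nrm1 (u - ek k))).
  apply: lerD; apply: le_trans (nrm1_sum _ _ _) _.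
    rewrite mulr_sumr; apply: ler_sum => j _; rewrite nrm1Z mulrC.
    case: (ltnP k j) => kj; first by rewrite IH1// cmod0 !mulr0.
    by rewrite ler_wpM2r ?cmod_ge0//; apply: near_shift_column => //; exact: leq_ltn_trans kj kK.
  by apply: ler_sum => j _; rewrite nrm1Z nrm1_ec mulr1 !mxE.
have uE : nrm1 u <= nrm1 (u - ek k) + 1.
  by have := nrm1D (u - ek k) (ek k); rewrite subrK nrm1_ec.
apply: (@le_trans _ _ (eta * ((1 + eta) ^+ k - 1 + 1) + ((1 + eta) ^+ k - 1))).
  apply: lerD => //; rewrite ler_wpM2l//; apply: le_trans uE _; exact: lerD.
by rewrite exprS; lra.
Qed.

End Krylov.

Lemma sum_ord_head (V : nmodType) (m : nat) (a : nat -> V) : (0 < m)%N ->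
  (forall j, (0 < j)%N -> a j = 0) -> \sum_(j < m) a j = a 0.
Proof.
case: m => [//|m] _ a0; rewrite big_ord_recl big1 ?addr0// => j _.
exact: a0.
Qed.

Section Resolvent.
Context {R : realType}.
Local Notation C := (R[i]).
Variables (N : nat).
Local Notation n := N.+1.
Implicit Types (x y : 'cV[C]_n) (z : C).

Lemma geom_sum (q : R) m : 1 < q ->
  \sum_(k < m) (q^-1) ^+ k.+1 = (1 - (q^-1) ^+ m) / (q - 1).
Proof.
move=> q1; have q10 : q - 1 != 0 by rewrite subr_eq0 gt_eqF.
have q0 : q != 0 by rewrite gt_eqF// (lt_trans _ q1).
elim: m => [|m IH]; first by rewrite big_ord0 expr0 subrr mul0r.
apply: (mulIf q10); rewrite big_ord_recr /= mulrDl IH !divfK//.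
by rewrite mulrBr mulr1 !exprS mulrAC mulVf// mul1r; lra.
Qed.

Variables (H : 'M[C]_n) (m : nat) (eps B r : R).
Hypotheses (m0 : (0 < m)%N) (mn : (m.*2 < n)%N) (r1 : 1 < r).
Hypotheses (eps0 : 0 <= eps) (eps1 : eps <= 1) (B0 : 0 <= B).
Hypothesis krylovH : forall k, (k <= m.*2)%N -> nrm1 (H ^+ k *m ek _ 0 - ek _ k) <= eps.
Hypothesis boundH : forall k x, (k <= m)%N -> nrm1 (H ^+ k *m x) <= B * nrm1 x.
Hypothesis smallB : B * (r^-1) ^+ m <= 2^-1.

Let r0 : 0 < r. Proof. exact: lt_trans ltr01 r1. Qed.
Let r10 : 0 < r - 1. Proof. by rewrite subr_gt0. Qed.

Let zr z : r <= cmod z -> z != 0.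
Proof. by move=> rz; rewrite -cmod_eq0 gt_eqF// (lt_le_trans r0 rz). Qed.

Let zV z : r <= cmod z -> 0 <= (cmod z)^-1 <= r^-1.
Proof.
move=> rz; have z0 := lt_le_trans r0 rz.
by rewrite invr_ge0 (ltW z0)/= lef_pV2// posrE.
Qed.

Let geom z M : r <= cmod z -> \sum_(k < M) (cmod z)^-1 ^+ k.+1 <= (r - 1)^-1.
Proof.
move=> rz; rewrite geom_sum; last exact: lt_le_trans r1 rz.
have z1 : 0 < cmod z - 1 by rewrite subr_gt0 (lt_le_trans r1).
apply: (@le_trans _ _ (cmod z - 1)^-1).
  rewrite ler_piMl ?invr_ge0 ?(ltW z1)// lerBlDl lerDr exprn_ge0//.
  by rewrite invr_ge0 cmod_ge0.
by rewrite lef_pV2 ?posrE// lerD2r.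
Qed.

Let zm z : r <= cmod z -> (cmod z)^-1 ^+ m <= r^-1 ^+ m.
Proof.
move=> /zV /andP[z1 z2]; rewrite lerXn2r// nnegrE// invr_ge0 ltW//.
Qed.

(** The Neumann series of (z - H)^-1 truncated at degree m. *)
Definition neumann z := \sum_(k < m) (z^-1) ^+ k.+1 *: H ^+ k.

Lemma neumann_mul z : z != 0 -> neumann z *m (z%:M - H) = 1%:M - (z^-1) ^+ m *: H ^+ m.
Proof.
move=> z0; rewrite /neumann; elim: (m) => [|k IH].
  by rewrite big_ord0 mul0mx !expr0 scale1r subrr.
rewrite big_ord_recr /= mulmxDl IH -scalemxAl mulmxBr mul_mx_scalar scalerBr.
by rewrite scalerA {1}exprSr -mulrA mulVf// mulr1 mulmxE -exprSr addrA subrK.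
Qed.

Lemma mul_neumann z : z != 0 -> (z%:M - H) *m neumann z = 1%:M - (z^-1) ^+ m *: H ^+ m.
Proof.
move=> z0; rewrite /neumann; elim: (m) => [|k IH].
  by rewrite big_ord0 mulmx0 !expr0 scale1r subrr.
rewrite big_ord_recr /= mulmxDr IH -scalemxAr mulmxBl mul_scalar_mx scalerBr.
by rewrite scalerA {1}exprSr -mulrA mulVf// mulr1 mulmxE -exprS addrA subrK.
Qed.

(** In x = z^-m H^m x + neumann z (z - H) x the first term is at most half of
    x by [smallB], and is absorbed in the left-hand side. *)
Lemma resolvent_bound z x : r <= cmod z ->
  nrm1 x <= 2 * B / (r - 1) * nrm1 ((z%:M - H) *m x).
Proof.
move=> rz; set y := _ *m x.
have e : x = (z^-1) ^+ m *: (H ^+ m *m x) + neumann z *m y.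
  rewrite /y mulmxA neumann_mul ?zr// mulmxBl mul1mx -scalemxAl.
  by rewrite addrC subrK.
have nb : nrm1 (neumann z *m y) <= B / (r - 1) * nrm1 y.
  rewrite /neumann mulmx_suml; apply: le_trans (nrm1_sum _ _ _) _.
  apply: (@le_trans _ _ (\sum_(k < m) (cmod z)^-1 ^+ k.+1 * (B * nrm1 y))).
    apply: ler_sum => k _; rewrite -scalemxAl nrm1Z cmodX cmodV ler_wpM2l//.
      by rewrite exprn_ge0// invr_ge0 cmod_ge0.
    exact/boundH/ltnW.
  rewrite -mulr_suml (mulrAC B) mulrC ler_wpM2l ?mulr_ge0 ?nrm1_ge0//.
  exact: geom.
have na : nrm1 (z^-1 ^+ m *: (H ^+ m *m x)) <= 2^-1 * nrm1 x.
  rewrite nrm1Z cmodX cmodV; apply: (@le_trans _ _ (r^-1 ^+ m * (B * nrm1 x))).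
    apply: ler_pM; rewrite ?nrm1_ge0 ?exprn_ge0 ?invr_ge0 ?cmod_ge0//.
      exact: zm.
    exact: boundH.
  by rewrite mulrA [_ * B]mulrC ler_wpM2r ?nrm1_ge0.
have := nrm1D (z^-1 ^+ m *: (H ^+ m *m x)) (neumann z *m y); rewrite -e => t.
have -> : 2 * B / (r - 1) * nrm1 y = 2 * (B / (r - 1) * nrm1 y) by ring.
lra.
Qed.

Lemma resolvent_unit z : r <= cmod z -> z%:M - H \in unitmx.
Proof.
move=> rz; rewrite unitmxE unitfE -det_tr; apply/negP => /det0P[v v0 vH].
have vH' : (z%:M - H) *m v^T = 0 by rewrite -[LHS]trmxK trmx_mul trmxK vH trmx0.
have := resolvent_bound v^T rz; rewrite vH' nrm10 mulr0 => /nrm1_eq0 vT0.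
by move: v0; rewrite -[v]trmxK vT0 trmx0 eqxx.
Qed.

Definition res z := invmx (z%:M - H).
Let beta := 2 * B / (r - 1).
Let tail := 2 * beta * r^-1 ^+ m.
Let kappa := eps / (r - 1) + tail.

Let beta0 : 0 <= beta.
Proof. by rewrite divr_ge0 ?mulr_ge0 ?(ltW r10). Qed.

Lemma res_bound z x : r <= cmod z -> nrm1 (res z *m x) <= beta * nrm1 x.
Proof.
move=> rz; apply: le_trans (resolvent_bound _ rz) _.
by rewrite mulmxA mulmxV ?mul1mx// resolvent_unit.
Qed.

Lemma res_neumann z x : r <= cmod z ->
  res z *m x = neumann z *m x + (z^-1) ^+ m *: (res z *m (H ^+ m *m x)).
Proof.
move=> rz; have /(congr1 (fun A => res z *m (A *m x))) := mul_neumann (zr rz).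
rewrite !mulmxA mulVmx ?resolvent_unit// mul1mx => ->.
by rewrite mulmxBr mulmx1 mulmxBl -scalemxAr -scalemxAl subrK.
Qed.

Lemma krylov_norm k : (k <= m.*2)%N -> nrm1 (H ^+ k *m ek N 0) <= 2.
Proof.
move=> km; rewrite -[_ *m _](subrK (ek N k)); apply: le_trans (nrm1D _ _) _.
by rewrite nrm1_ec; exact: lerD (le_trans (krylovH km) eps1) (lexx 1).
Qed.

Lemma res_tail z k : r <= cmod z -> (k <= m)%N ->
  nrm1 ((z^-1) ^+ m *: (res z *m (H ^+ m *m (H ^+ k *m ek N 0)))) <= tail.
Proof.
move=> rz km; rewrite nrm1Z cmodX cmodV /tail (mulrC 2) [leRHS]mulrC.
apply: ler_pM; rewrite ?nrm1_ge0 ?exprn_ge0 ?invr_ge0 ?cmod_ge0//; first exact: zm.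
apply: le_trans (res_bound _ rz) _; rewrite ler_wpM2l//.
rewrite mulmxA mulmxE -exprD; apply: krylov_norm.
by rewrite -addnn leq_add2l.
Qed.

(** Replacing the Krylov vectors by basis vectors in the truncated series
    costs eps / (r - 1), and the remainder costs [tail]. *)
Lemma res_krylov z k : r <= cmod z -> (k <= m)%N ->
  nrm1 (res z *m (H ^+ k *m ek N 0) -
    \sum_(j < m) (z^-1) ^+ j.+1 *: ek N (j + k)) <= kappa.
Proof.
move=> rz km; rewrite res_neumann// addrAC.
apply: le_trans (nrm1D _ _) _; apply: lerD; last exact: res_tail.
rewrite /neumann mulmx_suml -sumrB; apply: le_trans (nrm1_sum _ _ _) _.
rewrite mulrC; apply: (@le_trans _ _ (\sum_(j < m) (cmod z)^-1 ^+ j.+1 * eps)).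
  apply: ler_sum => j _; rewrite -scalemxAl -scalerBr nrm1Z cmodX cmodV.
  rewrite ler_wpM2l ?exprn_ge0 ?invr_ge0 ?cmod_ge0// mulmxA mulmxE -exprD.
  by apply: krylovH; rewrite -addnn leq_add// ltnW.
by rewrite -mulr_suml ler_wpM2r// geom.
Qed.

Lemma subr_mxE p q (u v : 'M[C]_(p, q)) i j : (u - v) i j = u i j - v i j.
Proof. by rewrite mxE [X in _ + X]mxE. Qed.

(** Among the basis vectors only e_0 has a nonzero coordinate of index 0. *)
Lemma res_krylov00 z k : r <= cmod z -> (k <= m)%N ->
  cmod ((res z *m (H ^+ k *m ek N 0)) 0 0 - (k == 0)%:R * z^-1) <= kappa.
Proof.
move=> rz km; apply: le_trans (res_krylov rz km).
apply: le_trans (cmod_le_nrm1 _ 0); rewrite subr_mxE [X in _ <= cmod (_ - X)]summxE.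
rewrite (_ : \sum_(j < m) _ = (k == 0)%:R * z^-1)//.
rewrite (eq_bigr (fun j : 'I_m => z^-1 ^+ j.+1 * ((j + k)%N == 0)%:R)); last first.
  move=> j _; rewrite mxE ekE /= 1?eq_sym//.
  by apply: leq_ltn_trans mn; rewrite -addnn leq_add// ltnW.
rewrite (@sum_ord_head _ m (fun j => z^-1 ^+ j.+1 * ((j + k)%N == 0)%:R))//.
  by rewrite add0n expr1 mulrC.
by move=> [//|j] _; rewrite mulr0.
Qed.

Lemma res_entry z : r <= cmod z -> cmod ((res z *m ek N 0) 0 0 - z^-1) <= kappa.
Proof.
by move=> rz; have := res_krylov00 rz (leq0n m); rewrite expr0 mul1mx mul1r.
Qed.

Lemma res_entry2 z w : r <= cmod z -> r <= cmod w ->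
  cmod ((res z *m (res w *m ek N 0)) 0 0 - (z * w)^-1) <=
  kappa / (r - 1) + beta * tail.
Proof.
move=> rz rw; have := res_neumann (ek N 0) rw.
set tl := _ ^+ m *: _ => e.
have tlE : nrm1 tl <= tail.
  by have := res_tail rw (leq0n m); rewrite expr0 mul1mx.
rewrite e mulmxDr mxE addrAC; apply: le_trans (cmodD _ _) _; apply: lerD; last first.
  apply: le_trans (cmod_le_nrm1 _ _) _; apply: le_trans (res_bound _ rz) _.
  by rewrite ler_wpM2l.
rewrite /neumann mulmx_suml mulmx_sumr summxE.
have -> : (z * w)^-1 = \sum_(k < m) w^-1 ^+ k.+1 * (((k : nat) == 0)%:R * z^-1).
  rewrite (@sum_ord_head _ m (fun k => w^-1 ^+ k.+1 * ((k == 0)%:R * z^-1)))//.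
    by rewrite expr1 mul1r invfM mulrC.
  by move=> [//|j] _; rewrite mul0r mulr0.
rewrite -sumrB; apply: le_trans (cmod_sum _ _ _) _.
rewrite mulrC; apply: (@le_trans _ _ (\sum_(k < m) (cmod w)^-1 ^+ k.+1 * kappa)).
  apply: ler_sum => k _; rewrite -scalemxAl -scalemxAr mxE -mulrBr cmodM cmodX cmodV.
  rewrite ler_wpM2l ?exprn_ge0 ?invr_ge0 ?cmod_ge0//; apply: res_krylov00 => //.
  exact: ltnW.
rewrite -mulr_suml ler_wpM2r ?geom//.
by rewrite addr_ge0 ?mulr_ge0 ?exprn_ge0 ?invr_ge0 ?(ltW r10) ?(ltW r0).
Qed.

(** The vector is close to the sum of the z^-(j+1) e_j, whose squared length
    is a geometric sum. *)
Lemma res_norm z : r <= cmod z ->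
  `|\sum_i sqmod ((res z *m ek N 0) i 0) - (cmod z ^+ 2 - 1)^-1| <=
  kappa * (kappa + 2 / (r - 1)) + r^-1 ^+ m / (r - 1).
Proof.
move=> rz; pose u := \sum_(j < m) (z^-1) ^+ j.+1 *: ek N j.
have uk : nrm1 (res z *m ek N 0 - u) <= kappa.
  have := res_krylov rz (leq0n m); rewrite expr0 mul1mx /u.
  by under eq_bigr do rewrite addn0.
have un : nrm1 u <= (r - 1)^-1.
  apply: le_trans (geom m rz); apply: le_trans (nrm1_sum _ _ _) _.
  by apply: ler_sum => j _; rewrite nrm1Z nrm1_ec mulr1 cmodX cmodV.
have us : \sum_i sqmod (u i 0) = \sum_(j < m) ((cmod z ^+ 2)^-1) ^+ j.+1.
  have mn' : (m <= n)%N by rewrite (leq_trans _ (ltnW mn))// -addnn leq_addr.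
  rewrite (big_ord_widen n (fun j => ((cmod z ^+ 2)^-1) ^+ j.+1) mn') [RHS]big_mkcond /=.
  apply: eq_bigr => i _; rewrite /u summxE.
  rewrite (eq_bigr (fun j : 'I_m => z^-1 ^+ j.+1 * (i == j :> nat)%:R)); last first.
    by move=> j _; rewrite mxE ekE// (leq_trans (ltn_ord j)).
  case: ifPn => im.
    rewrite (bigD1 (Ordinal im))//= eqxx mulr1 big1 ?addr0.
      by rewrite -cmod_sqr cmodX cmodV -!exprVn -!exprM mulnC.
    by move=> j; rewrite -val_eqE /= eq_sym => /negbTE ->; rewrite mulr0.
  rewrite big1; first by apply/eqP; rewrite sqmod_eq0.
  move=> j _; case: eqP => [ij|]; last by rewrite mulr0.
  by move: im; rewrite ij ltn_ord.
rewrite -[X in `|X|](subrKA (\sum_i sqmod (u i 0))).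
apply: le_trans (ler_normD _ _) _; apply: lerD.
  apply: le_trans (sum_sqmod_dist _ _) _.
  by apply: ler_pM; rewrite ?nrm1_ge0 ?addr_ge0 ?mulr_ge0 ?nrm1_ge0 ?lerD// ler_wpM2l.
have z1 : r <= cmod z ^+ 2.
  by rewrite expr2 -[r]mulr1 ler_pM// ?(ltW r0)// (le_trans (ltW r1)).
have q1 : 1 < cmod z ^+ 2 by exact: lt_le_trans r1 z1.
rewrite us geom_sum// mulrBl mul1r addrAC subrr add0r normrN ger0_norm; last first.
  by rewrite mulr_ge0 ?exprn_ge0 ?invr_ge0 ?sqr_ge0// subr_ge0 ltW.
apply: ler_pM; rewrite ?exprn_ge0 ?invr_ge0 ?sqr_ge0 ?subr_ge0 ?(ltW q1)//.
  rewrite lerXn2r ?nnegrE ?invr_ge0 ?sqr_ge0 ?(ltW r0)//.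
  by rewrite lef_pV2 ?posrE// (lt_le_trans r0).
by rewrite lef_pV2 ?posrE ?subr_gt0// lerD2r.
Qed.

End Resolvent.

(** * Unitary changes of basis *)

Section Transport.
Context {R : realType}.
Local Notation C := (R[i]).
Variables (N : nat).
Local Notation n := N.+1.
Implicit Types (G U : 'M[C]_n) (v : 'cV[C]_n).

(** In some orthonormal basis that starts with v, the first K columns of G are
    close to those of the shift. *)
Definition hess (delta : R) K G v : Prop := exists U : 'M[C]_n,
  [/\ unitary U, U *m v = ek N 0 & near_shift delta 0 K (U *m G *m adjmx U)].

Lemma unitary_conj_pow U G k : unitary U ->
  (U *m G *m adjmx U) ^+ k = U *m G ^+ k *m adjmx U.
Proof.
move=> uU; elim: k => [|k IH]; first by rewrite !expr0 mulmx1 unitaryC.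
by rewrite !exprS IH -!mulmxE !mulmxA -(mulmxA (U *m G)) uU mulmx1.
Qed.

Lemma unitary_entry U i j : unitary U -> cmod (U i j) <= 1.
Proof.
move=> uU; rewrite -(@expr_le1 _ 2)// ?cmod_ge0// cmod_sqr -mulmx_ec.
have : \sum_l sqmod ((U *m ec j) l 0) = 1.
  rewrite unitary_sum_sqmod// (bigD1 j)//= mxE !eqxx big1.
    by rewrite addr0 -cmod_sqr cmod1 expr1n.
  by move=> l /negbTE lj; rewrite mxE lj -cmod_sqr cmod0 expr0n.
move=> <-; rewrite (bigD1 i)//= lerDl; apply: sumr_ge0 => l _; exact: sqmod_ge0.
Qed.

Lemma hess_krylov delta K G v : 0 < delta <= 1 -> (K < n)%N -> hess delta K G v ->
  exists U, [/\ unitary U, U *m v = ek N 0 & forall k, (k <= K)%N ->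
    nrm1 ((U *m G *m adjmx U) ^+ k *m ek N 0 - ek N k) <=
    (1 + (2 * K%:R + 1) * delta) ^+ K - 1].
Proof.
move=> dl Kn [U [uU Uv nU]]; exists U; split => // k kK.
have [_ h] := krylov_shift dl nU Kn kK; apply: le_trans h _.
rewrite lerD2r; apply: ler_weXn2l => //.
by rewrite lerDl mulr_ge0 ?addr_ge0 ?mulr_ge0//; case/andP: dl => /ltW.
Qed.

(** The column j of G^k is G^k e_j, which is close to a unit vector when the
    basis of the reduction starts with e_j. *)
Lemma hess_pow_entry delta K G k (i j : 'I_n) : 0 < delta <= 1 -> (K < n)%N ->
  (1 + (2 * K%:R + 1) * delta) ^+ K - 1 <= 1 -> (k <= K)%N ->
  hess delta K G (ec j) -> cmod ((G ^+ k) i j) <= 2.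
Proof.
move=> dl Kn e1 kK /(hess_krylov dl Kn)[U [uU Uv hU]].
rewrite -(@ler_pXn2r _ 2)// ?nnegrE ?cmod_ge0// cmod_sqr -mulmx_ec.
have e : U *m (G ^+ k *m ec j) = (U *m G *m adjmx U) ^+ k *m ek N 0.
  by rewrite unitary_conj_pow// -Uv !mulmxA -(mulmxA (U *m _)) uU mulmx1.
apply: (@le_trans _ _ (\sum_l sqmod ((G ^+ k *m ec j) l 0))).
  by rewrite (bigD1 i)//= lerDl; apply: sumr_ge0 => l _; exact: sqmod_ge0.
rewrite -(unitary_sum_sqmod _ uU) e; apply: le_trans (sum_sqmod_le _) _.
rewrite ler_pXn2r// ?nnegrE ?nrm1_ge0//.
rewrite -[_ *m _](subrK (ek N k)); apply: le_trans (nrm1D _ _) _.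
by rewrite nrm1_ec; exact: lerD (le_trans (hU _ kK) e1) (lexx 1).
Qed.

Lemma mx_nrm1_bound (A : 'M[C]_n) (b : R) (x : 'cV[C]_n) :
  (forall i j, cmod (A i j) <= b) -> nrm1 (A *m x) <= n%:R * b * nrm1 x.
Proof.
move=> Ab; apply: (@le_trans _ _ (\sum_(i < n) b * nrm1 x)).
  apply: ler_sum => i _; rewrite mxE; apply: le_trans (cmod_sum _ _ _) _.
  rewrite mulr_sumr; apply: ler_sum => j _; rewrite cmodM.
  by rewrite ler_wpM2r ?cmod_ge0.
by rewrite sumr_const card_ord -[leLHS]mulr_natl mulrA.
Qed.

Lemma conj_entry (A U : 'M[C]_n) (b : R) i j : unitary U ->
  (forall i j, cmod (A i j) <= b) ->
  cmod ((U *m A *m adjmx U) i j) <= n%:R * (n%:R * b).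
Proof.
move=> uU Ab; have b0 : 0 <= b by apply: le_trans (Ab 0 0); exact: cmod_ge0.
have sumb (f : 'I_n -> C) (c : R) : (forall l, cmod (f l) <= c) ->
    cmod (\sum_l f l) <= n%:R * c.
  move=> fc; apply: le_trans (cmod_sum _ _ _) _.
  apply: (@le_trans _ _ (\sum_(l < n) c)); first by apply: ler_sum.
  by rewrite sumr_const card_ord -[leLHS]mulr_natl.
rewrite mxE; apply: (sumb) => l; rewrite cmodM adjmxE cmodJ -[leRHS]mulr1.
apply: ler_pM; rewrite ?cmod_ge0 ?unitary_entry//.
rewrite mxE; apply: sumb => l'; rewrite cmodM -[leRHS]mul1r.
by apply: ler_pM; rewrite ?cmod_ge0 ?unitary_entry.
Qed.

Lemma res_conj U G z : unitary U -> z%:M - U *m G *m adjmx U \in unitmx ->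
  z%:M - G \in unitmx /\ res G z = adjmx U *m res (U *m G *m adjmx U) z *m U.
Proof.
move=> uU hu; set H := U *m G *m adjmx U in hu *.
have e : (z%:M - G) *m (adjmx U *m res H z *m U) = 1%:M.
  have -> : z%:M - G = adjmx U *m (z%:M - H) *m U.
    rewrite mulmxBr mulmxBl /H !mulmxA uU mul1mx -[G *m _ *m _]mulmxA uU mulmx1.
    by rewrite mul_mx_scalar -scalemxAl uU scalemx1.
  rewrite !mulmxA -(mulmxA _ U) (unitaryC uU) mulmx1.
  by rewrite -(mulmxA (adjmx U)) mulmxV// mulmx1 uU.
have [gu _] := mulmx1_unit e; split => //.
by rewrite /res -[LHS]mulmx1 -e mulmxA mulVmx// mul1mx.
Qed.

End Transport.

(** * Fixed points in the complex plane *)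

Section FixedPoint.
Context {R : realType}.
Local Notation C := (R[i]).

Lemma cvgn_geometric_steps (x : R^nat) (rho : R) :
  (forall k, `|x k.+1 - x k| <= rho * 2^-1 ^+ k) -> cvgn x.
Proof.
move=> hx; have -> : x = (fun n => x 0 + series (telescope x) n).
  by apply/funext => n; exact: eq_sum_telescope.
apply: is_cvgD; first exact: is_cvg_cst.
apply: normed_cvg; apply: (series_le_cvg (v_ := geometric rho 2^-1)).
- by move=> k; exact: normr_ge0.
- move=> k; rewrite /geometric /= mulr_ge0 ?exprn_ge0//.
  by have := hx 0; rewrite expr0 mulr1; exact: le_trans.
- by move=> k; exact: hx.
- by apply: is_cvg_geometric_series; rewrite ger0_norm//; lra.
Qed.

Lemma cmod_le_parts (z : C) : cmod z <= `|complex.Re z| + `|complex.Im z|.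
Proof.
rewrite -(@ler_pXn2r _ 2)// ?nnegrE ?cmod_ge0 ?addr_ge0// cmod_sqr /sqmod.
by rewrite sqrrD !real_normK ?num_real// addrAC lerDl mulrn_wge0// mulr_ge0.
Qed.

Lemma parts_le_cmod (z : C) : `|complex.Re z| <= cmod z /\ `|complex.Im z| <= cmod z.
Proof.
by split; rewrite -sqrtr_sqr ler_wsqrtr// /sqmod ?lerDl ?lerDr sqr_ge0.
Qed.

(** The iterates of F form in both real coordinates a Cauchy sequence
    dominated by a geometric one. *)
Lemma complex_banach (F : C -> C) (a : C) (rho : R) :
  (forall z, cmod (z - a) <= rho -> cmod (F z - a) <= rho) ->
  (forall z w, cmod (z - a) <= rho -> cmod (w - a) <= rho ->
     cmod (F z - F w) <= 2^-1 * cmod (z - w)) ->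
  0 <= rho -> exists2 z, cmod (z - a) <= rho & F z = z.
Proof.
move=> FD FL rho0; pose z k := iter k F a.
have zD k : cmod (z k - a) <= rho.
  by elim: k => [|k /FD//]; rewrite subrr cmod0.
have zL k : cmod (z k.+1 - z k) <= rho * 2^-1 ^+ k.
  elim: k => [|k IH]; first by rewrite expr0 mulr1; exact: zD.
  apply: le_trans (FL _ _ (zD k.+1) (zD k)) _.
  by rewrite exprS mulrCA ler_wpM2l.
have /cvg_ex[x xl] : cvgn (fun k => complex.Re (z k)).
  apply: (cvgn_geometric_steps (rho := rho)) => k; apply: le_trans (zL k).
  by have [+ _] := parts_le_cmod (z k.+1 - z k); case: (z k.+1) (z k) => ? ? [].
have /cvg_ex[y yl] : cvgn (fun k => complex.Im (z k)).
  apply: (cvgn_geometric_steps (rho := rho)) => k; apply: le_trans (zL k).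
  by have [_] := parts_le_cmod (z k.+1 - z k); case: (z k.+1) (z k) => ? ? [].
pose zz : C := Complex x y.
have close e : 0 < e -> exists k, cmod (zz - z k) <= e /\ cmod (zz - z k.+1) <= e.
  move=> e0; have e20 : 0 < e / 2 by rewrite divr_gt0.
  have /cvgrPdist_le/(_ _ e20)[k1 _ h1] := xl.
  have /cvgrPdist_le/(_ _ e20)[k2 _ h2] := yl.
  have h k : (maxn k1 k2 <= k)%N -> cmod (zz - z k) <= e.
    rewrite geq_max => /andP[kk1 kk2]; apply: le_trans (cmod_le_parts _) _.
    rewrite [e]splitr; apply: lerD.
      by have := h1 k kk1; rewrite /zz; case: (z k).
    by have := h2 k kk2; rewrite /zz; case: (z k).
  by exists (maxn k1 k2); split; apply: h.
have zzD : cmod (zz - a) <= rho.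
  apply/ler_addgt0Pr => e e0; have [k [hk _]] := close e e0.
  rewrite -(subrKA (z k)) [leRHS]addrC; apply: le_trans (cmodD _ _) _.
  exact: lerD.
exists zz => //; apply/eqP; rewrite -subr_eq0 -cmod_eq0 eq_le cmod_ge0 andbT.
apply/ler_addgt0Pr => e e0; rewrite add0r; have e20 : 0 < e / 2 by rewrite divr_gt0.
have [k [hk hk1]] := close _ e20.
rewrite -(subrKA (z k.+1)) [e]splitr; apply: le_trans (cmodD _ _) _; apply: lerD.
  apply: le_trans (FL _ _ zzD (zD k)) _; apply: le_trans hk.
  by rewrite ler_piMl ?cmod_ge0//; lra.
by rewrite cmod_distC.
Qed.

End FixedPoint.

(** * Rank-one perturbations and their outlier *)

Section RankOne.
Context {R : realType}.
Local Notation C := (R[i]).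
Variables (N : nat).
Local Notation n := N.+1.
Variables (G : 'M[C]_n) (v : 'cV[C]_n) (t : R).

Let M := rank_one_perturbation G v t.

(** With the resolvent R(z): the two eigenvectors, the scalar v^* R(z) v of
    the eigenvalue equation, and v^* R(z) R(w) v, whose value at w = z
    normalizes the eigenvectors and which measures the variation of the scalar
    by [res_identity]. *)
Definition rvec z : 'cV[C]_n := res G z *m v.
Definition lvec z : 'rV[C]_n := adjmx v *m res G z.
Definition fres z : C := (adjmx v *m rvec z) 0 0.
Definition ares z w : C := (lvec z *m rvec w) 0 0.

Lemma mul_col_row (x : 'cV[C]_n) : v *m (adjmx v *m x) = (adjmx v *m x) 0 0 *: v.
Proof. by rewrite [X in v *m X]mx11_scalar mul_mx_scalar. Qed.

Lemma mul_row_col (u : 'rV[C]_n) : u *m v *m adjmx v = (u *m v) 0 0 *: adjmx v.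
Proof. by rewrite [X in X *m adjmx v]mx11_scalar mul_scalar_mx. Qed.

Section AtPoint.
Variable z : C.
Hypothesis zu : z%:M - G \in unitmx.

(** The perturbation maps x into the line of v, so that (z - G) x is a
    multiple of v. *)
Lemma right_eigenvector (x : 'cV[C]_n) : M *m x = z *: x ->
  x = (t%:C%C * (adjmx v *m x) 0 0) *: rvec z.
Proof.
move=> Mx; have e : (z%:M - G) *m x = (t%:C%C * (adjmx v *m x) 0 0) *: v.
  rewrite mulmxBl mul_scalar_mx -Mx /M /rank_one_perturbation mulmxDl.
  by rewrite [G *m x + _]addrC addrK -scalemxAl -mulmxA mul_col_row scalerA.
by rewrite /rvec scalemxAr -e mulKmx.
Qed.

Lemma left_eigenvector (u : 'rV[C]_n) : u *m M = z *: u ->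
  u = (t%:C%C * (u *m v) 0 0) *: lvec z.
Proof.
move=> uM; have e : u *m (z%:M - G) = (t%:C%C * (u *m v) 0 0) *: adjmx v.
  rewrite mulmxBr mul_mx_scalar -uM /M /rank_one_perturbation mulmxDr.
  by rewrite [u *m G + _]addrC addrK -scalemxAr mulmxA mul_row_col scalerA.
by rewrite /lvec scalemxAl -e mulmxK.
Qed.

Lemma lvec_v : (lvec z *m v) 0 0 = fres z.
Proof. by rewrite /lvec /fres /rvec mulmxA. Qed.

(** A left eigenvector is a multiple of v^* R(z) by [left_eigenvector];
    evaluating the multiple at v leaves this scalar equation. *)
Lemma rank_one_eigenvalue : eigenvalue M z = (t%:C%C * fres z == 1).
Proof.
apply/eigenvalueP/eqP => [[u uM u0]|tf].
  have e := left_eigenvector uM.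
  have uv0 : (u *m v) 0 0 != 0.
    by apply: contra_neq u0 => uv; rewrite e uv mulr0 scale0r.
  apply: (mulIf uv0); rewrite mul1r {2}e -scalemxAl [RHS]mxE lvec_v.
  by rewrite -!mulrA; congr (_ * _); rewrite mulrC.
exists (lvec z); last first.
  apply: contra_eq_neq tf => l0; rewrite -lvec_v l0 mul0mx mxE mulr0.
  by rewrite eq_sym oner_eq0.
have e : lvec z *m (z%:M - G) = adjmx v by rewrite /lvec -mulmxA mulVmx// mulmx1.
rewrite /M /rank_one_perturbation mulmxDr -scalemxAr mulmxA mul_row_col lvec_v.
by rewrite scalerA tf scale1r -e mulmxBr mul_mx_scalar addrC subrK.
Qed.

End AtPoint.

Lemma res_identity z w : z%:M - G \in unitmx -> w%:M - G \in unitmx ->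
  fres z - fres w = (w - z) * ares z w.
Proof.
move=> zu wu; have e : res G z - res G w = (w - z) *: (res G z *m res G w).
  have -> : (w - z) *: (res G z *m res G w) =
      res G z *m ((w%:M - G) - (z%:M - G)) *m res G w.
    rewrite opprB addrA subrK -raddfB /= mul_mx_scalar -scalemxAl.
    by [].
  by rewrite mulmxBr mulmxBl mulVmx// mul1mx -mulmxA mulmxV// mulmx1.
rewrite /fres /ares /rvec /lvec !mulmxA.
have -> : (w - z) * (adjmx v *m res G z *m res G w *m v) 0 0 =
   (adjmx v *m ((w - z) *: (res G z *m res G w)) *m v) 0 0.
  by rewrite -scalemxAr -scalemxAl [RHS]mxE !mulmxA.
by rewrite -e mulmxBr mulmxBl subr_mxE.
Qed.

(** Any eigensystem assigns to the outlier the same overlap, because its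
    eigenvectors are multiples of the resolvent vectors. *)
Lemma overlap_value z lam L Rv (i : 'I_n) : z%:M - G \in unitmx ->
  biorthogonal_eigensystem M lam L Rv -> lam i = z ->
  overlap L Rv i i = (((\sum_k sqmod (lvec z 0 k)) * (\sum_k sqmod (rvec z k 0)) /
    sqmod (ares z z))%:C)%C.
Proof.
move=> zu [_ hR hL hLR] lz.
have [a Re] : exists a, Rv i = a *: rvec z.
  by eexists; apply: right_eigenvector => //; rewrite hR lz.
have [b Le] : exists b, adjmx (L i) = b *: lvec z.
  by eexists; apply: left_eigenvector => //; rewrite hL lz.
have ab : b * a * ares z z = 1.
  have := hLR i i; rewrite eqxx /inner Le Re -scalemxAl -scalemxAr scalerA mxE.
  by [].
have RR : inner (Rv i) (Rv i) = ((sqmod a * \sum_k sqmod (rvec z k 0))%:C)%C.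
  rewrite /inner -sum_sqmod Re mulr_sumr; congr (_%:C)%C; apply: eq_bigr => k _.
  by rewrite mxE sqmodM.
have LL : inner (L i) (L i) = ((sqmod b * \sum_k sqmod (lvec z 0 k))%:C)%C.
  rewrite /inner -sum_sqmod mulr_sumr; congr (_%:C)%C; apply: eq_bigr => k _.
  rewrite -sqmodJ -adjmxE Le mxE sqmodM.
  by [].
rewrite /overlap RR LL -rmorphM /=; congr (_%:C)%C.
have /(congr1 sqmod) := ab; rewrite !sqmodM -(cmod_sqr 1) cmod1 expr1n.
move: (sqmod a) (sqmod b) (sqmod (ares z z)) (\sum_k _) (\sum_k _) => x y s p q s1.
have s0 : s != 0.
  by apply/eqP => s0; move: s1; rewrite s0 mulr0 => /esym/eqP; rewrite oner_eq0.
apply: (mulIf s0); rewrite divfK//; transitivity ((y * x * s) * (q * p)).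
  by ring.
by rewrite s1 mul1r.
Qed.

(** The eigenvectors of a simple matrix form a basis, so its eigenvalues are all
    in the list. *)
Lemma eigensystem_complete z lam L Rv : biorthogonal_eigensystem M lam L Rv ->
  eigenvalue M z -> exists i, lam i = z.
Proof.
move=> [_ hR _ hLR] /eigenvalueP[u uM u0]; apply: contrapT => nlam.
have uR i : u *m Rv i = 0.
  have : (z - lam i) *: (u *m Rv i) = 0.
    by rewrite scalerBl scalemxAl -uM -mulmxA hR -scalemxAr subrr.
  move/eqP; rewrite scaler_eq0 subr_eq0 => /orP[/eqP zl|/eqP//].
  by case: nlam; exists i.
pose Rm : 'M[C]_n := \matrix_(k, i) Rv i k 0.
pose Lm : 'M[C]_n := \matrix_(i, k) adjmx (L i) 0 k.
have LR : Lm *m Rm = 1%:M.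
  apply/matrixP => i j; rewrite [RHS]mxE -hLR /inner !mxE.
  by apply: eq_bigr => k _; rewrite !mxE.
have uRm : u *m Rm = 0.
  apply/matrixP => a i; rewrite (ord1 a) [RHS]mxE.
  have := congr1 (fun A : 'M[C]_1 => A 0 0) (uR i); rewrite [X in _ = X]mxE => <-.
  by rewrite !mxE; apply: eq_bigr => k _; rewrite mxE.
move: u0; rewrite -[u]mulmx1 -(mulmx1C LR) mulmxA uRm mul0mx.
by rewrite eqxx.
Qed.

Lemma diag_overlap_value z lam L Rv : z%:M - G \in unitmx ->
  biorthogonal_eigensystem M lam L Rv -> eigenvalue M z ->
  diag_overlap M z = (\sum_k sqmod (lvec z 0 k)) * (\sum_k sqmod (rvec z k 0)) /
    sqmod (ares z z).
Proof.
move=> zu bs zM; have [i iz] := eigensystem_complete bs zM.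
rewrite /diag_overlap; case: xgetP => [x _ [lam' [L' [Rv' [i' [bs' iz' ho]]]]]|nex].
  by move: ho; rewrite (overlap_value zu bs' iz') => /complexI.
by case: (nex _ (ex_intro _ lam (ex_intro _ L (ex_intro _ Rv (ex_intro _ i
  (And3 bs iz (overlap_value zu bs iz))))))).
Qed.

End RankOne.

Section Outlier.
Context {R : realType}.
Local Notation C := (R[i]).
Variables (N : nat).
Local Notation n := N.+1.
Variables (G : 'M[C]_n) (v : 'cV[C]_n) (t E : R).
Hypothesis t1 : 1 < t.
Let r := (t + 1) / 2.
Let rho := (t - 1) / 2.
Let M := rank_one_perturbation G v t.
Hypothesis Gu : forall z, r <= cmod z -> z%:M - G \in unitmx.
Hypothesis fE : forall z, r <= cmod z -> cmod (fres G v z - z^-1) <= E.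
Hypothesis aE : forall z w, r <= cmod z -> r <= cmod w ->
  cmod (ares G v z w - (z * w)^-1) <= E.
Hypothesis E0 : 0 <= E.
Hypothesis Esmall : 2 * t * (1 + 2 * t) * E <= rho.
Hypothesis Esmall2 : 2 * t * (1 + 2 * t) * E <= 1.

Let t0 : 0 < t. Proof. exact: lt_trans t1. Qed.
Let tC : C := (t%:C)%C.

Lemma disc_annulus z : cmod (z - tC) <= rho -> r <= cmod z <= 2 * t.
Proof.
move=> zt; have := ler_cmodB z tC; rewrite cmod_real (gtr0_norm t0).
have := zt; rewrite /rho /r => h1 /(fun h => le_trans h h1).
rewrite ler_norml => /andP[h2 h3]; have := t1; lra.
Qed.

(** Away from the unit disc the eigenvalues are the fixed points of F z = t z
    f(z), where f(z) = v^* R(z) v. It is close to the constant t because f(z)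
    is close to 1/z. It is a contraction because, by the resolvent identity, F
    z - F w = t (z - w) (f(z) - w v^* R(z) R(w) v), where both terms of the
    last factor are close to 1/z. The eigenvalue found in this way is the
    closest one to t, as the disc of center t and radius rho contains no
    other. *)
Lemma outlier_fixed_point : exists2 z, cmod (z - tC) <= 2 * t ^+ 2 * E &
  r <= cmod z /\ outlier M t = z /\ eigenvalue M z.
Proof.
pose F z := tC * z * fres G v z.
have rz z : cmod (z - tC) <= rho -> r <= cmod z by move=> /disc_annulus/andP[].
have z2 z : cmod (z - tC) <= rho -> cmod z <= 2 * t by move=> /disc_annulus/andP[].
have z0 z : cmod (z - tC) <= rho -> z != 0.
  move=> /rz h; rewrite -cmod_eq0 gt_eqF// (lt_le_trans _ h)// /r.
  by have := t0; lra.
have rho0 : 0 <= rho by rewrite /rho; have := t1; lra.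
have Ft z : cmod (z - tC) <= rho -> cmod (F z - tC) <= 2 * t ^+ 2 * E.
  move=> zt; have -> : F z - tC = tC * z * (fres G v z - z^-1).
    by rewrite mulrBr mulfK ?z0.
  rewrite !cmodM cmod_real (gtr0_norm t0).
  apply: ler_pM; rewrite ?mulr_ge0 ?cmod_ge0 ?(ltW t0)//; last exact/fE/rz.
  by rewrite expr2 mulrCA ler_wpM2l ?(ltW t0)// z2.
have tE : 2 * t ^+ 2 * E <= rho.
  apply: le_trans Esmall; rewrite ler_wpM2r// expr2 mulrA ler_wpM2l ?mulr_ge0 ?(ltW t0)//.
  by have := t0; lra.
have FD z : cmod (z - tC) <= rho -> cmod (F z - tC) <= rho.
  by move=> /Ft h; exact: le_trans h tE.
have FL z w : cmod (z - tC) <= rho -> cmod (w - tC) <= rho ->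
    cmod (F z - F w) <= 2^-1 * cmod (z - w).
  move=> zt wt; have := res_identity v (Gu (rz _ zt)) (Gu (rz _ wt)) => id.
  have -> : F z - F w = tC * (z - w) * (fres G v z - w * ares G v z w).
    rewrite /F; have -> : fres G v w = fres G v z - (w - z) * ares G v z w.
      by rewrite -id opprB addrC subrK.
    by ring.
  rewrite !cmodM cmod_real (gtr0_norm t0) mulrAC ler_wpM2r ?cmod_ge0//.
  have h : cmod (fres G v z - w * ares G v z w) <= (1 + 2 * t) * E.
    have -> : fres G v z - w * ares G v z w =
        (fres G v z - z^-1) - w * (ares G v z w - (z * w)^-1).
      have hw : w * (z * w)^-1 = z^-1 by rewrite invfM mulrCA divff ?z0// mulr1.
      by rewrite mulrBr hw opprB addrA subrK.
    apply: le_trans (cmodB _ _) _; rewrite mulrDl mul1r; apply: lerD.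
      exact/fE/rz.
    rewrite cmodM; apply: ler_pM; rewrite ?cmod_ge0 ?z2//.
    by apply: aE; exact: rz.
  have : t * cmod (fres G v z - w * ares G v z w) <= t * ((1 + 2 * t) * E).
    by rewrite ler_wpM2l// ltW.
  by have := Esmall2; lra.
have [z zt Fz] := complex_banach FD FL rho0.
have eigE w : cmod (w - tC) <= rho -> eigenvalue M w = (F w == w).
  move=> wt; rewrite (rank_one_eigenvalue _ _ (Gu (rz _ wt))) /F.
  rewrite mulrAC; apply/eqP/eqP => [h|h]; first by rewrite h mul1r.
  by apply: (mulIf (z0 _ wt)); rewrite h mul1r.
have zM : eigenvalue M z by rewrite eigE// Fz.
exists z; first by rewrite -{1}Fz; exact: Ft.
split; first exact: rz.
split => //; rewrite /outlier.
have uniq w : cmod (w - tC) <= rho -> eigenvalue M w -> w = z.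
  move=> wt; rewrite eigE// => /eqP Fw; apply/eqP; rewrite -subr_eq0 -cmod_eq0.
  rewrite eq_le cmod_ge0 andbT; have := FL w z wt zt; rewrite Fw Fz.
  by have := cmod_ge0 (w - z); lra.
case: xgetP => [w _ [wM wmin]|nex].
  apply: uniq => //; have := wmin z zM; rewrite !norm_cmod lecR => h.
  exact: le_trans h zt.
case: (nex z); split => // w wM; rewrite !norm_cmod lecR.
have [wt|wt] := leP (cmod (w - tC)) rho; first by rewrite (uniq w wt wM).
exact: le_trans zt (ltW wt).
Qed.

End Outlier.

(** * Almost sure simplicity of the spectrum *)

Section Discriminant.
Variables (F : fieldType) (n : nat).
Implicit Types (A B P : 'M[F]_n.+1).

Definition trace_hankel A : 'M[F]_n.+1 := \matrix_(i, j) \tr (A ^+ (i + j)).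

(** When A has eigenvalues lam_i, its matrix of power sums is V V^T for the
    Vandermonde matrix V of the lam_i; hence this determinant is the
    discriminant of the characteristic polynomial. In terms of traces it is
    visibly a polynomial in the entries. *)
Definition discr A : F := \det (trace_hankel A).

Lemma discr_power_sums A (lam : 'I_n.+1 -> F) :
  (forall k, \tr (A ^+ k) = \sum_i lam i ^+ k) ->
  discr A = \det (Vandermonde n.+1 (\row_i lam i)) ^+ 2.
Proof.
move=> E; rewrite expr2 -[X in _ = _ * X]det_tr -det_mulmx; congr (\det _).
apply/matrixP => i j; rewrite !mxE E; apply: eq_bigr => k _.
by rewrite !mxE exprD.
Qed.

Lemma discr_injective A (lam : 'I_n.+1 -> F) :
  (forall k, \tr (A ^+ k) = \sum_i lam i ^+ k) -> discr A != 0 -> injective lam.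
Proof.
move=> E; rewrite (discr_power_sums E) sqrf_eq0 det_Vandermonde => V0 i j ij.
apply/eqP; apply: contraNT V0 => neq; apply/eqP.
wlog lt : i j ij neq / (i < j)%N.
  move=> W; have [lt|ge] := ltnP i j; first exact: (W i j).
  apply: (W j i) => //; first by rewrite eq_sym.
  by rewrite ltn_neqAle ge andbT eq_sym.
by rewrite (bigD1 i)//= (bigD1 j)//= !mxE ij subrr !mul0r.
Qed.

Lemma discr_neq0_of_power_sums A (lam : 'I_n.+1 -> F) :
  (forall k, \tr (A ^+ k) = \sum_i lam i ^+ k) -> injective lam -> discr A != 0.
Proof.
move=> E inj; rewrite (discr_power_sums E) sqrf_eq0 det_Vandermonde.
apply/prodf_neq0 => i _; apply/prodf_neq0 => j ij; rewrite !mxE subr_eq0.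
by apply: contraTneq ij => /inj ->; rewrite ltnn.
Qed.

Lemma trig_expE B k : is_trig_mx B ->
  is_trig_mx (B ^+ k) /\ forall i, (B ^+ k) i i = B i i ^+ k.
Proof.
move=> /is_trig_mxP tB; elim: k => [|k [/is_trig_mxP tk dk]].
  rewrite expr0; split; last by move=> i; rewrite mxE eqxx.
  by apply/is_trig_mxP => i j ij; rewrite mxE -val_eqE ltn_eqF.
rewrite exprS; split.
  apply/is_trig_mxP => i j ij; rewrite mxE big1// => l _.
  have [lj|jl] := ltnP l j; first by rewrite tk// mulr0.
  by rewrite tB ?mul0r// (leq_trans ij).
move=> i; rewrite exprS mxE (bigD1 i)//= dk big1 ?addr0// => l li.
have [il|] := ltnP i l; first by rewrite tB// mul0r.
by rewrite leq_eqVlt val_eqE (negbTE li)/= => lt; rewrite tk ?mulr0.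
Qed.

Lemma conj_expE P A k : P \in unitmx ->
  (P *m A *m invmx P) ^+ k = P *m A ^+ k *m invmx P.
Proof.
move=> uP; elim: k => [|k IH]; first by rewrite !expr0 mulmx1 mulmxV.
rewrite !exprS IH !mulmxE -!mulrA; congr (_ * (_ * _)).
by rewrite mulrA -!mulmxE mulVmx// mul1mx.
Qed.

Lemma trace_conj_trig P A k : P \in unitmx -> is_trig_mx (P *m A *m invmx P) ->
  \tr (A ^+ k) = \sum_i (P *m A *m invmx P) i i ^+ k.
Proof.
move=> uP tB; have [_ dk] := trig_expE k tB.
have -> : \tr (A ^+ k) = \tr ((P *m A *m invmx P) ^+ k).
  by rewrite conj_expE// mxtrace_mulC mulmxA mulVmx// mul1mx.
by apply: eq_bigr => i _; rewrite dk.
Qed.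

Lemma discr_line_poly A B : exists p : {poly F}, forall x, p.[x] = discr (A + x *: B).
Proof.
pose M : 'M[{poly F}]_n.+1 := map_mx polyC A + 'X *: map_mx polyC B.
exists (\det (\matrix_(i < n.+1, j < n.+1) \tr (M ^+ (i + j)))) => x.
have ev k : map_mx (horner_eval x) (M ^+ k) = (A + x *: B) ^+ k.
  rewrite rmorphXn /=; congr (_ ^+ _); rewrite /M map_mxD map_mxZ -!map_mx_comp.
  by congr (_ + _); apply/matrixP => i j; rewrite !mxE /= /horner_eval ?hornerX hornerC.
rewrite -[LHS]/(horner_eval x _) -det_map_mx; congr (\det _).
apply/matrixP => i j; rewrite !mxE -ev -trace_map_mx //.
Qed.

Lemma discrZ (x : F) A : x != 0 -> (discr (x *: A) == 0) = (discr A == 0).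
Proof.
move=> x0; rewrite /discr; have -> : trace_hankel (x *: A) =
    diag_mx (\row_i x ^+ i) *m trace_hankel A *m diag_mx (\row_i x ^+ i).
  apply/matrixP => i j; rewrite mul_mx_diag mul_diag_mx !mxE exprZn mxtraceZ exprD.
  by rewrite mulrAC.
rewrite !det_mulmx !mulf_eq0 det_diag; set z := (X in X == 0).
suff z0 : z != 0 by rewrite (negbTE z0) /= orbF.
by apply/prodf_neq0 => i _; rewrite mxE expf_neq0.
Qed.
End Discriminant.

Section SimpleSpectrum.
Context {R : realType}.
Local Notation C := (R[i]).

(** A Schur form exhibits the eigenvalues together with their power sums, and
    the discriminant tells that they are distinct. Hence the matrix is
    diagonalizable; the rows of the change of basis and the columns of its
    inverse are the biorthogonal eigenvectors. *)
Lemma eigensystem_of_discr n (A : 'M[C]_n.+1) : discr A != 0 ->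
  exists lam L Rv, biorthogonal_eigensystem A lam L Rv.
Proof.
move=> D0; have [P0 /unitarymx_unit uP0] := Schur A (ltn0Sn n).
rewrite /mxred.similar_to mxred.conjumx // => tB.
set B := P0 *m A *m invmx P0 in tB.
have inj0 : injective (fun i => B i i).
  by apply: discr_injective D0 => k; exact: trace_conj_trig.
have : mxpoly.diagonalizable A.
  apply/mxpoly.diagonalizableP; exists [seq B i i | i <- enum 'I_n.+1].
    by rewrite map_inj_uniq ?enum_uniq.
  rewrite -(mxpoly.mxminpoly_uconj A uP0) mxpoly.conjumx //.
  apply: (dvdp_trans (mxminpoly_dvd_char B)).
  by rewrite char_poly_trig// big_map big_enum.
case=> P uP /(mxpoly.diagonalizable_forLR uP)[dv]; rewrite mxpoly.conjVmx// => AE.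
have PA : P *m A = diag_mx dv *m P by rewrite AE !mulmxA mulmxV// mul1mx.
have AP : A *m invmx P = invmx P *m diag_mx dv by rewrite AE mulmxK.
exists (dv 0), (fun i => adjmx (row i P)), (fun i => col i (invmx P)).
split.
- apply: discr_injective D0 => k.
  have E : P *m A *m invmx P = diag_mx dv by rewrite PA mulmxK.
  rewrite (trace_conj_trig k uP) E; last exact: diag_mx_is_trig.
  by apply: eq_bigr => i _; rewrite mxE eqxx.
- move=> i; apply/matrixP => a b; move/matrixP/(_ a i): AP.
  rewrite mul_mx_diag !mxE mulrC => <-; apply: eq_bigr => l _.
  by rewrite !mxE.
- move=> i; rewrite adjmxK -row_mul PA mul_diag_mx.
  by apply/rowP => a; rewrite !mxE.
- move=> i j; rewrite /inner adjmxK -row_mul.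
  have := mulmxV uP => /matrixP /(_ i j); rewrite [RHS]mxE => <-.
  by rewrite !mxE; apply: eq_bigr => l _; rewrite !mxE.
Qed.
End SimpleSpectrum.

Section PolynomialRoots.
Variable F : idomainType.

Lemma nonroot_in_range (p : {poly F}) (f : nat -> F) : p != 0 -> injective f ->
  exists s, p.[f s] != 0.
Proof.
move=> p0 inj; apply: contrapT => H.
have H' s : p.[f s] = 0 by apply: contrapT => /eqP ps; apply: H; exists s.
have := @max_poly_roots _ p [seq f s | s <- iota 0 (size p)] p0.
rewrite map_inj_uniq ?iota_uniq// size_map size_iota ltnn.
suff -> : all (root p) [seq f s | s <- iota 0 (size p)] by move/(_ isT isT).
by apply/allP => _ /mapP[s _ ->]; apply/rootP.
Qed.

End PolynomialRoots.

Section GenericDiscriminant.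
Context {R : realType}.
Local Notation C := (R[i]).
Variable n : nat.
Implicit Types (A : 'M[C]_n.+1).

Definition index_tail (k : nat) : 'M[C]_n.+1 :=
  diag_mx (\row_i (if (k <= i)%N then (i : nat)%:R else 0)).

(** The diagonal entries of index at least k, still to be drawn, are replaced
    by s times their index. Letting s be a natural number makes this a
    countable union of measurable conditions. *)
Definition tail_generic A (k : nat) : Prop :=
  exists s : nat, discr (A + s%:R *: index_tail k) != 0.

(** Up to scaling the matrix is D + s^-1 A with D diagonal with distinct
    entries, and its discriminant is a polynomial in s^-1 that does not vanish
    at 0. *)
Lemma tail_generic0 A : tail_generic A 0.
Proof.
have [p pE] := discr_line_poly (index_tail 0) A.
have p0 : p != 0.
  apply/eqP => p0; have := pE 0; rewrite p0 horner0 scale0r addr0.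
  apply/eqP; rewrite eq_sym; apply: (@discr_neq0_of_power_sums _ _ _ (fun i => (i : nat)%:R)).
    move=> k; have [_ dk] := @trig_expE _ _ (index_tail 0) k (diag_mx_is_trig _).
    by apply: eq_bigr => i _; rewrite dk !mxE eqxx mulr1n.
  by move=> i j /(mulrIn (oner_neq0 _))/val_inj.
have inj : injective (fun s : nat => (s.+1%:R : C)^-1).
  by move=> i j /invr_inj /(mulrIn (oner_neq0 _)) [].
have [s ps] := nonroot_in_range p0 inj; exists s.+1.
have s0 : (s.+1%:R : C) != 0 by rewrite pnatr_eq0.
have -> : A + s.+1%:R *: index_tail 0 =
    s.+1%:R *: (index_tail 0 + (s.+1%:R)^-1 *: A).
  by rewrite scalerDr scalerA (mulfV s0) scale1r addrC.
by rewrite (discrZ _ s0) -pE.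
Qed.

(** q is the discriminant as a polynomial in the diagonal entry k. It is not
    zero, because [tail_generic A k] says that it does not vanish at the entry
    s k. *)
Lemma tail_generic_step A (k : 'I_n.+1) : tail_generic A k ->
  exists2 q : {poly C}, q != 0 & forall g : C, q.[g] != 0 ->
    tail_generic (A + g *: delta_mx k k) k.+1.
Proof.
move=> [s Ds]; have [q qE] := discr_line_poly (A + s%:R *: index_tail k.+1) (delta_mx k k).
exists q; last by move=> g; rewrite qE => h; exists s; rewrite addrAC.
apply: contraNneq Ds => q0; have := qE (s%:R * (k : nat)%:R); rewrite q0 horner0 => ->.
apply/eqP; congr discr; rewrite -scalerA -addrA -scalerDr; congr (_ + _ *: _).
apply/matrixP => i j; rewrite !mxE; have [->|ij] := eqVneq i j.
  rewrite !andbb; have [->|jk] := eqVneq j k.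
    by rewrite ltnn leqnn mul0rn add0r mulr1 mulr1n.
  by rewrite mulr0 addr0 leq_eqVlt val_eqE eq_sym (negbTE jk).
rewrite !mulr0n add0r [_ && _](_ : _ = false) ?mulr0//.
by apply: contraNF ij => /andP[/eqP-> /eqP->].
Qed.

Lemma tail_generic_full A : tail_generic A n.+1 -> discr A != 0.
Proof.
move=> [s]; rewrite [index_tail _](_ : _ = 0) ?scaler0 ?addr0//.
by apply/matrixP => i j; rewrite !mxE leqNgt ltn_ord/= mul0rn.
Qed.
End GenericDiscriminant.

Section ComplexMeasurability.
Context d (T : measurableType d) (R : realType).
Local Notation C := (R[i]).
Variable F : set_system T.

Lemma cmeas_prod (I : Type) (s : seq I) (z : I -> T -> C) :
  (forall i, cmeas F (z i)) -> cmeas F (fun w => \prod_(i <- s) z i w).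
Proof.
move=> mz; elim: s => [|i s IH].
  rewrite (_ : (fun w => _) = fun=> 1); first exact: cmeas_cst.
  by apply/funext => w; rewrite big_nil.
rewrite (_ : (fun w => _) = fun w => z i w * \prod_(i <- s) z i w).
  exact: cmeasM.
by apply/funext => w; rewrite big_cons.
Qed.

Lemma cmeas_det m (A : T -> 'M[C]_m) : (forall i j, cmeas F (fun w => A w i j)) ->
  cmeas F (fun w => \det (A w)).
Proof.
by move=> mA; apply: cmeas_sum => s; apply: cmeasM; [exact: cmeas_cst|exact: cmeas_prod].
Qed.

Lemma cmeas_exp m (A : T -> 'M[C]_m.+1) k :
  (forall i j, cmeas F (fun w => A w i j)) ->
  forall i j, cmeas F (fun w => (A w ^+ k) i j).
Proof.
move=> mA; elim: k => [|k IH] i j; first exact: cmeas_cst.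
rewrite (_ : (fun w => _) = fun w => (A w *m A w ^+ k) i j).
  exact: cmeas_mul_mx.
by apply/funext => w; rewrite exprS.
Qed.

Lemma cmeas_discr m (A : T -> 'M[C]_m.+1) : (forall i j, cmeas F (fun w => A w i j)) ->
  cmeas F (fun w => discr (A w)).
Proof.
move=> mA; apply: cmeas_det => i j; rewrite (_ : (fun w => _) =
  fun w => \sum_a (A w ^+ (i + j)) a a); last by apply/funext => w; rewrite mxE.
by apply: cmeas_sum => a; exact: cmeas_exp.
Qed.

End ComplexMeasurability.

Section MeasurableGenericity.
Context d (E : measurableType d) (R : realType).
Local Notation C := (R[i]).

Lemma cmeas_measurable (z : E -> C) :
  (forall b, measurable_fun setT (fun w => cpart b (z w))) -> cmeas measurable z.
Proof.
move=> mz b _ Y mY; apply: sub_sigma_algebra.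
exact: (mz b measurableT Y mY).
Qed.

Lemma measurable_neq0 (z : E -> C) : cmeas measurable z ->
  measurable [set w | z w != 0].
Proof.
move=> mz; have ms := measurable_sqmod mz.
have := ms measurableT (~` [set 0]) (measurableC (measurable_set1 0)).
move/(smallest_sub (@sigma_algebra_measurable _ E)) => /(_ (fun _ h => h)).
congr (measurable _); apply/seteqP; split => w /=.
  by move=> [_ /eqP h]; rewrite -sqmod_eq0.
by move=> h; split => //; apply/eqP; rewrite sqmod_eq0.
Qed.

Lemma measurable_tail_generic n (A : E -> 'M[C]_n.+1) k :
  (forall i j, cmeas measurable (fun w => A w i j)) ->
  measurable [set w | tail_generic (A w) k].
Proof.
move=> mA; rewrite (_ : [set w | _] = \bigcup_s
    [set w | discr (A w + s%:R *: index_tail n k) != 0]); last first.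
  by apply/seteqP; split => w /= [s h]; exists s.
apply: bigcup_measurable => s _; apply: measurable_neq0; apply: cmeas_discr => i j.
rewrite (_ : (fun w => _) = fun w => A w i j + (s%:R *: index_tail n k) i j).
  by apply: cmeasD => //; exact: cmeas_cst.
by apply/funext => w; rewrite [LHS]mxE.
Qed.

End MeasurableGenericity.

Section AlmostSureSimplicity.
Context d (T : measurableType d) (R : realType) (P : probability T R).
Variable sg : R.
Local Notation C := (R[i]).
Notation gam := (normal_prob 0 sg : probability (measurableTypeR R) R).

Lemma normal_countable (B : set R) : countable B -> measurable B -> gam B = 0%E.
Proof.
move=> cB mB; have := @normal_prob_dominates R 0 sg.
move/null_content_dominatesP; apply => //; exact: countable_lebesgue_measure0.
Qed.

Lemma real_roots_countable (q : {poly C}) : q != 0 ->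
  countable [set g : R | q.[(g%:C)%C] = 0].
Proof.
move=> q0; have [r qE] := closed_field_poly_normal q.
apply: finite_set_countable.
apply: (@sub_finite_set _ _ [set complex.Re z | z in [set` r]]).
  move=> g /= /rootP; rewrite qE rootZ ?lead_coef_eq0// root_prod_XsubC => h.
  by exists (g%:C)%C.
exact: finite_image.
Qed.

(** Given F, the law of X a has no atoms. *)
Lemma fresh_null (F : set_system T) (I : finType) (X : I -> T -> R) (K : {set I}) a
    (S : set (g_sigma_algebraType F * R)) :
  iid_normal P sg F X K -> a \in K -> measurable S ->
  (forall w, countable [set g | S (w, g)]) -> P.-negligible [set w | S (w, X a w)].
Proof.
move=> XK aK mS cS; have [Fm mX _] := XK.
have mid := sub_measurable_id Fm.
exists [set w | S (w, X a w)]; split => //.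
  have mp : measurable_fun setT (fun w => (w, X a w) : g_sigma_algebraType F * R).
    by apply: measurable_fun_pair => //; exact: mX.
  by have := mp measurableT S mS; rewrite setTI.
rewrite (iid_normal_joint mid XK aK mS).
rewrite [LHS](_ : _ = \int[distribution P (mfun_of mid)]_w gam (xsection S w))%E; last by [].
apply: integral0_eq => w _; apply: normal_countable; last exact: measurable_xsection.
apply: sub_countable (cS w); apply: subset_card_le => g.
by rewrite /xsection /= inE.
Qed.

Variables (n : nat) (F : set_system T) (G L : T -> 'M[C]_n.+1).
Hypothesis gG : gauss_cols P sg F G 0.
Hypothesis mL : forall i j, cmeas F (fun w => L w i j).

(** From k to k+1 a single fresh real variable is added, at the diagonal entry
    k. *)
Definition partial_mx (k : nat) (w : T) : 'M[C]_n.+1 :=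
  G w + L w - diag_mx (\row_i (if (k <= i)%N then ((complex.Re (G w i i))%:C)%C else 0)).

Lemma partial_mx_step (k : 'I_n.+1) w : partial_mx k.+1 w =
  partial_mx k w + ((ent G (k, k, true) w)%:C)%C *: delta_mx k k.
Proof.
apply/matrixP => i j; rewrite !mxE -[in RHS]addrA; congr (_ + _).
have [->|ij] := eqVneq i j.
  rewrite !andbb !mulr1n; have [->|jk] := eqVneq j k.
    by rewrite ltnn leqnn mulr1 oppr0 addNr.
  by rewrite mulr0 addr0 [in RHS]leq_eqVlt val_eqE eq_sym (negbTE jk).
rewrite !mulr0n [_ && _](_ : _ = false) ?mulr0 ?addr0//.
by apply: contraNF ij => /andP[/eqP-> /eqP->].
Qed.

(** All variables but the real part of the diagonal entry k are revealed;
    given them only finitely many values of it are bad, by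
    [tail_generic_step]. *)
Lemma ae_tail_generic_step (k : 'I_n.+1) :
  {ae P, forall w, tail_generic (partial_mx k w) k ->
    tail_generic (partial_mx k.+1 w) k.+1}.
Proof.
pose a := (k, k, true); pose J := [set~ a]%SET.
have JK : J \subset cols n.+1 0 by apply/fintype.subsetP => i _; rewrite inE.
have XK := iid_normal_adjoin JK gG; set F' := adjoin F (ent G) J in XK.
have aK : a \in cols n.+1 0 :\: J by rewrite !inE eqxx.
have mA i j b : measurable_fun setT
    ((fun w => cpart b (partial_mx k w i j)) : g_sigma_algebraType F' -> R).
  have mLb : measurable_fun setT
      ((fun w => cpart b (L w i j)) : g_sigma_algebraType F' -> R).
    move=> _ Y mY; have mb := mL i j b; have := mb measurableT Y mY.
    by apply: sub_sigma_algebra2; exact: sub_adjoin.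
  pose c := [&& b, i == j & (k <= i)%N].
  rewrite (_ : (fun w => _) = fun w => (if c then 0 else ent G (i, j, b) w) +
      cpart b (L w i j)); last first.
    apply/funext => w; rewrite !mxE /c /ent /=; clear.
    have [->|_] := eqVneq i j; case: b; case: ifP => _ //=;
      rewrite ?andbF /= ?mulr1n ?mulr0n ?oppr0 ?addr0;
      case: (G w _ _) => x y; case: (L w _ _) => x' y' //=; ring.
  apply: measurable_funD => //; have [cc|cc] := boolP c; first exact: measurable_cst.
  have iJ : (i, j, b) \in J.
    rewrite !inE; apply: contra cc => /eqP E.
    by case: E; rewrite /c => -> -> ->; rewrite eqxx leqnn.
  move=> _ Y mY; rewrite setTI; apply: sub_sigma_algebra.
  exact: adjoin_preimage.
pose S0 : set (g_sigma_algebraType F' * R) := [set z |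
  tail_generic (partial_mx k z.1) k /\
  ~ tail_generic (partial_mx k z.1 + ((z.2)%:C)%C *: delta_mx k k) k.+1].
have mS0 : measurable S0.
  have mz i j : cmeas measurable
      (fun z : g_sigma_algebraType F' * R => partial_mx k z.1 i j).
    apply: cmeas_measurable => b.
    exact: (measurableT_comp (mA i j b) measurable_fst).
  apply: measurableI; first exact: measurable_tail_generic.
  apply: measurableC; apply: measurable_tail_generic => i j.
  rewrite (_ : (fun w => _) = fun z => partial_mx k z.1 i j +
    ((z.2)%:C)%C * delta_mx k k i j); last by apply/funext => z; rewrite !mxE.
  apply: cmeasD => //; apply: cmeasM; last exact: cmeas_cst.
  apply: cmeas_measurable => -[]; [exact: measurable_snd|exact: measurable_cst].
have cS0 w : countable [set g | S0 (w, g)].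
  have [tg|ntg] := pselect (tail_generic (partial_mx k w) k); last first.
    have -> : [set g | S0 (w, g)] = set0; last exact: countable0.
    by apply/seteqP; split => [g [h _]|g []]; case: (ntg h).
  have [q q0 hq] := tail_generic_step tg.
  apply: sub_countable (real_roots_countable q0); apply: subset_card_le => g [_ /=].
  by move=> h; apply: contrapT => /eqP /hq.
apply: negligibleS (fresh_null XK aK mS0 cS0) => w /= /not_implyP[tg ntg].
by split; [exact: tg|rewrite -partial_mx_step; exact: ntg].
Qed.

Lemma ae_discr_neq0 : {ae P, forall w, discr (G w + L w) != 0}.
Proof.
have H k : (k <= n.+1)%N -> {ae P, forall w, tail_generic (partial_mx k w) k}.
  elim: k => [_|k IH kn].
    by apply: aeW => w; exact: tail_generic0.
  have := ae_tail_generic_step (Ordinal kn).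
  by apply: filterS2 (IH (ltnW kn)) => w /= h /(_ h).
have := H _ (leqnn _); apply: filterS => w /tail_generic_full.
rewrite /partial_mx (_ : diag_mx _ = 0) ?subr0//.
by apply/matrixP => i j; rewrite !mxE leqNgt ltn_ord/= mul0rn.
Qed.

End AlmostSureSimplicity.

(** * Ginibre matrices *)

Section GinibreColumns.
Context d (T : measurableType d) (R : realType) (P : probability T R).
Local Notation C := (R[i]).

Lemma iid_normal_reindex sg F (I : finType) (X : I -> T -> R) (f : I -> I) :
  involutive f -> iid_normal P sg F X [set: I] ->
  iid_normal P sg F (fun i => X (f i)) [set: I].
Proof.
move=> fK [Fm mX H]; split => // [i _|A B sA mB]; first by apply: mX; rewrite inE.
have := H A (fun i => B (f i)) sA (fun i => mB (f i)).
rewrite (reindex_inj (inv_inj fK))/= (eq_bigl (fun i => i \in [set: I]%SET)); last first.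
  by move=> i; rewrite !inE.
under eq_bigr do rewrite fK.
move=> <-; congr (P (_ `&` _)); apply/seteqP; split => w h i /= _.
  by have := h (f i); rewrite /= fK inE; exact.
by have := h (f i); rewrite /= fK inE; exact.
Qed.

Lemma complex_rv_part (z : T -> C) b (Y : set R) : measurable Y ->
  sigma_rv z ((fun w => cpart b (z w)) @^-1` Y).
Proof.
move=> mY; pose p (x : R * R) := if b then x.1 else x.2.
have mp : measurable_fun setT p.
  by rewrite /p; case: b {p}; [exact: measurable_fst|exact: measurable_snd].
exists (p @^-1` Y); first by rewrite -[X in measurable X]setTI; exact: mp.
by rewrite setTI /p; case: b {p mp}.
Qed.

Lemma sigma_rv_measurable (z : T -> C) : complex_rv z -> sigma_rv z `<=` measurable.
Proof. by move=> mz _ [Y mY <-]; exact: mz. Qed.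

Lemma sigma_mx_measurable m n (M : T -> 'M[C]_(m, n)) :
  (forall i j, complex_rv (fun w => M w i j)) -> sigma_mx M `<=` measurable.
Proof.
move=> mM; apply: smallest_sub; first exact: sigma_algebra_measurable.
by move=> A [[i j] _ /= hA]; exact: (sigma_rv_measurable (mM i j)).
Qed.

Lemma sigma_mx_cmeas m n (M : T -> 'M[C]_(m, n)) i j :
  cmeas (sigma_mx M) (fun w => M w i j).
Proof.
move=> b _ Y mY; rewrite setTI; apply: sub_sigma_algebra; apply: sub_sigma_algebra.
by exists (i, j) => //; exact: complex_rv_part.
Qed.

(** The real and imaginary parts of an entry have variance 1 / (2 n). *)
Lemma ginibre_gauss_cols n (G : T -> 'M[C]_n) F :
  ginibre P G -> F `<=` measurable -> independent2 P (sigma_mx G) <<s F >> ->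
  gauss_cols P (Num.sqrt (n%:R^-1 / 2)) F G 0.
Proof.
move=> [mG lG iG] Fm ind; split => //.
  move=> [[i j] b] _; rewrite /ent /= => _ Y mY; rewrite setTI.
  by apply: (sigma_rv_measurable (mG i j)); exact: complex_rv_part.
move=> A B sA mB.
pose D (ij : 'I_n * 'I_n) := B (ij, true) `*` B (ij, false).
have mD ij : measurable (D ij) by exact: measurableX.
pose Z ij : set T := (coords \o (fun w => G w ij.1 ij.2)) @^-1` D ij.
have sZ ij : sigma_rv (fun w => G w ij.1 ij.2) (Z ij).
  by exists (D ij) => //; rewrite setTI.
have ZE : \bigcap_(i in [set` cols n 0]) ent G i @^-1` B i =
    \bigcap_(ij in [set` [set: 'I_n * 'I_n]%SET]) Z ij.
  apply/seteqP; split => w h.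
    move=> ij _; split; first by apply: (h (ij, true)); rewrite /= inE.
    by apply: (h (ij, false)); rewrite /= inE.
  by move=> [ij b] _; have [|h1 h2] := h ij; [rewrite /= inE|case: b].
rewrite ZE setIC ind//; last first.
  apply: (@finset_bigcap_measurable _ (g_sigma_algebraType _)) => ij _.
  by apply: sub_sigma_algebra; exists ij.
rewrite muleC; congr (_ * _)%E; rewrite iG//.
set g := normal_prob 0 (Num.sqrt (n%:R^-1 / 2)) : set R -> \bar R.
have bb (f : bool -> \bar R) : (\prod_(b : bool) f b = f true * f false)%E.
  exact: big_bool.
have pp (f : 'I_n * 'I_n -> bool -> \bar R) :
    (\prod_(ij : 'I_n * 'I_n) \prod_(b : bool) f ij b =
     \prod_(i : 'I_n * 'I_n * bool) f i.1 i.2)%E.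
  exact: pair_big.
rewrite [RHS](eq_bigl predT) => [|i]; last by rewrite inE.
rewrite [LHS](eq_bigl predT) => [|i]; last by rewrite inE.
transitivity (\prod_(ij : 'I_n * 'I_n) \prod_(b : bool) g (B (ij, b)))%E.
  apply: eq_bigr => ij _; rewrite bb /Z lG//.
  by rewrite /complex_gaussian /D product_measure1E//; exact: mB.
by rewrite pp; apply: eq_bigr => -[ij b].
Qed.

End GinibreColumns.

(** * Overlap of the outlier at a fixed size *)

Section FixedSize.
Context {R : realType}.
Local Notation C := (R[i]).
Variables (N : nat).
Local Notation n := N.+1.
Implicit Types (G : 'M[C]_n) (v : 'cV[C]_n).

Definition krylov_error (delta : R) K : R := (1 + (2 * K%:R + 1) * delta) ^+ K - 1.

Lemma krylov_error_ge0 (delta : R) K : 0 <= delta -> 0 <= krylov_error delta K.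
Proof.
move=> d0; rewrite subr_ge0; apply: exprn_ege1.
by rewrite lerDl mulr_ge0 ?addr_ge0 ?mulr_ge0.
Qed.

(** A common bound for the errors of [res_entry], [res_entry2] and [res_norm],
    with q standing for r^-m. *)
Definition resolvent_error (r eps B q : R) : R :=
  let beta := 2 * B / (r - 1) in
  let tail := 2 * beta * q in
  let kappa := eps / (r - 1) + tail in
  kappa + (kappa / (r - 1) + beta * tail) +
  (kappa * (kappa + 2 / (r - 1)) + q / (r - 1)).

Definition resolvent_estimates (r E : R) G v : Prop :=
  [/\ forall z, r <= cmod z -> z%:M - G \in unitmx,
      forall z, r <= cmod z -> cmod (fres G v z - z^-1) <= E,
      forall z w, r <= cmod z -> r <= cmod w ->
        cmod (ares G v z w - (z * w)^-1) <= E &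
      forall z, r <= cmod z ->
        `|\sum_i sqmod (rvec G v z i 0) - (cmod z ^+ 2 - 1)^-1| <= E].

Lemma ek0E : ek N 0 = ec 0 :> 'cV[C]_n.
Proof. by rewrite /ek; congr ec; apply: val_inj; rewrite /= inordK. Qed.

Lemma adjmx_ek0 (u : 'cV[C]_n) : (adjmx (ek N 0) *m u) 0 0 = u 0 0.
Proof.
rewrite mxE (bigD1 0)//= big1 ?addr0.
  by rewrite adjmxE ek0E mxE !eqxx rmorph1 mul1r.
by move=> i /negbTE i0; rewrite adjmxE ek0E mxE i0 rmorph0 mul0r.
Qed.

(** B bounds the powers of the Hessenberg form: 2 for the entries of the
    powers of G, n (n 2) after the change of basis, and n times that for the
    action on vectors. *)
Lemma hess_estimates (delta r : R) m G v : (0 < m)%N -> (m.*2 < n)%N -> 1 < r ->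
  0 < delta <= 1 -> krylov_error delta m.*2 <= 1 ->
  let B := n%:R * (n%:R * (n%:R * 2)) in B * r^-1 ^+ m <= 2^-1 ->
  (forall k i j, (k <= m)%N -> cmod ((G ^+ k) i j) <= 2) ->
  hess delta m.*2 G v ->
  resolvent_estimates r (resolvent_error r (krylov_error delta m.*2) B (r^-1 ^+ m)) G v.
Proof.
move=> m0 mn r1 dl e1 B small ent2 hG.
have d0 : 0 <= delta by case/andP: dl => /ltW.
have e0 : 0 <= krylov_error delta m.*2 by exact: krylov_error_ge0.
have B0 : 0 <= B by rewrite /B !mulr_ge0.
have [U [uU Uv kH]] := hess_krylov dl mn hG.
set H := U *m G *m adjmx U in kH.
have bH k x : (k <= m)%N -> nrm1 (H ^+ k *m x) <= B * nrm1 x.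
  move=> km; apply: mx_nrm1_bound => i j; rewrite /H unitary_conj_pow//.
  by apply: conj_entry => // i' j'; exact: ent2.
have r10 : 0 < r - 1 by rewrite subr_gt0.
have q0 : 0 <= r^-1 ^+ m by rewrite exprn_ge0// invr_ge0 ltW// (lt_trans _ r1).
have uH z : r <= cmod z -> z%:M - H \in unitmx by exact: (resolvent_unit r1 B0 bH small).
have rG z : r <= cmod z -> z%:M - G \in unitmx /\ res G z = adjmx U *m res H z *m U.
  by move=> rz; apply: res_conj => //; exact: uH.
have aE : adjmx v *m adjmx U = adjmx (ek N 0) by rewrite -adjmxM Uv.
have rv z : r <= cmod z -> rvec G v z = adjmx U *m (res H z *m ek N 0).
  by move=> rz; rewrite /rvec (rG z rz).2 -Uv !mulmxA.
have lv z : r <= cmod z -> lvec G v z = adjmx (ek N 0) *m res H z *m U.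
  by move=> rz; rewrite /lvec (rG z rz).2 -aE !mulmxA.
have E1 := res_entry m0 mn r1 e0 e1 B0 kH bH small.
have E2 := res_entry2 m0 mn r1 e0 e1 B0 kH bH small.
have E3 := res_norm mn r1 e0 e1 B0 kH bH small.
rewrite /resolvent_error /=; set be := 2 * B / (r - 1) in E1 E2 E3 *.
set ta := 2 * be * r^-1 ^+ m in E1 E2 E3 *.
set ka := krylov_error delta m.*2 / (r - 1) + ta.
have be0 : 0 <= be by rewrite divr_ge0 ?mulr_ge0// ltW.
have ta0 : 0 <= ta by exact: (mulr_ge0 (mulr_ge0 (ler0n _ 2) be0) q0).
have ka0 : 0 <= ka by rewrite addr_ge0// divr_ge0// ltW.
have x0 : 0 <= ka / (r - 1) + be * ta.
  by apply: addr_ge0; [apply: divr_ge0 => //; exact: ltW|exact: mulr_ge0].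
have y0 : 0 <= ka * (ka + 2 / (r - 1)) + r^-1 ^+ m / (r - 1).
  have h : 0 <= 2 / (r - 1) by apply: divr_ge0 => //; exact: ltW.
  apply: addr_ge0; first by apply: mulr_ge0 => //; exact: addr_ge0.
  by apply: divr_ge0 => //; exact: ltW.
split.
- by move=> z /rG[].
- move=> z rz; apply: (@le_trans _ _ ka); last by rewrite -addrA lerDl addr_ge0.
  apply: le_trans (E1 z rz); rewrite /fres rv// mulmxA aE adjmx_ek0.
  exact: lexx.
- move=> z w rz rw; apply: (@le_trans _ _ (ka / (r - 1) + be * ta)).
    apply: le_trans (E2 z w rz rw); rewrite /ares rv// lv//.
    rewrite -!mulmxA (mulmxA U) (unitaryC uU) mul1mx adjmx_ek0.
    exact: lexx.
  by rewrite addrAC lerDr addr_ge0.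
- move=> z rz; apply: (@le_trans _ _ (ka * (ka + 2 / (r - 1)) + r^-1 ^+ m / (r - 1))).
    apply: le_trans (E3 z rz); rewrite rv// (unitary_sum_sqmod _ (unitary_adj uU)).
    exact: lexx.
  by rewrite lerDr addr_ge0.
Qed.

(** Brings the left vectors under the estimates on right vectors, applied to a
    matrix with the same law. *)
Lemma lvec_trmx G v z : (lvec G v z)^T = rvec G^T (adjmx v)^T z.
Proof.
rewrite /lvec /rvec /res trmx_mul trmx_inv; congr (invmx _ *m _).
by rewrite linearB /= tr_scalar_mx.
Qed.

Lemma hess_overlap (t r E : R) G v : r = (t + 1) / 2 -> 1 < t ->
  resolvent_estimates r E G v -> resolvent_estimates r E G^T (adjmx v)^T ->
  0 <= E -> 2 * t * (1 + 2 * t) * E <= (t - 1) / 2 -> 2 * t * (1 + 2 * t) * E <= 1 ->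
  discr (rank_one_perturbation G v t) != 0 ->
  let M := rank_one_perturbation G v t in
  exists z a : C, exists x y : R,
  [/\ diag_overlap M (outlier M t) = x * y / sqmod a,
      cmod (z - t%:C%C) <= 2 * t ^+ 2 * E,
      cmod (a - (z * z)^-1) <= E,
      `|x - (cmod z ^+ 2 - 1)^-1| <= E & `|y - (cmod z ^+ 2 - 1)^-1| <= E].
Proof.
move=> rE t1 [Gu fE aE NE] [_ _ _ NE'] E0 s1 s2 D0; rewrite rE in Gu fE aE NE NE'.
have [z zt [rz [oz zM]]] := outlier_fixed_point t1 Gu fE aE E0 s1 s2.
have [lam [Lv [Rv bs]]] := eigensystem_of_discr D0.
exists z, (ares G v z z), (\sum_k sqmod (lvec G v z 0 k)), (\sum_k sqmod (rvec G v z k 0)).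
split => //.
- rewrite oz; exact: (diag_overlap_value (Gu z rz) bs zM).
- exact: aE.
- have := NE' z rz; rewrite -lvec_trmx; congr (`|_ - _| <= _).
  by apply: eq_bigr => k _; rewrite mxE.
- exact: NE.
Qed.
End FixedSize.

(** * Probability of the Hessenberg reductions *)

Section GoodEvent.
Context d (T : measurableType d) (R : realType) (P : probability T R).
Local Notation C := (R[i]).
Variables (N : nat) (G : T -> 'M[C]_N.+1) (v : T -> 'cV[C]_N.+1).
Local Notation n := N.+1.
Hypothesis hG : ginibre P G.
Hypothesis hv : random_unit_vector v.
Hypothesis hGv : independent2 P (sigma_mx G) (sigma_mx v).
Let sg : R := Num.sqrt (n%:R^-1 / 2).

Lemma vector_sigma_measurable : sigma_mx v `<=` measurable.
Proof. by apply: sigma_mx_measurable => i j; rewrite (ord1 j); case: hv. Qed.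

Lemma gauss_cols_ginibre : gauss_cols P sg (sigma_mx v) G 0.
Proof.
apply: ginibre_gauss_cols => //; first exact: vector_sigma_measurable.
move=> A B sA sB; apply: hGv => //; apply: smallest_sub sB => //.
exact: smallest_sigma_algebra.
Qed.

Lemma gauss_cols_ginibre_tr : gauss_cols P sg (sigma_mx v) (fun w => (G w)^T) 0.
Proof.
pose f (i : 'I_n * 'I_n * bool) := (i.1.2, i.1.1, i.2).
have cE : cols n 0 = [set: 'I_n * 'I_n * bool]%SET by apply/setP => i; rewrite !inE.
have := gauss_cols_ginibre; rewrite /gauss_cols cE => g.
have fK : involutive f by move=> [[i j] b].
apply: eq_iid_normal (iid_normal_reindex fK g) => -[[i j] b] w _.
by rewrite /ent /f /= mxE.
Qed.

Lemma unit_sum_sqmod w : \sum_i sqmod (v w i 0) = 1.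
Proof. by apply: complexI; rewrite sum_sqmod; case: hv => _ /(_ w). Qed.

Lemma hess_off (delta : R) k (A : T -> 'M[C]_n) (u : T -> 'cV[C]_n) :
  0 < delta <= 1 -> (k < n)%N -> gauss_cols P sg (sigma_mx v) A 0 ->
  (forall i, cmeas (sigma_mx v) (fun w => u w i 0)) ->
  (forall w, \sum_i sqmod (u w i 0) = 1) ->
  holds_off P (k%:R * col_risk n delta) (fun w => hess delta k (A w) (u w)).
Proof.
move=> dl kn gA mu u1; have := krylov_hessenberg (ltn0Sn N) dl kn gA mu u1.
apply: holds_offW => // w [U [uU Uu nU]]; exists U; split => //.
by rewrite Uu ek0E; congr ec; exact: val_inj.
Qed.

Lemma col_risk_ge0 p (delta : R) : 0 <= col_risk p delta.
Proof. by rewrite mulr_ge0 ?expR_ge0// addr_ge0 ?mulr_ge0. Qed.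

(** The reductions at v and, for the transpose, at conj v give the estimates
    on right and left vectors; those at the basis vectors bound the powers of
    G. *)
Definition all_hess (delta : R) k w : Prop :=
  [/\ hess delta k (G w) (v w), hess delta k (G w)^T (adjmx (v w))^T &
      forall j, hess delta k (G w) (ec j)].

Lemma all_hess_off (delta : R) k : 0 < delta <= 1 -> (k < n)%N ->
  holds_off P ((n%:R + 2) * (k%:R * col_risk n delta)) (all_hess delta k).
Proof.
move=> dl kn; set e := k%:R * col_risk n delta.
have e0 : 0 <= e by rewrite mulr_ge0// col_risk_ge0.
have h1 : holds_off P e (fun w => hess delta k (G w) (v w)).
  apply: hess_off => //; first exact: gauss_cols_ginibre.
    by move=> i; exact: sigma_mx_cmeas.
  exact: unit_sum_sqmod.
have h2 : holds_off P e (fun w => hess delta k (G w)^T (adjmx (v w))^T).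
  apply: (hess_off dl kn gauss_cols_ginibre_tr) => [i|w].
    rewrite (_ : (fun w => _) = fun w => Num.conj (v w i 0)).
      by apply: cmeasJ; exact: sigma_mx_cmeas.
    by apply/funext => w; rewrite !mxE.
  rewrite -(unit_sum_sqmod w); apply: eq_bigr => i _.
  by rewrite !mxE sqmodJ.
have h3 : holds_off P (#|'I_n|%:R * e) (fun w => forall j, hess delta k (G w) (ec j)).
  apply: holds_off_forall => // j; apply: (hess_off dl kn gauss_cols_ginibre).
    by move=> i; exact: cmeas_cst.
  move=> w; rewrite (bigD1 j)//= big1 => [|i /negbTE ij]; last first.
    by rewrite mxE ij -cmod_sqr cmod0 expr0n.
  by rewrite mxE !eqxx -cmod_sqr cmod1 expr1n addr0.
apply: holds_offW (holds_offI (holds_offI h1 h2) h3).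
  by rewrite card_ord le_eqVlt; apply/orP; left; apply/eqP; ring.
by move=> w [[? ?] ?].
Qed.

Lemma ae_discr_perturbation (t : R) :
  {ae P, forall w, discr (rank_one_perturbation (G w) (v w) t) != 0}.
Proof.
apply: (ae_discr_neq0 gauss_cols_ginibre) => i j.
rewrite (_ : (fun w => _) = fun w => (t%:C)%C * (v w i 0 * Num.conj (v w j 0))).
  apply: cmeasM; first exact: cmeas_cst.
  by apply: cmeasM; last apply: cmeasJ; exact: sigma_mx_cmeas.
by apply/funext => w; rewrite !mxE big_ord1 !mxE.
Qed.
End GoodEvent.

(** * Exceptional events and rates *)

Section BorelCantelli.
Context d (T : measurableType d) (R : realType) (P : probability T R).

(** Borel-Cantelli; the bounds are summable as 1 / ((N+1) (N+2)) = 1 / (N+1) -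
    1 / (N+2). *)
Lemma eventually_of_holds_off (c : R) (Q : nat -> T -> Prop) :
  0 <= c -> (forall N, holds_off P (c / (N.+1%:R * N.+2%:R)) (Q N)) ->
  {ae P, forall w, \forall N \near \oo, Q N w}.
Proof.
move=> c0 /choice[B HB]; exists (lim_sup_set B); split.
- apply: bigcapT_measurable => k; apply: bigcup_measurable => j _.
  by have [] := HB j.
- apply: lim_sup_set_cvg0; first by move=> k; have [] := HB k.
  apply: (@le_lt_trans _ _ c%:E); last exact: ltry.
  apply: lime_le; first by apply: is_cvg_nneseries => n _ _; exact: measure_ge0.
  apply: nearW => n; apply: (@le_trans _ _ (c - c / n.+1%:R)%:E); last first.
    by rewrite lee_fin gerBl divr_ge0.
  elim: n => [|n IH]; first by rewrite big_geq// divr1 subrr.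
  rewrite big_nat_recr//=; have [_ PB _] := HB n.
  apply: (@le_trans _ _ ((c - c / n.+1%:R)%:E + (c / (n.+1%:R * n.+2%:R))%:E)%E).
    exact: leeD.
  rewrite -EFinD lee_fin le_eqVlt; apply/orP; left; apply/eqP.
  have : (n.+1%:R : R) != 0 by rewrite pnatr_eq0.
  have : (n.+1%:R + 1 : R) != 0 by rewrite natr1 pnatr_eq0.
  rewrite -[n.+2%:R]natr1.
  by move: (n.+1%:R : R) => a a1 a0; field; rewrite a0 a1.
- move=> w /= nQ k _; apply: contrapT => nB; apply: nQ; exists k => // N /= kN.
  have [_ _ h] := HB N; apply: h => BN; apply: nB.
  by exists N.
Qed.
End BorelCantelli.

Section Rates.
Context {R : realType}.

Lemma expN_le_pow (k : nat) : exists2 c : R, 0 < c &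
  forall x : R, 0 < x -> expR (- x) <= c / x ^+ k.+1.
Proof.
exists (k.+1`!)%:R; first by rewrite ltr0n fact_gt0.
move=> x x0; rewrite expRN invf_ple ?posrE ?expR_gt0//; last first.
  by rewrite divr_gt0 ?exprn_gt0// ltr0n fact_gt0.
rewrite invf_div; apply: le_trans (expR_ge1Dxn k (ltW x0)); by rewrite lerDr.
Qed.

(** The degree m of the Neumann series is the eighth root of the size n, and
    delta = m^-3. Then n delta^2 >= m^2 beats every power of n in [col_risk],
    m^2 delta tends to 0 as required by [krylov_error], and r^-m beats every
    power of n. *)
Lemma eighth_root (N : nat) : exists m, (m ^ 8 <= N.+1 < m.+1 ^ 8)%N.
Proof.
elim: N => [|N [m /andP[h1 h2]]]; first by exists 1%N.
have [h|h] := ltnP N.+2 (m.+1 ^ 8); first by exists m; rewrite h (leq_trans h1).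
exists m.+1; rewrite h /=; apply: leq_ltn_trans h2 _; by rewrite ltn_exp2r.
Qed.

(** As n < (2 m)^8, it is enough that n^4 m exp (- m^2 / 8) is bounded, hence
    that exp (- x) decreases faster than x^-17. *)
Lemma risk_bound : exists2 c : R, 0 <= c & forall n m : nat, (0 < m)%N ->
  (m ^ 8 <= n < m.+1 ^ 8)%N ->
  (n%:R + 2) * ((m.*2)%:R * col_risk n ((m%:R : R) ^+ 3)^-1) <=
  c / (n%:R * n.+1%:R).
Proof.
(* x >= m^2 / 8 turns c x^-17 into m^-34, against n^4 m = O(m^33). *)
have [c c0 hc] := expN_le_pow 16.
exists (48 * (2 ^+ 8) ^+ 4 * (8 ^+ 17 * c)).
  by rewrite !mulr_ge0// ?exprn_ge0// ltW.
move=> n m m0 /andP[mn nm].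
have M0 : 0 < (m%:R : R) by rewrite ltr0n.
have M1 : 1 <= (m%:R : R) by rewrite ler1n.
have n0 : (0 < n)%N by apply: leq_trans mn; rewrite expn_gt0 m0.
have n1 : 1 <= (n%:R : R) by rewrite ler1n.
have nR : 0 < (n%:R : R) by rewrite ltr0n.
have nM : (n%:R : R) <= 2 ^+ 8 * m%:R ^+ 8.
  rewrite -exprMn -natrM -natrX ler_nat; apply: leq_trans (ltnW nm) _.
  by rewrite leq_exp2r// mul2n -addnn -addn1 leq_add2l.
have Mn : (m%:R : R) ^+ 8 <= n%:R by rewrite -natrX ler_nat.
set x := n%:R * ((m%:R : R) ^+ 3)^-1 ^+ 2 / 8.
have xm : m%:R ^+ 2 / 8 <= x.
  rewrite /x ler_pM2r// -exprVn -exprM -[m%:R ^+ 2](@mulfK _ (m%:R ^+ 6)); last first.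
    by rewrite expf_neq0// gt_eqF.
  by rewrite -exprD -exprVn ler_pM2r// exprn_gt0// invr_gt0.
have y0 : 0 < (m%:R : R) ^+ 2 / 8 by rewrite divr_gt0// exprn_gt0.
have ex : expR (- x) <= 8 ^+ 17 * c / m%:R ^+ 34.
  apply: (@le_trans _ _ (expR (- (m%:R ^+ 2 / 8)))); first by rewrite ler_expR lerN2.
  apply: le_trans (hc _ y0) _; rewrite expr_div_n -exprM invf_div.
  by rewrite mulrA [c * _]mulrC.
rewrite ler_pdivlMr ?mulr_gt0 ?ltr0n// /col_risk -/x.
have -> : (n%:R + 2) * (m.*2%:R * ((2 * n%:R + 2) * expR (- x))) * (n%:R * n.+1%:R) =
   ((n%:R + 2) * (2 * n%:R + 2) * n%:R * (n%:R + 1)) * (2 * m%:R) * expR (- x) :> R.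
  by rewrite -muln2 natrM -[n.+1%:R]natr1; ring.
have h4 : (n%:R + 2) * (2 * n%:R + 2) * n%:R * (n%:R + 1) <= 24 * n%:R ^+ 4 :> R.
  have -> : 24 * n%:R ^+ 4 = (3 * n%:R) * (4 * n%:R) * n%:R * (2 * n%:R) :> R by ring.
  apply: ler_pM; rewrite ?mulr_ge0 ?addr_ge0 ?mulr_ge0//; last by lra.
  apply: ler_pM; rewrite ?mulr_ge0 ?addr_ge0 ?mulr_ge0//.
  by apply: ler_pM; rewrite ?addr_ge0 ?mulr_ge0//; lra.
have h5 : n%:R ^+ 4 <= (2 ^+ 8) ^+ 4 * m%:R ^+ 32 :> R.
  rewrite (_ : 32 = 8 * 4)%N// exprM -exprMn.
  by apply: lerXn2r; rewrite ?nnegrE ?mulr_ge0 ?exprn_ge0 ?ler0n.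
have E0 := expR_ge0 (- x).
apply: (@le_trans _ _ (24 * ((2 ^+ 8) ^+ 4 * m%:R ^+ 32) * (2 * m%:R) * expR (- x))).
  apply: ler_wpM2r => //; apply: ler_wpM2r; first by rewrite mulr_ge0.
  by apply: le_trans h4 _; rewrite ler_wpM2l.
apply: (@le_trans _ _ (48 * (2 ^+ 8) ^+ 4 * (m%:R ^+ 33 * (8 ^+ 17 * c / m%:R ^+ 34)))).
  have -> : 24 * ((2 ^+ 8) ^+ 4 * m%:R ^+ 32) * (2 * m%:R) * expR (- x) =
    48 * (2 ^+ 8) ^+ 4 * (m%:R ^+ 33 * expR (- x)) :> R.
    by rewrite (exprSr _ 32); move: (_ ^+ 32) ((_ ^+ _) ^+ _) => a b; ring.
  apply: ler_wpM2l; first by rewrite mulr_ge0 ?exprn_ge0.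
  by apply: ler_wpM2l => //; rewrite exprn_ge0// ltW.
apply: ler_wpM2l; first by rewrite mulr_ge0 ?exprn_ge0.
rewrite mulrA ler_pdivrMr ?exprn_gt0// mulrC ler_wpM2l//.
  by rewrite mulr_ge0 ?exprn_ge0// ltW.
exact: ler_weXn2l.
Qed.
End Rates.

Section ErrorLimits.
Context {R : realType}.
Variables (m : nat -> nat) (r : R).
Hypothesis mE : forall N, (m N ^ 8 <= N.+1 < (m N).+1 ^ 8)%N.
Hypothesis r1 : 1 < r.

Lemma root_gt0 N : (0 < m N)%N.
Proof.
rewrite lt0n; apply/negP => /eqP m0; have := mE N.
by rewrite m0 exp1n ltnS ltn0 andbF.
Qed.

Lemma root_cvg_infty : m N @[N --> \oo] --> \oo.
Proof.
apply/cvgnyPge => A; exists (A ^ 8)%N => // N /= AN.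
rewrite -ltnS -(ltn_exp2r _ _ (isT : (0 < 8)%N)); have /andP[_] := mE N.
by apply: leq_ltn_trans; exact: leq_trans AN (leqnSn N).
Qed.

Lemma root_inv_cvg0 : ((m N)%:R^-1 : R) @[N --> \oo] --> 0.
Proof.
apply/gtr0_cvgV0; last by apply/cvgrnyP; exact: root_cvg_infty.
by apply: nearW => N; rewrite ltr0n root_gt0.
Qed.

Let step N : R := ((m N)%:R ^+ 3)^-1.

Lemma step_range N : 0 < step N <= 1.
Proof.
have m0 : 0 < ((m N)%:R : R) ^+ 3 by rewrite exprn_gt0// ltr0n root_gt0.
rewrite invr_gt0 m0 invf_le1// exprn_ege1// ler1n; exact: root_gt0.
Qed.

Lemma squeeze0 (u w : nat -> R) : (forall N, 0 <= u N <= w N) ->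
  w N @[N --> \oo] --> 0 -> u N @[N --> \oo] --> 0.
Proof.
by move=> uw w0; apply: squeeze_cvgr (cvg_cst 0) w0; apply: nearW.
Qed.

(** It is at most exp (10 / m) - 1. *)
Lemma krylov_error_cvg0 : krylov_error (step N) (m N).*2 @[N --> \oo] --> 0.
Proof.
apply: (@squeeze0 _ (fun N => expR (10 * (m N)%:R^-1) - 1)) => [N|].
  have /andP[d0 _] := step_range N; rewrite krylov_error_ge0 ?(ltW d0)//=.
  have m0 : 0 < ((m N)%:R : R) by rewrite ltr0n root_gt0.
  have m1 : 1 <= ((m N)%:R : R) by rewrite ler1n root_gt0.
  rewrite lerD2r; set a := _ * step N; apply: (@le_trans _ _ (expR a ^+ (m N).*2)).
    apply: lerXn2r; rewrite ?nnegrE ?expR_ge0 ?expR_ge1Dx//.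
    by rewrite addr_ge0// mulr_ge0 ?ltW// addr_gt0// mulr_gt0// ltr0n double_gt0 root_gt0.
  rewrite -expRM_natl ler_expR /a /step -muln2 natrM.
  move: (m N)%:R m0 m1 => x x0 x1.
  rewrite [leLHS]mulrA ler_pdivrMr ?exprn_gt0//.
  have -> : 10 / x * x ^+ 3 = 10 * x ^+ 2.
    by rewrite exprS mulrA divfK// gt_eqF.
  by nra.
have e1 : expR (10 * (m N)%:R^-1) @[N --> \oo] --> (1 : R).
  have h : 10 * (m N)%:R^-1 @[N --> \oo] --> (0 : R).
    by rewrite -[X in _ --> X](mulr0 10); apply: cvgMr; exact: root_inv_cvg0.
  have := continuous_cvg _ (@continuous_expR R 0) h; rewrite expR0 => H.
  exact: H.
by rewrite -[X in _ --> X](subrr 1); apply: cvgB => //; exact: cvg_cst.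
Qed.

Let B N : R := N.+1%:R * (N.+1%:R * (N.+1%:R * 2)).
Let q N : R := r^-1 ^+ m N.

(** B^2 is of order m^48 at most, and r^-m decreases faster than m^-49. *)
Lemma square_tail_cvg0 : B N ^+ 2 * q N @[N --> \oo] --> 0.
Proof.
have [c c0 hc] := @expN_le_pow R 48.
have l0 : 0 < ln r by rewrite ln_gt0.
pose k := 4 * (2 ^+ 8) ^+ 6 * (c / ln r ^+ 49).
apply: (@squeeze0 _ (fun N => k * (m N)%:R^-1)) => [N|]; last first.
  by rewrite -[X in _ --> X](mulr0 k); apply: cvgMr; exact: root_inv_cvg0.
have r0 : 0 < r by exact: lt_trans r1.
have B0 : 0 <= B N by rewrite /B !mulr_ge0.
have q0 : 0 <= q N by rewrite exprn_ge0// invr_ge0 ltW.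
rewrite (mulr_ge0 (exprn_ge0 _ B0) q0) /=.
have m0 : 0 < ((m N)%:R : R) by rewrite ltr0n root_gt0.
have nM : (N.+1%:R : R) <= 2 ^+ 8 * (m N)%:R ^+ 8.
  have /andP[_ nm] := mE N.
  rewrite -exprMn -natrM -natrX ler_nat; apply: leq_trans (ltnW nm) _.
  by rewrite leq_exp2r// mul2n -addnn -addn1 leq_add2l root_gt0.
have B2 : B N ^+ 2 <= 4 * ((2 ^+ 8) ^+ 6 * (m N)%:R ^+ 48).
  have -> : B N ^+ 2 = 4 * N.+1%:R ^+ 6 by rewrite /B; move: (N.+1%:R : R) => a; ring.
  rewrite (_ : 48 = 8 * 6)%N// exprM -exprMn; apply: ler_wpM2l => //.
  by apply: lerXn2r; rewrite ?nnegrE ?mulr_ge0 ?exprn_ge0 ?ler0n.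
have qc : q N <= c / (ln r ^+ 49 * (m N)%:R ^+ 49).
  have -> : q N = expR (- (ln r * (m N)%:R)).
    by rewrite mulrC -mulrN expRM_natl expRN lnK.
  by rewrite -exprMn; apply: hc; rewrite mulr_gt0.
apply: (@le_trans _ _ ((4 * ((2 ^+ 8) ^+ 6 * (m N)%:R ^+ 48)) *
    (c / (ln r ^+ 49 * (m N)%:R ^+ 49)))).
  exact: (ler_pM (exprn_ge0 _ B0) q0 B2 qc).
rewrite /k le_eqVlt; apply/orP; left; apply/eqP.
rewrite (exprS (m N)%:R 48); have : (m N)%:R ^+ 48 != 0 :> R by rewrite expf_neq0 ?gt_eqF.
have : ln r ^+ 49 != 0 by rewrite expf_neq0 ?gt_eqF.
move: (gt_eqF m0) => /negbT; move: (m N)%:R (_ ^+ 6) (_ ^+ 48) (_ ^+ 49) => x4 x1 x2 x3 h1 h2 h3.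
by field; rewrite h1 h2 h3.
Qed.

Lemma size_bound_ge1 N : 1 <= B N.
Proof.
have n1 : 1 <= (N.+1%:R : R) by rewrite ler1n.
by rewrite /B; do 3![apply: mulr_ege1 => //]; rewrite ler1n.
Qed.

Lemma tail_cvg0 : B N * q N @[N --> \oo] --> 0.
Proof.
apply: (@squeeze0 _ (fun N => B N ^+ 2 * q N)) square_tail_cvg0 => N.
have q0 : 0 <= q N by rewrite exprn_ge0// invr_ge0 ltW// (lt_trans _ r1).
have B1 := size_bound_ge1 N; have B0 := le_trans ler01 B1.
by rewrite mulr_ge0//= ler_wpM2r// expr2 ler_peMr.
Qed.

Lemma ratio_pow_cvg0 : q N @[N --> \oo] --> 0.
Proof.
apply: (@squeeze0 _ (fun N => B N * q N)) tail_cvg0 => N.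
have q0 : 0 <= q N by rewrite exprn_ge0// invr_ge0 ltW// (lt_trans _ r1).
by rewrite q0 /= ler_peMl// size_bound_ge1.
Qed.

Lemma resolvent_error_cvg0 :
  resolvent_error r (krylov_error (step N) (m N).*2) (B N) (q N) @[N --> \oo] --> 0.
Proof.
pose k N := krylov_error (step N) (m N).*2 / (r - 1) + 4 / (r - 1) * (B N * q N).
have k0 : k N @[N --> \oo] --> 0.
  rewrite -[X in _ --> X]addr0; apply: cvgD.
    rewrite -[X in _ --> X](mul0r (r - 1)^-1); apply: cvgMl; exact: krylov_error_cvg0.
  rewrite -[X in _ --> X](mulr0 (4 / (r - 1))); apply: cvgMr; exact: tail_cvg0.
rewrite (_ : (fun N => _) = fun N => k N +
    (k N / (r - 1) + 8 / (r - 1) ^+ 2 * (B N ^+ 2 * q N)) +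
    (k N * (k N + 2 / (r - 1)) + q N / (r - 1))); last first.
  apply/funext => N; rewrite /resolvent_error /k /=.
  have : r - 1 != 0 by rewrite gt_eqF// subr_gt0.
  move: (krylov_error _ _) (B N) (q N) (r - 1) => x y z s s0.
  by field.
rewrite -[X in _ --> X](_ : 0 + (0 / (r - 1) + 8 / (r - 1) ^+ 2 * 0) +
   (0 * (0 + 2 / (r - 1)) + 0 / (r - 1)) = 0); last by rewrite !(mul0r, mulr0, addr0).
apply: cvgD; first apply: cvgD => //.
  apply: cvgD; first exact: cvgMl.
  by apply: cvgMr; exact: square_tail_cvg0.
apply: cvgD; last by apply: cvgMl; exact: ratio_pow_cvg0.
by apply: cvgM => //; apply: cvgD => //; exact: cvg_cst.
Qed.
End ErrorLimits.

(** * Convergence of the overlap *)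

Section Limit.
Context {R : realType}.
Local Notation C := (R[i]).

Lemma trmx_pow n (A : 'M[C]_n.+1) k : A^T ^+ k = (A ^+ k)^T.
Proof.
elim: k => [|k IH]; first by rewrite !expr0 trmx1.
by rewrite exprS exprSr IH -!mulmxE trmx_mul.
Qed.

Lemma cvg_close (u w e : nat -> R) (l : R) :
  (\forall N \near \oo, `|u N - w N| <= e N) -> e N @[N --> \oo] --> 0 ->
  w N @[N --> \oo] --> l -> u N @[N --> \oo] --> l.
Proof.
move=> ue e0 wl; rewrite (_ : (fun N => u N) = fun N => (u N - w N) + w N); last first.
  by apply/funext => N; rewrite subrK.
rewrite -[l]add0r; apply: cvgD => //.
have ne0 : - e N @[N --> \oo] --> 0 by rewrite -[X in _ --> X]oppr0; exact: cvgN.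
apply: squeeze_cvgr ne0 e0; near=> N; rewrite -ler_norml.
by near: N.
Unshelve. all: by end_near. Qed.

Lemma near_le0 (e : nat -> R) (c : R) : 0 < c -> e N @[N --> \oo] --> 0 ->
  \forall N \near \oo, e N <= c.
Proof. by move=> c0 e0; apply: (cvgr_le _ e0). Qed.

Lemma overlap_limit (t : R) (o E : nat -> R) : 1 < t -> E N @[N --> \oo] --> 0 ->
  (\forall N \near \oo, exists z a : C, exists x y : R,
    [/\ o N = x * y / sqmod a, cmod (z - t%:C%C) <= 2 * t ^+ 2 * E N,
        cmod (a - (z * z)^-1) <= E N,
        `|x - (cmod z ^+ 2 - 1)^-1| <= E N & `|y - (cmod z ^+ 2 - 1)^-1| <= E N]) ->
  o N @[N --> \oo] --> (t ^+ 2 / (t ^+ 2 - 1)) ^+ 2.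
Proof.
move=> t1 E0 H; have t0 : 0 < t by exact: lt_trans t1.
have tt : 0 < t ^+ 2 - 1 by rewrite subr_gt0 exprn_egt1.
pose Q N := exists z a : C, exists x y : R,
  [/\ o N = x * y / sqmod a, cmod (z - t%:C%C) <= 2 * t ^+ 2 * E N,
      cmod (a - (z * z)^-1) <= E N,
      `|x - (cmod z ^+ 2 - 1)^-1| <= E N & `|y - (cmod z ^+ 2 - 1)^-1| <= E N].
have {}H : \forall N \near \oo, Q N by [].
have /choice[f hf] N : exists f : C * C * R * R, Q N ->
   [/\ o N = f.1.2 * f.2 / sqmod f.1.1.2,
     cmod (f.1.1.1 - t%:C%C) <= 2 * t ^+ 2 * E N,
     cmod (f.1.1.2 - (f.1.1.1 * f.1.1.1)^-1) <= E N,
     `|f.1.2 - (cmod f.1.1.1 ^+ 2 - 1)^-1| <= E N &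
     `|f.2 - (cmod f.1.1.1 ^+ 2 - 1)^-1| <= E N].
  have [[z [a [x [y h]]]]|nQ] := pselect (Q N); first by exists (z, a, x, y).
  by exists (0, 0, 0, 0) => /nQ.
pose z N := (f N).1.1.1; pose a N := (f N).1.1.2.
have zc : cmod (z N) @[N --> \oo] --> t.
  have tE : 2 * t ^+ 2 * E N @[N --> \oo] --> 0.
    by rewrite -[X in _ --> X](mulr0 (2 * t ^+ 2)); exact: cvgMr.
  apply: (cvg_close _ tE (cvg_cst t)).
  apply: filterS H => N /hf[_ h _ _ _]; apply: le_trans h.
  by have := ler_cmodB (z N) (t%:C)%C; rewrite cmod_real (gtr0_norm t0).
have z2 : cmod (z N) ^+ 2 @[N --> \oo] --> t ^+ 2 by exact: cvgM.
have nc : (cmod (z N) ^+ 2 - 1)^-1 @[N --> \oo] --> (t ^+ 2 - 1)^-1.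
  apply: cvgV; first by rewrite gt_eqF.
  by apply: cvgB => //; exact: cvg_cst.
have xc : (f N).1.2 @[N --> \oo] --> (t ^+ 2 - 1)^-1.
  by apply: cvg_close E0 nc; apply: filterS H => N /hf[].
have yc : (f N).2 @[N --> \oo] --> (t ^+ 2 - 1)^-1.
  by apply: cvg_close E0 nc; apply: filterS H => N /hf[].
have ac : cmod (a N) @[N --> \oo] --> (t ^+ 2)^-1.
  have t2 : t ^+ 2 != 0 by rewrite expf_neq0// gt_eqF.
  apply: cvg_close E0 (cvgV t2 z2); apply: filterS H => N /hf[_ _ h _ _].
  apply: le_trans h; apply: le_trans (ler_cmodB _ _).
  by rewrite cmodV cmodM.
have -> : (t ^+ 2 / (t ^+ 2 - 1)) ^+ 2 =
    (t ^+ 2 - 1)^-1 * (t ^+ 2 - 1)^-1 / ((t ^+ 2)^-1 * (t ^+ 2)^-1).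
  by have := lt0r_neq0 tt; have := lt0r_neq0 t0; move=> h1 h2; field; rewrite h1 h2.
have lc : (f N).1.2 * (f N).2 / (cmod (a N) * cmod (a N)) @[N --> \oo] -->
    (t ^+ 2 - 1)^-1 * (t ^+ 2 - 1)^-1 / ((t ^+ 2)^-1 * (t ^+ 2)^-1).
  apply: cvgM; first exact: cvgM.
  apply: cvgV; last exact: cvgM.
  by rewrite mulf_neq0// invr_eq0 expf_neq0// gt_eqF.
apply: cvg_close (cvg_cst 0) lc; apply: filterS H => N /hf[-> _ _ _ _].
by rewrite -cmod_sqr expr2 subrr normr0.
Qed.

Lemma rank_one_overlap_cvg (t : R) (m : nat -> nat)
    (G : forall N, 'M[C]_N.+1) (v : forall N, 'cV[C]_N.+1) :
  1 < t -> (forall N, (m N ^ 8 <= N.+1 < (m N).+1 ^ 8)%N) ->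
  (forall N, discr (rank_one_perturbation (G N) (v N) t) != 0) ->
  (\forall N \near \oo,
    [/\ hess ((m N)%:R ^+ 3)^-1 (m N).*2 (G N) (v N),
        hess ((m N)%:R ^+ 3)^-1 (m N).*2 (G N)^T (adjmx (v N))^T &
        forall j, hess ((m N)%:R ^+ 3)^-1 (m N).*2 (G N) (ec j)]) ->
  diag_overlap (rank_one_perturbation (G N) (v N) t)
     (outlier (rank_one_perturbation (G N) (v N) t) t) @[N --> \oo] -->
  (t ^+ 2 / (t ^+ 2 - 1)) ^+ 2.
Proof.
move=> t1 mE D0 H; pose r := (t + 1) / 2; have r1 : 1 < r by rewrite /r; lra.
have t0 : 0 < t by exact: lt_trans t1.
pose B N : R := N.+1%:R * (N.+1%:R * (N.+1%:R * 2)).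
pose E N := resolvent_error r (krylov_error ((m N)%:R ^+ 3)^-1 (m N).*2) (B N) (r^-1 ^+ m N).
have E0 : E N @[N --> \oo] --> 0 := resolvent_error_cvg0 mE r1.
apply: (overlap_limit t1 E0).
pose s := 2 * t * (1 + 2 * t); have s0 : 0 < s by rewrite !mulr_gt0// addr_gt0// mulr_gt0.
have t10 : 0 < (t - 1) / 2 by rewrite divr_gt0// subr_gt0.
have c1 : 0 < (t - 1) / 2 / s by rewrite divr_gt0.
have c2 : 0 < 1 / s by rewrite divr_gt0.
have h0 : 0 < 2^-1 :> R by rewrite invr_gt0.
have /cvgnyPge /(_ 2%N) m2 := root_cvg_infty mE.
near=> N.
have mN : (1 < m N)%N by near: N.
have m0 : (0 < m N)%N by exact: ltnW.
have kn : ((m N).*2 < N.+1)%N.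
  have /andP[h _] := mE N; apply: leq_trans h.
  rewrite expnS -muln2 ltn_pmul2l//; apply: (@leq_trans (2 ^ 7)%N) => //.
  by rewrite leq_exp2r.
have e1 : krylov_error (((m N)%:R : R) ^+ 3)^-1 (m N).*2 <= 1.
  by near: N; apply: near_le0; [exact: ltr01|exact: krylov_error_cvg0].
have b1 : B N * r^-1 ^+ m N <= 2^-1.
  by near: N; apply: near_le0; [exact: h0|exact: tail_cvg0].
have s1 : E N <= (t - 1) / 2 / s by near: N; apply: near_le0.
have s2 : E N <= 1 / s by near: N; apply: near_le0.
have dl := step_range (R := R) mE N.
have [h1 h2 h3] : [/\ hess ((m N)%:R ^+ 3)^-1 (m N).*2 (G N) (v N),
        hess ((m N)%:R ^+ 3)^-1 (m N).*2 (G N)^T (adjmx (v N))^T &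
        forall j, hess ((m N)%:R ^+ 3)^-1 (m N).*2 (G N) (ec j)] by near: N.
have ent2 k i j : (k <= m N)%N -> cmod ((G N ^+ k) i j) <= 2.
  move=> km; apply: (hess_pow_entry i dl kn e1 _ (h3 j)).
  by apply: leq_trans km _; rewrite -addnn leq_addr.
have ent2' k i j : (k <= m N)%N -> cmod (((G N)^T ^+ k) i j) <= 2.
  by move=> km; rewrite trmx_pow mxE; exact: ent2.
have Q1 := hess_estimates m0 kn r1 dl e1 b1 ent2 h1.
have Q2 := hess_estimates m0 kn r1 dl e1 b1 ent2' h2.
have EN : 0 <= E N.
  have [_ fE _ _] := Q1; apply: le_trans (cmod_ge0 _) (fE (r%:C)%C _).
  by rewrite cmod_real ler_norm.
apply: (@hess_overlap R N t r (E N) (G N) (v N)) => //.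
- by rewrite -/s mulrC -ler_pdivlMr.
- by rewrite -/s mulrC -ler_pdivlMr.
Unshelve. all: by end_near. Qed.
End Limit.

Theorem theorem3 (R : realType) (d : measure_display) (T : measurableType d)
    (P : probability T R) (t : R) (ht : 1 < t)
    (G : forall N : nat, T -> 'M[R[i]]_N.+1)
    (v : forall N : nat, T -> 'cV[R[i]]_N.+1)
    (hG : forall N, ginibre P (G N))
    (hv : forall N, random_unit_vector (v N))
    (hGv : forall N, independent2 P (sigma_mx (G N)) (sigma_mx (v N))) :
  {ae P, forall w : T,
    (fun N : nat =>
       let Gt := rank_one_perturbation (G N w) (v N w) t in
       diag_overlap Gt (outlier Gt t)) @ \oo
    --> (t ^+ 2 / (t ^+ 2 - 1)) ^+ 2}.
Proof.
have /choice[m mE] := eighth_root.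
have [c c0 hc] := @risk_bound R.
have D : {ae P, forall w N, discr (rank_one_perturbation (G N w) (v N w) t) != 0}.
  by apply/ae_foralln => N; exact: ae_discr_perturbation.
have Hs : {ae P, forall w, \forall N \near \oo, (1 < m N)%N ->
    all_hess (G N) (v N) ((m N)%:R ^+ 3)^-1 (m N).*2 w}.
  apply: (eventually_of_holds_off c0) => N.
  have [m1|m1] := ltnP 1 (m N); last first.
    by apply: holds_offT => [|w]; [rewrite divr_ge0|].
  have kn : ((m N).*2 < N.+1)%N.
    have /andP[h _] := mE N; apply: leq_trans h.
    rewrite expnS -muln2 ltn_pmul2l ?(ltnW m1)//; apply: (@leq_trans (2 ^ 7)%N) => //.
    by rewrite leq_exp2r.
  have := all_hess_off (hG N) (hv N) (hGv N) (step_range (R := R) mE N) kn.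
  by apply: holds_offW => //; exact: hc (root_gt0 mE N) (mE N).
apply: filterS2 D Hs => w Dw Hw.
apply: (rank_one_overlap_cvg ht mE Dw).
have /cvgnyPge /(_ 2%N) m2 := root_cvg_infty mE.
by apply: filterS2 m2 Hw => N m1 /(_ m1).
Qed.
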